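(* The following time and storage complexities can be achieved for computing the worst-case load $\max_{q\in\mathcal{Q}}\sum_{i\in S}q_i$ of a route that visits a set of customers $S\subseteq V_C=\{1,\dots,n\}$, for each of the uncertainty sets $\mathcal{Q}$ defined in the context. Here ''from scratch'' refers to computing the worst-case load directly for the given $S$, and ''incremental update'' refers to the complexity of updating the worst-case load when a single customer is added to or removed from $S$. - $\mathcal{Q}_B$: from scratch, time $O(|S|)$; incremental update, time $O(1)$ and storage $O(L)$. - $\mathcal{Q}_F$: from scratch, time $O(|S|F+F\log F)$; incremental update, time $O(F\log F)$ and storage $O(F)$. - $\mathcal{Q}_E$ (axis-parallel): from scratch, time $O(|S|)$; incremental update, time $O(1)$ and storage $O(1)$. - $\mathcal{Q}_E$ (general): from scratch, time $O(|S|n)$; incremental update, time $O(n)$ and storage $O(n)$. - $\mathcal{Q}_G$: from scratch, time $O(|S|)$; incremental update, time $O(\log(|S|))$ and storage $O(n)$; these last two can be improved to $O(\log(\Gamma))$ and $O(\Gamma)$, respectively, if only additions to $S$ are considered. - $\mathcal{Q}_D$: from scratch, time $O(|S|D)$; incremental update, time $O(D)$ and storage $O(D)$.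
   Context: There are $n$ customers $V_C=\{1,\dots,n\}$ with uncertain demand vector $q$. The worst-case load of a route over an uncertainty set $\mathcal{Q}$ is the maximum over $q\in\mathcal{Q}$ of the total demand of the customers it visits. Uncertainty sets are assumed to be non-empty, closed and bounded subsets of $\mathbb{R}^n_+$. Budget set: $\mathcal{Q}_B=\{q\in[\underline q,\bar q]:\sum_{i\in B_l}q_i\le b_l\ \ \forall l\in\{1,\dots,L\}\}$, where $L\in\mathbb{N}$, $\underline q\le\bar q$, $B_l\subseteq V_C$, $b_l\in\mathbb{R}_+$ with $\sum_{i\in B_l}\underline q_i\le b_l$, and the sets $B_1,\dots,B_L$ are pairwise disjoint. Factor model: $\mathcal{Q}_F=\{q\in\mathbb{R}^n: q=q^0+\Psi\xi\text{ for some }\xi\in[-1,1]^F\text{ with }|e^\top\xi|\le\beta F\}$, where $q^0\in\mathbb{R}^n_+$, $F\in\mathbb{N}$, $\Psi\in\mathbb{R}^{n\times F}$, $\beta\in[0,1]$, and $e$ is the vector of ones. Ellipsoidal set: $\mathcal{Q}_E=\{q\in\mathbb{R}^n: q=q^0+\Sigma^{1/2}\xi\text{ for some }\xi\in\mathbb{R}^n\text{ with }\xi^\top\xi\le1\}$, where $q^0\in\mathbb{R}^n_+$ and $\Sigma$ is a symmetric positive semidefinite $n\times n$ matrix; the set is called axis-parallel if $\Sigma$ is diagonal. Cardinality-constrained set: $\mathcal{Q}_G=\{q\in[q^0,q^0+\hat q]: q=q^0+(\hat q\circ\xi)\text{ for some }\xi\in[0,1]^n\text{ with }e^\top\xi\le\Gamma\}$,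 where $q^0,\hat q\in\mathbb{R}^n_+$, $\Gamma\in[0,n]$, and $\circ$ is the componentwise product. Discrete set: $\mathcal{Q}_D=\mathrm{conv}\{q^{(j)}:j=1,\dots,D\}$, where $D\in\mathbb{N}$ and $q^{(1)},\dots,q^{(D)}\in\mathbb{R}^n_+$ are distinct.
   Formalization: For Q_B, the from-scratch time O(|S|) is proved after a preprocessing of the instance, independent of S and linear in its size; without it O(|S|) fails, since for B_1=V_C and S={1} the load depends on the lower bounds of all customers. *)

(* Defs.v *)
From HB Require Import structures.
From mathcomp Require Import all_boot all_order all_algebra.
From mathcomp Require Import all_classical reals topology normedtype.

Set Implicit Arguments.
Unset Strict Implicit.
Unset Printing Implicit Defensive.
Import Order.TTheory GRing.Theory Num.Theory.
Import numFieldNormedType.Exports.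
Local Open Scope classical_set_scope.
Local Open Scope ring_scope.

(* The machine is a real RAM. Programs are uniform: they mention no reals other
   than casts of naturals, and their syntax does not depend on the instance.
   Memory consists of arrays with static names [a : nat] (a program mentions
   finitely many), in two sorts: cells holding a machine integer and cells
   holding an exact real. A scalar variable is cell 0 of an array. Cells are
   initially zero.

   Only region [Work] is writable. [Inst] holds the instance, [Table] the
   result of a preprocessing of the instance, and [Query] the argument of the
   current call (a list of customers or a single customer). *)

Inductive region := Inst | Table | Query | Work.

Inductive iexp :=
| ILit of nat
| IGet of region & nat & iexp
| IAdd of iexp & iexp
| ISub of iexp & iexp
| IMul of iexp & iexp
| IDiv of iexp & iexp.

Inductive rexp :=
| RNat of iexp
| RGet of region & nat & iexp
| RAdd of rexp & rexp
| RSub of rexp & rexp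
| RMul of rexp & rexp
| RDiv of rexp & rexp
| RSqrt of rexp.

Inductive bexp :=
| BLeI of iexp & iexp
| BLeR of rexp & rexp
| BNot of bexp
| BAnd of bexp & bexp.

Inductive cmd :=
| Skip
| SetI of nat & iexp & iexp
| SetR of nat & iexp & rexp
| Seq of cmd & cmd
| If of bexp & cmd & cmd
| While of bexp & cmd.

Record memory (R : Type) := Memory {
  icell : nat -> nat -> nat;
  rcell : nat -> nat -> R
}.

Section Semantics.
Variable R : realType.
Implicit Types (m : memory R) (env : region -> memory R).

Definition zero_memory : memory R := Memory (fun _ _ => 0%N) (fun _ _ => 0).

Definition store (V : Type) (f : nat -> nat -> V) a k v : nat -> nat -> V :=
  fun a' k' => if (a' == a) && (k' == k) then v else f a' k'.

Definition environment (inst table query work : memory R) (r : region) :=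
  match r with
  | Inst => inst | Table => table | Query => query | Work => work
  end.

Fixpoint ieval env (e : iexp) : nat :=
  match e with
  | ILit k => k
  | IGet r a e => icell (env r) a (ieval env e)
  | IAdd e f => (ieval env e + ieval env f)%N
  | ISub e f => (ieval env e - ieval env f)%N
  | IMul e f => (ieval env e * ieval env f)%N
  | IDiv e f => (ieval env e %/ ieval env f)%N
  end.

Fixpoint reval env (e : rexp) : R :=
  match e with
  | RNat e => (ieval env e)%:R
  | RGet r a e => rcell (env r) a (ieval env e)
  | RAdd e f => reval env e + reval env f
  | RSub e f => reval env e - reval env f
  | RMul e f => reval env e * reval env f
  | RDiv e f => reval env e / reval env f
  | RSqrt e => Num.sqrt (reval env e)
  end.

Fixpoint beval env (b : bexp) : bool :=
  match b with
  | BLeI e f => (ieval env e <= ieval env f)%N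
  | BLeR e f => reval env e <= reval env f
  | BNot b => ~~ beval env b
  | BAnd b c => beval env b && beval env c
  end.

(* [exec inst table query W M c m t m']: started in work memory [m], the
   command [c] halts after [t] steps in work memory [m'].
   - A step is one assignment or one test. Expressions have a size fixed by
     the program, so counting their operators would change [t] by at most a
     constant factor.
   - [W] bounds every stored integer. With [W] linear in the size of the
     instance, this is the usual word size of logarithmically many bits; it
     rules out packing much data into one integer.
   - [M] bounds the index of every written cell. A program names finitely
     many arrays, so it uses O(M) cells of storage, scratch space included.
   A program exceeding [W] or [M] is stuck, i.e. has no execution. *)
Inductive exec (inst table query : memory R) (W M : nat) :
    cmd -> memory R -> nat -> memory R -> Prop :=
| exec_skip m :
    exec inst table query W M Skip m 1 m
| exec_seti a e f m k v :
    k = ieval (environment inst table query m) e ->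
    v = ieval (environment inst table query m) f ->
    (k < M)%N -> (v <= W)%N ->
    exec inst table query W M (SetI a e f) m 1
      (Memory (store (icell m) a k v) (rcell m))
| exec_setr a e f m k v :
    k = ieval (environment inst table query m) e ->
    v = reval (environment inst table query m) f ->
    (k < M)%N ->
    exec inst table query W M (SetR a e f) m 1
      (Memory (icell m) (store (rcell m) a k v))
| exec_seq c1 c2 m1 m2 m3 t1 t2 :
    exec inst table query W M c1 m1 t1 m2 ->
    exec inst table query W M c2 m2 t2 m3 ->
    exec inst table query W M (Seq c1 c2) m1 (t1 + t2) m3
| exec_if b c1 c2 m m' t :
    exec inst table query W M
      (if beval (environment inst table query m) b then c1 else c2) m t m' ->
    exec inst table query W M (If b c1 c2) m t.+1 m'
| exec_while_done b c m :
    beval (environment inst table query m) b = false ->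
    exec inst table query W M (While b c) m 1 m
| exec_while_step b c m1 m2 m3 t1 t2 :
    beval (environment inst table query m1) b = true ->
    exec inst table query W M c m1 t1 m2 ->
    exec inst table query W M (While b c) m2 t2 m3 ->
    exec inst table query W M (While b c) m1 (t1 + t2).+1 m3.

Definition output m : R := rcell m 0 0.

Definition memory_of (ints : seq (seq nat)) (reals : seq (seq R)) : memory R :=
  Memory (fun a k => nth 0%N (nth [::] ints a) k)
         (fun a k => nth 0 (nth [::] reals a) k).

End Semantics.

Definition is_worst_case_load (R : realType) (n : nat) (Q : set 'cV[R]_n)
    (S : {set 'I_n}) (v : R) : Prop :=
  (exists2 q, Q q & \sum_(i in S) q i 0 = v) /\
  (forall q, Q q -> \sum_(i in S) q i 0 <= v).

Definition uncertainty_set (R : realType) (n : nat) (Q : set 'cV[R]_n) : Prop :=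
  [/\ Q !=set0, closed Q,
      exists K : R, forall q i, Q q -> `|q i 0| <= K
    & forall q i, Q q -> 0 <= q i 0].

(* The two lists of lists are the encoding of the instance in memory: the
   [a]-th list is the content of array [a]. *)
Record problem (R : realType) := Problem {
  customers : nat;
  int_data : seq (seq nat);
  real_data : seq (seq R);
  uset : set 'cV[R]_customers
}.
Arguments uset {R} p _.

Section Complexity.
Variable R : realType.

Definition inst_memory (p : problem R) : memory R :=
  memory_of (int_data p) (real_data p).

Definition inst_size (p : problem R) : nat :=
  (sumn (map size (int_data p)) + sumn (map size (real_data p)))%N.

(* O(f) with constant [c]: the usual convention that [f] stands for
   [max(1, f)], needed since for example [log 1 = 0] and [S] may be empty. *)
Definition bigO (c f : nat) : nat := (c * f.+1)%N.

Definition log2 (k : nat) : nat := trunc_log 2 k.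

Definition route_query (n : nat) (s : seq 'I_n) : memory R :=
  memory_of [:: [:: size s]; map val s] [::].

Definition customer_query (n : nat) (i : 'I_n) : memory R :=
  memory_of [:: [:: val i]] [::].

(* [X] indexes the instances of a class. The time bound [T x k], for [k] the
   cardinality of the route, is uniform in the instance: [prog] and [c] are
   chosen before [x]. The customers of the route are given in arbitrary order.
   [pre] is run once per instance, before the route is known, in time linear
   in the size of the instance; its final work memory becomes [Table]. *)
Definition from_scratch (X : Type) (P : X -> problem R) (pre : cmd)
    (T : X -> nat -> nat) : Prop :=
  exists (prog : cmd) (c : nat), forall x : X,
    uncertainty_set (uset (P x)) ->
    let inst := inst_memory (P x) in
    let W := bigO c (inst_size (P x)) in
    exists (t0 : nat) (table : memory R),
      [/\ exec inst (zero_memory R) (zero_memory R) W W pre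
            (zero_memory R) t0 table,
          (t0 <= bigO c (inst_size (P x)))%N
        & forall (S : {set 'I_(customers (P x))}) (s : seq 'I_(customers (P x))),
            uniq s -> s =i S ->
            exists (t : nat) (m : memory R),
              [/\ exec inst table (route_query s) W W prog (zero_memory R) t m,
                  (t <= bigO c (T x #|S|))%N
                & is_worst_case_load (uset (P x)) S (output m)]].

(* [maintained ... S m]: [m] can result from initializing the data structure
   for the empty route and then performing any sequence of updates (additions,
   and also removals if [removals] holds) that leads to the route [S]. *)
Inductive maintained (n : nat) (inst : memory R) (W M : nat) (removals : bool)
    (init add rem : cmd) : {set 'I_n} -> memory R -> Prop :=
| maintained_init t m :
    exec inst (zero_memory R) (zero_memory R) W M init (zero_memory R) t m ->
    maintained inst W M removals init add rem finset.set0 m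
| maintained_add (S : {set 'I_n}) (i : 'I_n) t m m' :
    maintained inst W M removals init add rem S m -> i \notin S ->
    exec inst (zero_memory R) (customer_query i) W M add m t m' ->
    maintained inst W M removals init add rem (i |: S)%SET m'
| maintained_rem (S : {set 'I_n}) (i : 'I_n) t m m' :
    removals -> maintained inst W M removals init add rem S m -> i \in S ->
    exec inst (zero_memory R) (customer_query i) W M rem m t m' ->
    maintained inst W M removals init add rem (S :\ i)%SET m'.

(* The output is the worst-case load of the current route at all times. The
   time bound [T x k], for [k] the cardinality of the route before the update,
   holds for every single update (it is not amortized). The storage bound
   [Sto x] covers everything written by initialization and updates; the
   read-only instance is not counted. *)
Definition incremental (X : Type) (P : X -> problem R) (removals : bool)
    (T : X -> nat -> nat) (Sto : X -> nat) : Prop :=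
  exists (init add rem : cmd) (c : nat), forall x : X,
    uncertainty_set (uset (P x)) ->
    let inst := inst_memory (P x) in
    let W := bigO c (inst_size (P x)) in
    let M := bigO c (Sto x) in
    (exists (t : nat) (m : memory R),
       exec inst (zero_memory R) (zero_memory R) W M init (zero_memory R) t m /\
       (t <= bigO c (inst_size (P x)))%N) /\
    forall (S : {set 'I_(customers (P x))}) (m : memory R),
      maintained inst W M removals init add rem S m ->
      [/\ is_worst_case_load (uset (P x)) S (output m),
          forall i, i \notin S -> exists (t : nat) (m' : memory R),
            exec inst (zero_memory R) (customer_query i) W M add m t m' /\
            (t <= bigO c (T x #|S|))%N
        & removals -> forall i, i \in S -> exists (t : nat) (m' : memory R),
            exec inst (zero_memory R) (customer_query i) W M rem m t m' /\
            (t <= bigO c (T x #|S|))%N].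

End Complexity.

Definition vec (R : Type) (n : nat) (v : 'cV[R]_n) : seq R :=
  [seq v i 0 | i <- enum 'I_n].

(* row-major *)
Definition flat (R : Type) (m n : nat) (A : 'M[R]_(m, n)) : seq R :=
  [seq A i j | i <- enum 'I_m, j <- enum 'I_n].

Section Sets.
Variable R : realType.

Record budget := Budget {
  B_n : nat;
  B_L : nat;
  B_lo : 'cV[R]_B_n;
  B_hi : 'cV[R]_B_n;
  B_B : 'I_B_L -> {set 'I_B_n};
  B_b : 'I_B_L -> R;
  B_lo_hi : forall i, B_lo i 0 <= B_hi i 0;
  B_b_ge0 : forall l, 0 <= B_b l;
  B_lo_b : forall l, \sum_(i in B_B l) B_lo i 0 <= B_b l;
  B_disjoint : forall k l, k != l -> (B_B k :&: B_B l)%SET = finset.set0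
}.

Arguments B_B : clear implicits.
Arguments B_b : clear implicits.

Definition budget_set (x : budget) : set 'cV[R]_(B_n x) :=
  [set q : 'cV[R]_(B_n x) | (forall i, B_lo x i 0 <= q i 0 <= B_hi x i 0) /\
           (forall l, \sum_(i in B_B x l) q i 0 <= B_b x l)].

(* The disjoint sets are encoded by giving, for each customer, the index of
   the set containing it, and [B_L x] if there is none. *)
Definition budget_index (x : budget) (i : 'I_(B_n x)) : nat :=
  if [pick l | i \in B_B x l] is Some l then val l else B_L x.

Definition budget_problem (x : budget) : problem R :=
  Problem [:: [:: B_n x; B_L x]; [seq budget_index i | i <- enum 'I_(B_n x)]]
          [:: vec (B_lo x); vec (B_hi x); [seq B_b x l | l <- enum 'I_(B_L x)]]
          (budget_set (x := x)).

Record factor := Factor {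
  F_n : nat;
  F_F : nat;
  F_q0 : 'cV[R]_F_n;
  F_Psi : 'M[R]_(F_n, F_F);
  F_beta : R;
  F_F_gt0 : (0 < F_F)%N;
  F_q0_ge0 : forall i, 0 <= F_q0 i 0;
  F_beta01 : 0 <= F_beta <= 1
}.

Definition factor_set (x : factor) : set 'cV[R]_(F_n x) :=
  [set q : 'cV[R]_(F_n x) | exists xi : 'cV[R]_(F_F x),
     [/\ forall k, -1 <= xi k 0 <= 1,
         `|\sum_k xi k 0| <= F_beta x * (F_F x)%:R
       & q = F_q0 x + F_Psi x *m xi]].

Definition factor_problem (x : factor) : problem R :=
  Problem [:: [:: F_n x; F_F x]]
          [:: vec (F_q0 x); flat (F_Psi x); [:: F_beta x]]
          (factor_set (x := x)).

Definition sym_psd (n : nat) (A : 'M[R]_n) : Prop :=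
  A^T = A /\ forall v : 'cV[R]_n, 0 <= (v^T *m A *m v) 0 0.

Record ellipsoid := Ellipsoid {
  E_n : nat;
  E_q0 : 'cV[R]_E_n;
  E_Sigma : 'M[R]_E_n;
  E_q0_ge0 : forall i, 0 <= E_q0 i 0;
  E_Sigma_psd : sym_psd E_Sigma
}.

(* [A] is the (unique) symmetric positive semidefinite square root of
   [E_Sigma x]. *)
Definition ellipsoid_set (x : ellipsoid) : set 'cV[R]_(E_n x) :=
  [set q : 'cV[R]_(E_n x) | exists (A : 'M[R]_(E_n x)) (xi : 'cV[R]_(E_n x)),
     [/\ sym_psd A, A *m A = E_Sigma x,
         (xi^T *m xi) 0 0 <= 1
       & q = E_q0 x + A *m xi]].

Definition ellipsoid_problem (x : ellipsoid) : problem R :=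
  Problem [:: [:: E_n x]] [:: vec (E_q0 x); flat (E_Sigma x)]
          (ellipsoid_set (x := x)).

Record axis_ellipsoid := AxisEllipsoid {
  A_ellipsoid : ellipsoid;
  A_diag : is_diag_mx (E_Sigma A_ellipsoid)
}.

Definition axis_ellipsoid_problem (x : axis_ellipsoid) : problem R :=
  ellipsoid_problem (A_ellipsoid x).

Record cardinality := Cardinality {
  G_n : nat;
  G_q0 : 'cV[R]_G_n;
  G_dev : 'cV[R]_G_n;
  G_Gamma : R;
  G_q0_ge0 : forall i, 0 <= G_q0 i 0;
  G_dev_ge0 : forall i, 0 <= G_dev i 0;
  G_Gamma_bnd : 0 <= G_Gamma <= G_n%:R
}.

Definition cardinality_set (x : cardinality) : set 'cV[R]_(G_n x) :=
  [set q : 'cV[R]_(G_n x) | (forall i, G_q0 x i 0 <= q i 0 <= G_q0 x i 0 + G_dev x i 0) /\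
     exists xi : 'cV[R]_(G_n x),
       [/\ forall i, 0 <= xi i 0 <= 1,
           \sum_i xi i 0 <= G_Gamma x
         & forall i, q i 0 = G_q0 x i 0 + G_dev x i 0 * xi i 0]].

Definition cardinality_problem (x : cardinality) : problem R :=
  Problem [:: [:: G_n x]] [:: vec (G_q0 x); vec (G_dev x); [:: G_Gamma x]]
          (cardinality_set (x := x)).

Record discrete := Discrete {
  D_n : nat;
  D_D : nat;
  D_q : 'I_D_D -> 'cV[R]_D_n;
  D_D_gt0 : (0 < D_D)%N;
  D_q_ge0 : forall j i, 0 <= D_q j i 0;
  D_distinct : injective D_q
}.

Arguments D_q : clear implicits.

Definition discrete_set (x : discrete) : set 'cV[R]_(D_n x) :=
  [set q : 'cV[R]_(D_n x) | exists w : 'I_(D_D x) -> R,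
     [/\ forall j, 0 <= w j, \sum_j w j = 1
       & q = \sum_j w j *: D_q x j]].

Definition discrete_problem (x : discrete) : problem R :=
  Problem [:: [:: D_n x; D_D x]]
          [:: [seq D_q x j i 0 | j <- enum 'I_(D_D x), i <- enum 'I_(D_n x)]]
          (discrete_set (x := x)).

End Sets.

(* Main.v *)
(** For a route [S], the worst-case load over a budget set is
    [sum_S lo + sum_l min (sum_(S :&: B_l) (hi - lo), b_l - sum_(B_l) lo)], over
    an ellipsoid it is [sum_S q0 + sqrt (1_S^T Sigma 1_S)], and over a discrete
    set it is a maximum of [D] sums; all of these are kept up to date customer by
    customer, and computing from scratch amounts to inserting the customers one
    at a time.

    Cardinality-constrained sets and factor models both reduce to a threshold
    [lam] with [#{d > lam} <= s <= #{d >= lam}]: by linear programming duality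
    the optimal value is then read off [lam] in one pass. Such a [lam] is found
    in linear time by prune and search. The pivot is obtained from a bottom-up
    merge sort in which every second merge keeps only every other element: run
    lengths double while the number of elements halves, so the total time is
    linear, and the accumulated rank errors form a geometric series that leaves
    at least a quarter of the elements on each side of the pivot.

    Under updates, the customers of the route are split into the [Gamma] greatest
    deviations [T] and the rest [U]; an update changes [T] by at most two
    elements, found with tournament trees for the minimum of [T] and the maximum
    of [U]. The trees share the slots [1..#|S|] of an implicit binary tree, so
    that their depth is logarithmic in the size of the route. *)

Require Import Defs.
From HB Require Import structures.
From mathcomp Require Import all_boot all_order all_algebra.
From mathcomp Require Import all_classical reals.
From mathcomp Require Import zify ring lra.

Set Implicit Arguments.
Unset Strict Implicit.
Unset Printing Implicit Defensive.
Import Order.TTheory GRing.Theory Num.Theory.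
Local Open Scope nat_scope.

(** * Time-bounded Hoare logic for the real RAM *)

(** The command language is deterministic and has no recursion, so a random pivot is excluded and
    recursive median of medians would need an explicit stack; thinning merge sort consists of flat
    loops over two arrays. Full sorting would already break the [O(|S|)] bound for
    cardinality-constrained sets. Factor models could afford a logarithm but share the same routine:
    only the [F] factor loads are maintained, and the optimum is recomputed after each update.

    For cardinality-constrained sets under updates, [T] has as many members as the integral part of
    [Gamma], and the fractional part multiplies the maximum of [U]; the tree over [U] thus serves
    both the exchange and the output. Without removals, a customer that is not among the greatest
    deviations, one more than [T] holds, never returns. Storage then no longer depends on [n]: the
    array that locates the slot of a given customer serves removals only and disappears.

    Storage is charged by the largest index written, so programs may read beyond it and find zeros
    there. *)

Fixpoint iwrites (c : cmd) : seq nat :=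
  match c with
  | SetI a _ _ => [:: a]
  | Seq c1 c2 | If _ c1 c2 => iwrites c1 ++ iwrites c2
  | While _ c => iwrites c
  | _ => [::]
  end.

Fixpoint rwrites (c : cmd) : seq nat :=
  match c with
  | SetR a _ _ => [:: a]
  | Seq c1 c2 | If _ c1 c2 => rwrites c1 ++ rwrites c2
  | While _ c => rwrites c
  | _ => [::]
  end.

(* Meaningful for loop-free commands only. *)
Fixpoint cost (c : cmd) : nat :=
  match c with
  | Seq c1 c2 => cost c1 + cost c2
  | If _ c1 c2 => (maxn (cost c1) (cost c2)).+1
  | _ => 1
  end.

Section Wp.
Variable R : realType.
Variables (inst table query : memory R) (W M : nat).
Implicit Types (c : cmd) (m : memory R) (Q : memory R -> Prop).

Local Notation E := (environment inst table query).
Local Notation exec := (exec inst table query W M).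

(** The existential is a claim of total correctness: a command that loops or exceeds [W] or [M] has
    no execution, so every instance of [wp] also certifies termination and the resource bounds. *)
Definition wp c m k Q : Prop :=
  exists t m', [/\ exec c m t m', (t <= k)%N & Q m'].

Definition agree (ia ra : seq nat) m m' : Prop :=
  (forall a, a \notin ia -> icell m' a = icell m a) /\
  (forall a, a \notin ra -> rcell m' a = rcell m a).

Definition seti m a k v : memory R := Memory (store (icell m) a k v) (rcell m).
Definition setr m a k v : memory R := Memory (icell m) (store (rcell m) a k v).

(* The weakest precondition of a loop-free command, defined by recursion so that
   simplification executes the command symbolically. *)
Fixpoint lf c m Q : Prop :=
  match c with
  | Skip => Q m
  | SetI a e f => [/\ (ieval (E m) e < M)%N, (ieval (E m) f <= W)%N
                    & Q (seti m a (ieval (E m) e) (ieval (E m) f))]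
  | SetR a e f => (ieval (E m) e < M)%N /\
                  Q (setr m a (ieval (E m) e) (reval (E m) f))
  | Seq c1 c2 => lf c1 m (fun m' => lf c2 m' Q)
  | If b c1 c2 => if beval (E m) b then lf c1 m Q else lf c2 m Q
  | While _ _ => False
  end.

(** [maintained] speaks of arbitrary executions while [wp] exhibits one; determinism identifies the
    two. *)
Lemma exec_det c m t1 m1 t2 m2 :
  exec c m t1 m1 -> exec c m t2 m2 -> t1 = t2 /\ m1 = m2.
Proof.
move=> H; elim: H t2 m2 => {c m t1 m1}.
- by move=> m t2 m2 H; inversion H.
- by move=> a e f m k v -> -> _ _ t2 m2 H; inversion H; subst.
- by move=> a e f m k v -> -> _ t2 m2 H; inversion H; subst.
- move=> c1 c2 ma mb mc t1 t2 _ IH1 _ IH2 t m2 H; inversion H; subst.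
  match goal with h : Defs.exec _ _ _ _ _ c1 _ _ _ |- _ => have [? ?] := IH1 _ _ h end; subst.
  by match goal with h : Defs.exec _ _ _ _ _ c2 _ _ _ |- _ => have [-> ->] := IH2 _ _ h end.
- move=> b c1 c2 m m' t _ IH t2 m2 H; inversion H; subst.
  by match goal with h : Defs.exec _ _ _ _ _ (if _ then _ else _) _ _ _ |- _ => have [-> ->] := IH _ _ h end.
- by move=> b c m Hb t2 m2 H; inversion H; subst => //; congruence.
- move=> b c m1 m2 m3 t1 t2 Hb _ IH1 _ IH2 t m H; inversion H; subst.
    by congruence.
  match goal with h : Defs.exec _ _ _ _ _ c _ _ _ |- _ => have [? ?] := IH1 _ _ h end; subst.
  by match goal with h : Defs.exec _ _ _ _ _ (While _ _) _ _ _ |- _ => have [-> ->] := IH2 _ _ h end.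
Qed.

Lemma exec_agree c m t m' : exec c m t m' -> agree (iwrites c) (rwrites c) m m'.
Proof.
elim=> {c m t m'} //=.
- move=> a e f m k v _ _ _ _; split=> // a'; rewrite inE => /negbTE h /=.
  by apply/funext => k'; rewrite /store h.
- move=> a e f m k v _ _ _; split=> // a'; rewrite inE => /negbTE h /=.
  by apply/funext => k'; rewrite /store h.
- move=> c1 c2 m1 m2 m3 t1 t2 _ [i1 r1] _ [i2 r2].
  by split=> a; rewrite mem_cat negb_or => /andP[? ?];
     rewrite ?i2 ?i1 ?r2 ?r1.
- move=> b c1 c2 m m' t _ [i r]; split=> a; rewrite mem_cat negb_or => /andP[? ?].
    by apply: i; case: ifP.
  by apply: r; case: ifP.
- by move=> b c m1 m2 m3 t1 t2 _ _ [i1 r1] _ [i2 r2];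
  split=> a h; rewrite ?i2 ?i1 ?r2 ?r1.
Qed.

Lemma wp_weaken c m k k' Q Q' :
  wp c m k Q -> (k <= k')%N -> (forall m', Q m' -> Q' m') -> wp c m k' Q'.
Proof.
move=> [t [m' [h1 h2 h3]]] kk' QQ'; exists t, m'; split=> //; last exact: QQ'.
exact: leq_trans kk'.
Qed.

Lemma wp_frame c m k Q :
  wp c m k Q ->
  wp c m k (fun m' => Q m' /\ agree (iwrites c) (rwrites c) m m').
Proof.
by move=> [t [m' [h1 h2 h3]]]; exists t, m'; split=> //; split=> //;
   exact: exec_agree h1.
Qed.

Lemma wp_seq c1 c2 m k1 k2 Q :
  wp c1 m k1 (fun m' => wp c2 m' k2 Q) -> wp (Seq c1 c2) m (k1 + k2) Q.
Proof.
move=> [t1 [m1 [h1 l1 [t2 [m2 [h2 l2 q]]]]]].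
exists (t1 + t2)%N, m2; split=> //; last exact: leq_add.
exact: exec_seq h1 h2.
Qed.

Lemma wp_if b c1 c2 m k Q :
  wp (if beval (E m) b then c1 else c2) m k Q -> wp (If b c1 c2) m k.+1 Q.
Proof.
by move=> [t [m' [h1 l1 q]]]; exists t.+1, m'; split=> //; exact: exec_if.
Qed.

Lemma wp_lf c m Q : lf c m Q -> wp c m (cost c) Q.
Proof.
elim: c m Q => //=.
- by move=> m Q q; exists 1%N, m; split=> //; exact: exec_skip.
- move=> a e f m Q [h1 h2 q]; exists 1%N; eexists; split=> //; last exact: q.
  exact: exec_seti.
- move=> a e f m Q [h1 q]; exists 1%N; eexists; split=> //; last exact: q.
  exact: exec_setr.
- move=> c1 IH1 c2 IH2 m Q h; apply: wp_seq.
  by apply: wp_weaken (IH1 _ _ h) _ _ => // m'; apply: IH2.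
- move=> b c1 IH1 c2 IH2 m Q h; apply: wp_if.
  case: ifP h => _ h.
    by apply: wp_weaken (IH1 _ _ h) _ _ => //; rewrite leq_maxl.
  by apply: wp_weaken (IH2 _ _ h) _ _ => //; rewrite leq_maxr.
Qed.

Lemma wp_skip m k Q : 0 < k -> Q m -> wp Skip m k Q.
Proof. by move=> k0 q; exists 1%N, m; split=> //; exact: exec_skip. Qed.

(** [phi] is the remaining time. A round must release strictly more than the cost [k] of the body,
    the extra unit paying for the loop test; the final [.+1] is the failing test. Rounds may have
    different costs, as in loops over shrinking data. *)
Lemma wp_while b c m (I : memory R -> Prop) (phi : memory R -> nat) :
  (forall m, I m -> beval (E m) b = true ->
     exists k, wp c m k (fun m' => I m' /\ (k + phi m' < phi m)%N)) ->
  I m -> wp (While b c) m (phi m).+1 (fun m' => I m' /\ beval (E m') b = false).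
Proof.
move=> step; have [n] := ubnP (phi m); elim: n m => // n IH m lt_n Im.
case Hb: (beval (E m) b); last first.
  by exists 1%N, m; split=> //; exact: exec_while_done.
have [k [t1 [m1 [h1 l1 [I1 lt1]]]]] := step m Im Hb.
have lt1n : (phi m1 < n)%N.
  by rewrite ltnS in lt_n; apply: leq_trans lt_n; lia.
have [t2 [m2 [h2 l2 q]]] := IH _ lt1n I1.
exists (t1 + t2).+1, m2; split=> //; last by lia.
exact: exec_while_step h1 h2.
Qed.

Definition For (i : nat) (N : iexp) (c : cmd) : cmd :=
  Seq (SetI i (ILit 0) (ILit 0))
    (While (BNot (BLeI N (IGet Work i (ILit 0))))
       (Seq c (SetI i (ILit 0) (IAdd (IGet Work i (ILit 0)) (ILit 1))))).

(** A round costs the body, a test and an increment; the last [2] is the initialization and the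
    failing test. The postcondition of the body is guarded by [agree], which hands the frame
    condition to the caller for free. *)
Lemma wp_for (i n k : nat) (N : iexp) c m (I : nat -> memory R -> Prop) :
  i \notin iwrites c -> (0 < M)%N -> (n <= W)%N ->
  (forall j m, I j m -> ieval (E m) N = n) ->
  I 0%N (seti m i 0 0) ->
  (forall j m, (j < n)%N -> I j m -> icell m i 0 = j ->
     wp c m k (fun m' => agree (iwrites c) (rwrites c) m m' ->
                         I j.+1 (seti m' i 0 j.+1))) ->
  wp (For i N c) m (n * (k + 2) + 2) (I n).
Proof.
move=> ic M0 nW IN I0 step; rewrite addnC; apply: (wp_seq (k1 := 1)).
apply: wp_lf; split=> //=.
have := @wp_while (BNot (BLeI N (IGet Work i (ILit 0))))
  (Seq c (SetI i (ILit 0) (IAdd (IGet Work i (ILit 0)) (ILit 1))))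
  (seti m i 0 0)
  (fun m => exists2 j, (j <= n)%N & I j m /\ icell m i 0 = j)
  (fun m => ((n - icell m i 0) * (k + 2))%N).
move=> /(_ _ _)/wp_weaken; apply.
- move=> {I0}m [j jn [Ij ej]] /=; subst j; rewrite (IN _ _ Ij) -ltnNge => jltn.
  exists (k + 1)%N; apply: wp_seq.
  have := wp_frame (step _ _ jltn Ij erefl).
  move=> /wp_weaken; apply=> // m' [/[swap] Hag /(_ Hag) I'].
  apply: wp_lf => /=; have -> : icell m' i 0 = icell m i 0.
    by have [-> //] := Hag.
  rewrite addn1; split=> //; first exact: leq_trans jltn nW.
  split; last by rewrite /= /store !eqxx /= -(subnSK jltn) mulSn; lia.
  by exists (icell m i 0).+1 => //; split=> //=; rewrite /store !eqxx.
- by exists 0%N => //; split=> //=; rewrite /store !eqxx.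
- by rewrite /= /store !eqxx /= subn0.
- move=> m' [[j jn [Ij ej]]] /=; rewrite (IN _ _ Ij) ej => /negbFE nj.
  by have -> : n = j by lia.
Qed.

End Wp.

Definition wi (a : nat) : iexp := IGet Work a (ILit 0).
Definition wr (a : nat) : rexp := RGet Work a (ILit 0).
Definition seti0 (a : nat) (e : iexp) : cmd := SetI a (ILit 0) e.
Definition setr0 (a : nat) (e : rexp) : cmd := SetR a (ILit 0) e.
Definition inst_int (k : nat) : iexp := IGet Inst 0 (ILit k).

(** * Reduction of both complexity notions to invariants over routes *)

Section Reduction.
Variable R : realType.

Definition customer_arg : iexp := IGet Query 0 (ILit 0).

(* Updates never write the integer array [0], which holds the counter of
   [route_for]. *)
Definition evaluates (inst table query m : memory R) (e : iexp) (v : nat) : Prop :=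
  forall m', icell m' 0 = icell m 0 ->
    ieval (environment inst table query m') e = v.

Definition update (n : nat) (b : bool) (i : 'I_n) (S : {set 'I_n}) : {set 'I_n} :=
  if b then (i |: S)%SET else (S :\ i)%SET.

(** Additions and removals are treated together through the mode [b]: the equation
    [(i \in S) = ~~ b] says that the update is legal. *)
Lemma incrementalI (X : Type) (P : X -> problem R) (removals : bool)
    (T : X -> nat -> nat) (Sto : X -> nat) (init : cmd) (upd : bool -> cmd) (c : nat)
    (Inv : forall x, {set 'I_(customers (P x))} -> memory R -> Prop) :
  (forall x, uncertainty_set (uset (P x)) ->
    let inst := inst_memory (P x) in
    let W := bigO c (inst_size (P x)) in
    let M := bigO c (Sto x) in
    let E0 := zero_memory R in
    [/\ wp inst E0 E0 W M init E0 W (Inv x finset.set0),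
        forall S m, Inv x S m -> is_worst_case_load (uset (P x)) S (output m)
      & forall b S m i, b || removals -> Inv x S m -> (i \in S) = ~~ b ->
          evaluates inst E0 (customer_query R i) m customer_arg i ->
          wp inst E0 (customer_query R i) W M (upd b) m (bigO c (T x #|S|))
            (Inv x (update b i S))]) ->
  incremental P removals T Sto.
Proof.
move=> H; exists init, (upd true), (upd false), c => x ux inst W M.
have [Hi Ho Hu] := H x ux.
split; first by have [t [m [h1 h2 _]]] := Hi; exists t, m.
have HI S m : maintained inst W M removals init (upd true) (upd false) S m -> Inv x S m.
  elim=> {S m}.
  - move=> t m Hm; have [t' [m' [h1 _ Hm']]] := Hi.
    by have [_ ->] := exec_det Hm h1.
  - move=> S i t m m' _ IS /negbTE iS Hm.
    have [t1 [m1 [h1 _ Hm1]]] := Hu true _ _ _ isT IS iS (fun _ _ => erefl).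
    by have [_ ->] := exec_det Hm h1.
  - move=> S i t m m' r _ IS iS Hm.
    have [t1 [m1 [h1 _ Hm1]]] := Hu false _ _ _ r IS iS (fun _ _ => erefl).
    by have [_ ->] := exec_det Hm h1.
move=> S m /HI IS; split; first exact: Ho.
  move=> i /negbTE iS.
  by have [t1 [m1 [h1 h2 _]]] := Hu true _ _ _ isT IS iS (fun _ _ => erefl); exists t1, m1.
by move=> r i iS; have [t1 [m1 [h1 h2 _]]] := Hu false _ _ _ r IS iS (fun _ _ => erefl); exists t1, m1.
Qed.

Lemma from_scratchI (X : Type) (P : X -> problem R) (pre prog : cmd)
    (T : X -> nat -> nat) (c : nat) :
  (forall x, uncertainty_set (uset (P x)) ->
    let inst := inst_memory (P x) in
    let W := bigO c (inst_size (P x)) in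
    let E0 := zero_memory R in
    wp inst E0 E0 W W pre E0 W (fun table =>
      forall s : seq 'I_(customers (P x)), uniq s ->
      wp inst table (route_query R s) W W prog E0 (bigO c (T x (size s)))
        (fun m => is_worst_case_load (uset (P x)) [set i in s]%SET (output m)))) ->
  from_scratch P pre T.
Proof.
move=> H; exists prog, c => x ux inst W.
have [t0 [table [h1 h2 h3]]] := H x ux.
exists t0, table; split=> // S s us sS.
have [t [m [k1 k2 k3]]] := h3 s us.
have eS : [set i in s]%SET = S by apply/setP => i; rewrite inE sS.
by exists t, m; split=> //; rewrite -?eS // cardsE (card_uniqP us).
Qed.

Definition rupd (b : bool) : rexp -> rexp -> rexp := if b then RAdd else RSub.

Definition sgn (b : bool) : R := if b then 1%R else (-1)%R.

Lemma reval_rupd env b e f :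
  reval env (rupd b e f) = (reval env e + sgn b * reval env f)%R.
Proof. by case: b; rewrite /= ?mul1r ?mulN1r. Qed.

Lemma sum_update n b (i : 'I_n) (S : {set 'I_n}) (f : 'I_n -> R) :
  (i \in S) = ~~ b ->
  (\sum_(j in update b i S) f j = \sum_(j in S) f j + sgn b * f i)%R.
Proof.
case: b => /= iS; rewrite ?mul1r ?mulN1r.
  by rewrite (big_setU1 _) ?iS //= addrC.
by rewrite [in RHS](big_setD1 i iS) /= addrAC subrr add0r.
Qed.

Definition route_arg : iexp := IGet Query 1 (IGet Work 0 (ILit 0)).
Definition route_for (c : cmd) : cmd := For 0 customer_arg c.

Lemma uniq_size_ord (n : nat) (s : seq 'I_n) : uniq s -> size s <= n.
Proof. by move=> /card_uniqP <-; rewrite -[n in _ <= n]card_ord max_card. Qed.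

(** Computing from scratch reuses the update for an addition: after [j] rounds, [Inv] holds for the
    set of the first [j] customers. [Inv] has to tolerate changes of the loop counter, integer cell
    [0] of array [0]. *)
Lemma wp_route (inst table : memory R) (W M n k : nat) (s : seq 'I_n) (c : cmd)
    (m : memory R) (Inv : {set 'I_n} -> memory R -> Prop) :
  uniq s -> 0 \notin iwrites c -> 0 < M -> size s <= W ->
  (forall S m v, Inv S m -> Inv S (seti m 0 0 v)) -> Inv finset.set0 m ->
  (forall (S : {set 'I_n}) m i, i \notin S -> Inv S m ->
     evaluates inst table (route_query R s) m route_arg i ->
     wp inst table (route_query R s) W M c m k (Inv (update true i S))) ->
  wp inst table (route_query R s) W M (route_for c) m (size s * (k + 2) + 2)
    (Inv [set i in s]%SET).
Proof.
move=> us c0 M0 sW Iset I0 step.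
apply: wp_weaken; first apply: (wp_for (n := size s) (k := k)
  (I := fun j m => Inv [set i in take j s]%SET m) c0 M0 sW); last 2 first.
- by [].
- by move=> m'; rewrite take_size.
- by move=> j m'.
- by rewrite take0; apply: Iset; have -> : [set i in [::]]%SET = finset.set0 :> {set 'I_n}
    by apply/setP => i; rewrite !inE.
- move=> j m' js Ij ej; have i0 : 'I_n by case: (s) js.
  pose i := nth i0 s j.
  have it : i \notin take j s.
    apply/negP => h; have := us; rewrite -(cat_take_drop j s) cat_uniq.
    case/and3P => _ /hasPn /(_ i) + _; rewrite (drop_nth i0 js) inE eqxx.
    by move=> /(_ isT); rewrite h.
  have := step [set i in take j s]%SET m' i _ Ij.
  rewrite inE => /(_ it) H.
  (* [route_arg] depends on the work memory only through the counter array, which is what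
     [evaluates] asks to be preserved. *)
  have {}H := H (fun m1 (e1 : icell m1 0 = _) =>
    etrans (f_equal (fun k => nth 0 (map val s) (k 0)) e1) _).
  have {}/H h : nth 0 (map val s) (icell m' 0 0) = i by rewrite ej (nth_map i0).
  apply: (wp_weaken h) => // m'' Im'' _; apply: Iset.
  rewrite (take_nth i0 js); congr (Inv _ _): Im''; apply/setP => i'.
  by rewrite !inE mem_rcons inE.
Qed.

Lemma nth_vec n (v : 'cV[R]_n) (i : 'I_n) : nth 0%R (vec v) i = v i ord0.
Proof. by rewrite (nth_map i) ?size_enum_ord // nth_ord_enum. Qed.

Lemma size_vec n (v : 'cV[R]_n) : size (vec v) = n.
Proof. by rewrite size_map size_enum_ord. Qed.

Lemma nth_allpairs_ord (V : Type) (v0 : V) m n (f : 'I_m -> 'I_n -> V)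
    (i : 'I_m) (j : 'I_n) :
  nth v0 [seq f i j | i <- enum 'I_m, j <- enum 'I_n] (i * n + j) = f i j.
Proof.
have H (s : seq 'I_m) (k : nat) : k < size s ->
    nth v0 [seq f i j | i <- s, j <- enum 'I_n] (k * n + j) = f (nth i s k) j.
  elim: s k => // a s IH [|k] ks; rewrite /= nth_cat size_map size_enum_ord.
    by rewrite mul0n add0n ltn_ord (nth_map j) ?size_enum_ord // nth_ord_enum.
  have -> : k.+1 * n + j < n = false by nia.
  have -> : k.+1 * n + j - n = k * n + j by nia.
  exact: IH.
by rewrite H ?size_enum_ord // nth_ord_enum.
Qed.

Lemma size_allpairs_ord (V : Type) m n (f : 'I_m -> 'I_n -> V) :
  size [seq f i j | i <- enum 'I_m, j <- enum 'I_n] = m * n.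
Proof. by rewrite size_allpairs !size_enum_ord. Qed.

Lemma sum_lt_ord n (f : 'I_n -> R) j (jn : j < n) :
  (\sum_(k < n | (k < j.+1)%N) f k = \sum_(k < n | (k < j)%N) f k + f (Ordinal jn))%R.
Proof.
rewrite (bigD1 (Ordinal jn)) //= addrC; congr (_ + _)%R; apply: eq_bigl => k.
by rewrite -val_eqE /= ltnS andbC -ltn_neqAle.
Qed.

Lemma sum_lt_ord0 n (f : 'I_n -> R) : (\sum_(k < n | (k < 0)%N) f k = 0)%R.
Proof. by rewrite big_pred0. Qed.

Lemma sum_lt_ord_max n (f : 'I_n -> R) :
  (\sum_(k < n | (k < n)%N) f k = \sum_k f k)%R.
Proof. by apply: eq_bigl => k; rewrite ltn_ord. Qed.

End Reduction.

(** * Ellipsoidal sets *)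

Section EllipsoidLoad.
Local Open Scope ring_scope.
Variable R : realType.

(** Cauchy-Schwarz: the deviation of the load is the inner product of [xi] with [A 1_S], whose
    squared norm is [1_S^T Sigma 1_S] because [A] is symmetric with square [E_Sigma x]. The
    identities [load] and [sqr] hold for any such root, so a competing point may come from another
    root than the maximizer. *)
Lemma ellipsoid_worst_case (x : ellipsoid R) (S : {set 'I_(E_n x)}) :
  uncertainty_set (ellipsoid_set (x := x)) ->
  is_worst_case_load (ellipsoid_set (x := x)) S
    (\sum_(i in S) E_q0 x i 0 +
     Num.sqrt (\sum_(i in S) \sum_(j in S) E_Sigma x i j)).
Proof.
set V := \sum_(i in S) \sum_(j in S) _.
have load (A : 'M[R]_(E_n x)) xi : sym_psd A ->
    \sum_(i in S) (E_q0 x + A *m xi) i 0 =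
    \sum_(i in S) E_q0 x i 0 + \sum_k (\sum_(i in S) A k i) * xi k 0.
  move=> [sA _]; under eq_bigr do rewrite !mxE; rewrite big_split /=.
  congr (_ + _); rewrite exchange_big /=; apply: eq_bigr => k _.
  rewrite mulr_suml; apply: eq_bigr => i _; congr (_ * _).
  by rewrite -[in LHS]sA mxE.
have sqr (A : 'M[R]_(E_n x)) : sym_psd A -> A *m A = E_Sigma x ->
    \sum_k (\sum_(i in S) A k i) ^+ 2 = V.
  move=> [sA _] AA; rewrite /V; under eq_bigr => k _.
    rewrite expr2 mulr_suml; under eq_bigr do rewrite mulr_sumr.
    over.
  rewrite exchange_big /=; apply: eq_bigr => i _.
  rewrite exchange_big /=; apply: eq_bigr => j _.
  rewrite -AA mxE; apply: eq_bigr => k _; congr (_ * _).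
  by rewrite -[in LHS]sA mxE.
(* Nonemptiness of the set provides the square root [A] from which the maximizer is built. *)
case=> -[q [A [xi0 [pA AA _ _]]]] _ _ _.
have V0 : 0 <= V by rewrite -(sqr A) //; apply: sumr_ge0 => k _; exact: sqr_ge0.
(* If [V = 0], then [A 1_S = 0] for every root and the load is constant on the set; the
   normalization by [N] below would divide by zero. *)
have [V_eq0|V_neq0] := eqVneq V 0.
  have z (B : 'M[R]_(E_n x)) k : sym_psd B -> B *m B = E_Sigma x ->
      \sum_(i in S) B k i = 0.
    move=> pB BB; apply/eqP; rewrite -sqrf_eq0.
    have /eqP := sqr B pB BB; rewrite V_eq0 psumr_eq0 => [|? _]; last exact: sqr_ge0.
    by move=> /allP/(_ k); rewrite mem_index_enum => /(_ isT).
  rewrite V_eq0 sqrtr0 addr0; split.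
    exists (E_q0 x + A *m 0); last first.
      by rewrite load // [X in _ + X]big1 ?addr0 // => k _; rewrite mxE mulr0.
    by exists A, 0; split=> //; rewrite mulmx0 mxE ler01.
  move=> _ [B [xi [pB BB _ ->]]]; rewrite load // [X in _ + X]big1 ?addr0 // => k _.
  by rewrite z // mul0r.
have N0 : 0 < Num.sqrt V by rewrite sqrtr_gt0 lt_def V_neq0.
set N := Num.sqrt V in N0 *.
have NV : N ^+ 2 = V by rewrite sqr_sqrtr.
split.
  pose xi : 'cV[R]_(E_n x) := \col_k ((\sum_(i in S) A k i) / N).
  exists (E_q0 x + A *m xi).
    exists A, xi; split=> //; rewrite mxE; under eq_bigr do rewrite !mxE -expr2 expr_div_n.
    by rewrite -mulr_suml sqr // NV divff.
  rewrite load //; congr (_ + _); under eq_bigr do rewrite mxE mulrA -expr2.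
  by rewrite -mulr_suml sqr // -NV expr2 mulfK // gt_eqF.
move=> _ [B [xi [pB BB xi1 ->]]]; rewrite load // lerD2l.
(* Expanding the squared distance from [xi] to the unit vector [B 1_S / N] gives
   [2 Y / N <= |xi|^2 + 1 <= 2], hence [Y <= N]. *)
have : 0 <= \sum_k (xi k 0 - (\sum_(i in S) B k i) / N) ^+ 2.
  by apply: sumr_ge0 => k _; exact: sqr_ge0.
have -> : \sum_k (xi k 0 - (\sum_(i in S) B k i) / N) ^+ 2 =
    \sum_k xi k 0 ^+ 2 - 2 / N * (\sum_k (\sum_(i in S) B k i) * xi k 0) + 1.
  rewrite [X in _ = _ + X](_ : 1 = \sum_k (\sum_(i in S) B k i) ^+ 2 / V); last first.
    by rewrite -mulr_suml sqr // divff.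
  rewrite mulr_sumr -sumrB -big_split /=.
  apply: eq_bigr => k _; rewrite -NV.
  move: (\sum_(i in S) B k i) (xi k 0) => y z; clearbody N; field.
  by rewrite gt_eqF.
have xi2 : \sum_k xi k 0 ^+ 2 <= 1.
  by apply: le_trans xi1; rewrite mxE; apply: ler_sum => k _; rewrite mxE expr2.
set Y := \sum_k _ * _ => h.
have : 2 / N * Y <= 2 by lra.
by rewrite mulrAC ler_pdivrMr // ler_pM2l.
Qed.

End EllipsoidLoad.

Section AxisEllipsoid.
Variable R : realType.

(** The nominal load (real array [1]) and the variance (real array [2]) are additive over customers;
    the worst-case load is not, so the square root is taken anew each time. *)
Definition axis_update (b : bool) (e : iexp) : cmd :=
  Seq (setr0 1 (rupd b (wr 1) (RGet Inst 0 e)))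
 (Seq (setr0 2 (rupd b (wr 2) (RGet Inst 1 (IAdd (IMul e (inst_int 0)) e))))
      (setr0 0 (RAdd (wr 1) (RSqrt (wr 2))))).

Definition axis_inv (x : axis_ellipsoid R) (S : {set 'I_(E_n (A_ellipsoid x))})
    (m : memory R) : Prop :=
  [/\ rcell m 1 0 = (\sum_(i in S) E_q0 (A_ellipsoid x) i ord0)%R,
      rcell m 2 0 = (\sum_(i in S) E_Sigma (A_ellipsoid x) i i)%R
    & output m = (rcell m 1 0 + Num.sqrt (rcell m 2 0))%R].

Lemma wp_axis_update (x : axis_ellipsoid R) table query W M
    (S : {set 'I_(E_n (A_ellipsoid x))}) (i : 'I_(E_n (A_ellipsoid x))) b e m :
  let inst := inst_memory (axis_ellipsoid_problem x) in
  0 < M -> axis_inv S m -> (i \in S) = ~~ b ->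
  evaluates inst table query m e i ->
  wp inst table query W M (axis_update b e) m 3 (axis_inv (update b i S)).
Proof.
move=> inst M0 [I1 I2 _] iS ei; apply: wp_lf => /=; do 3 split=> //.
rewrite /axis_inv !(sum_update _ iS) /= /store /= !reval_rupd /= !ei //; split=> //.
- by rewrite I1 nth_vec.
- by rewrite /store /= I2 (nth_allpairs_ord _ (fun i j => E_Sigma (A_ellipsoid x) i j)).
Qed.

Lemma axis_inv_worst_case (x : axis_ellipsoid R) S m :
  uncertainty_set (uset (axis_ellipsoid_problem x)) -> axis_inv (x := x) S m ->
  is_worst_case_load (uset (axis_ellipsoid_problem x)) S (output m).
Proof.
move=> ux [I1 I2 ->]; have := ellipsoid_worst_case S ux; rewrite I1 I2.
congr (is_worst_case_load _ _ (_ + Num.sqrt _))%R; apply: eq_bigr => i iS.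
rewrite (bigD1 i iS) /= big1 ?addr0 // => j /andP[_ ji].
by have /is_diag_mxP -> := A_diag x; rewrite // eq_sym.
Qed.

Lemma axis_inv0 (x : axis_ellipsoid R) : axis_inv (x := x) finset.set0 (zero_memory R).
Proof. by split; rewrite /output /= ?big_set0 ?sqrtr0 ?addr0. Qed.

Lemma axis_from_scratch :
  from_scratch (@axis_ellipsoid_problem R) Skip (fun x k => k).
Proof.
apply: (@from_scratchI _ _ _ _ (route_for (axis_update true route_arg)) _ 5) => x ux.
move=> inst W E0; apply: wp_skip; first by rewrite /W /bigO; lia.
move=> s us; have sW : size s <= W.
    have := uniq_size_ord us; rewrite /W /bigO /inst_size /= size_vec; lia.
  apply: (wp_weaken (wp_route (k := 3) (Inv := @axis_inv x) us _ _ sW _ _ _)) => //.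
  - exact: axis_inv0.
  - move=> S m i iS IS ei; apply: wp_axis_update => //; exact: negbTE.
  - by rewrite /bigO /=; lia.
  - by move=> m; apply: axis_inv_worst_case.
Qed.

Lemma axis_incremental :
  incremental (@axis_ellipsoid_problem R) true (fun x k => 1) (fun x => 1).
Proof.
apply: (@incrementalI R _ (@axis_ellipsoid_problem R) _ _ _ Skip (fun b => axis_update b customer_arg) 3
  (@axis_inv)) => x ux inst W M E0; split.
- by apply: wp_skip; [rewrite /W /bigO; lia|exact: axis_inv0].
- by move=> S m; apply: axis_inv_worst_case.
- move=> b S m i _ IS iS ei.
  by apply: wp_weaken; first exact: wp_axis_update IS iS ei.
Qed.

End AxisEllipsoid.

Section Ellipsoid.
Variable R : realType.

(** Integer array [2] holds membership flags. The flag of the customer is cleared before the loop,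
    for additions and removals alike, so that the loop sums over the route without this customer;
    the diagonal entry is handled apart and the final flag is written last. *)
Definition ellipsoid_update (b : bool) (e : iexp) : cmd :=
  Seq (SetI 2 e (ILit 0))
 (Seq (For 1 (inst_int 0)
    (If (BLeI (ILit 1) (IGet Work 2 (wi 1)))
       (setr0 2 (rupd b (wr 2) (RMul (RNat (ILit 2))
          (RGet Inst 1 (IAdd (IMul e (inst_int 0)) (wi 1))))))
       Skip))
 (Seq (setr0 1 (rupd b (wr 1) (RGet Inst 0 e)))
 (Seq (setr0 2 (rupd b (wr 2) (RGet Inst 1 (IAdd (IMul e (inst_int 0)) e))))
 (Seq (SetI 2 e (ILit b))
      (setr0 0 (RAdd (wr 1) (RSqrt (wr 2)))))))).

Definition quad (x : ellipsoid R) (S : {set 'I_(E_n x)}) : R :=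
  (\sum_(i in S) \sum_(j in S) E_Sigma x i j)%R.

Lemma quad_setU1 (x : ellipsoid R) (S : {set 'I_(E_n x)}) i : i \notin S ->
  (quad (i |: S)%SET =
   quad S + (\sum_(j in S) (2 * E_Sigma x i j) + E_Sigma x i i))%R.
Proof.
move=> iS; rewrite /quad big_setU1 //= big_setU1 //=.
under [X in (_ + X)%R]eq_bigr do rewrite big_setU1 //=.
rewrite big_split /= -mulr_sumr.
have -> : (\sum_(j in S) E_Sigma x j i = \sum_(j in S) E_Sigma x i j)%R.
  apply: eq_bigr => j _; have [sA _] := E_Sigma_psd x.
  by rewrite -[in LHS]sA mxE.
ring.
Qed.

(** A removal is an addition to [S :\ i] read backwards, so both modes involve the same row sum. *)
Lemma quad_update (x : ellipsoid R) (S : {set 'I_(E_n x)}) i b : (i \in S) = ~~ b ->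
  (quad (update b i S) =
   quad S + sgn R b * (\sum_(j in S :\ i) (2 * E_Sigma x i j) + E_Sigma x i i))%R.
Proof.
case: b => /= iS.
  rewrite mul1r quad_setU1 ?iS //; congr (_ + (_ + _))%R; apply: eq_bigl => j.
  by rewrite !inE; case: eqP => // ->; rewrite iS.
have := @quad_setU1 x (S :\ i) i; rewrite finset.setD1K // => ->; last by rewrite finset.setD11.
by rewrite mulN1r addrK.
Qed.

Definition ellipsoid_inv (x : ellipsoid R) (S : {set 'I_(E_n x)})
    (m : memory R) : Prop :=
  [/\ rcell m 1 0 = (\sum_(i in S) E_q0 x i ord0)%R,
      rcell m 2 0 = quad S,
      forall i : 'I_(E_n x), icell m 2 i = (i \in S)
    & output m = (rcell m 1 0 + Num.sqrt (rcell m 2 0))%R].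

Lemma wp_ellipsoid_update (x : ellipsoid R) table query W M
    (S : {set 'I_(E_n x)}) (i : 'I_(E_n x)) b e m :
  let inst := inst_memory (ellipsoid_problem x) in
  E_n x <= W -> E_n x <= M -> ellipsoid_inv S m -> (i \in S) = ~~ b ->
  evaluates inst table query m e i ->
  wp inst table query W M (ellipsoid_update b e) m (E_n x * 4 + 7)
    (ellipsoid_inv (update b i S)).
Proof.
move=> inst nW nM [I1 I2 I3 _] iS ei.
have iM : i < M by apply: leq_trans (ltn_ord i) nM.
have M0 : 0 < M by lia.
have W0 : 0 < W by have := ltn_ord i; lia.
apply: (@wp_weaken _ _ _ _ _ _ _ _ (1 + ((E_n x * (2 + 2) + 2) + 4))); last 2 first.
- by lia.
- by move=> m'; apply.
apply: wp_seq; apply: wp_lf => /=; split=> //; first by rewrite ei.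
rewrite ei //; apply: wp_seq.
pose J j m' := [/\ icell m' 0 = icell m 0, rcell m' 1 0 = rcell m 1 0,
  rcell m' 2 0 = (rcell m 2 0 + sgn R b *
    \sum_(k < E_n x | (k < j)%N) if k \in (S :\ i)%SET then 2 * E_Sigma x i k else 0)%R
  & forall k : 'I_(E_n x), icell m' 2 k = (k \in (S :\ i)%SET)].
apply: wp_weaken; first apply: (wp_for (n := E_n x) (k := 2) (I := J)) => //.
- split; rewrite //= /store /=; first by rewrite sum_lt_ord0 mulr0 addr0.
  move=> k; rewrite !inE I3 val_eqE.
  by case: eqP.
- move=> j m' jn [J1 J2 J3 J4] ej; apply: wp_lf => /=; rewrite ej.
  have e4 := J4 (Ordinal jn); rewrite /= in e4; rewrite e4 lt0b.
  case: ifP => jS; rewrite /=; [split=> // _|move=> _]; split=> //=.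
    rewrite reval_rupd /= ei // J3 sum_lt_ord jS ej /store /=.
    by rewrite (nth_allpairs_ord _ (fun i j => E_Sigma x i j) i (Ordinal jn)) mulrDr addrA.
  by rewrite J3 sum_lt_ord jS addr0.
- by [].
move=> m' [J1 J2 J3 J4]; apply: (wp_weaken (k := 4)); [|by []|move=> m''; exact: id].
apply: wp_lf => /=; do 2 split=> //.
have ei' m1 : icell m1 0 = icell m' 0 ->
  ieval (environment inst table query m1) e = i.
  by move=> e1; apply: ei; rewrite e1.
rewrite !ei' //; split=> //; first by apply: leq_trans W0; case: (b).
split=> //; rewrite /ellipsoid_inv quad_update // sum_update //=.
rewrite /store /= !reval_rupd /= !ei' //; split=> //.
- by rewrite J2 I1 nth_vec.
- rewrite /store /= J3 I2 sum_lt_ord_max -big_mkcond /=.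
  by rewrite (nth_allpairs_ord _ (fun i j => E_Sigma x i j)) mulrDr addrA.
- move=> k; rewrite /update; case: (b); rewrite !inE /= val_eqE.
    by case: eqP => //= /eqP h; rewrite J4 !inE h.
  by case: eqP => //= /eqP h; rewrite J4 !inE h.
Qed.

Lemma ellipsoid_inv_worst_case (x : ellipsoid R) S m :
  uncertainty_set (uset (ellipsoid_problem x)) -> ellipsoid_inv (x := x) S m ->
  is_worst_case_load (uset (ellipsoid_problem x)) S (output m).
Proof.
by move=> ux [I1 I2 _ ->]; rewrite I1 I2; exact: ellipsoid_worst_case.
Qed.

Lemma ellipsoid_inv0 (x : ellipsoid R) : ellipsoid_inv (x := x) finset.set0 (zero_memory R).
Proof. by split; rewrite /output /quad /= ?big_set0 ?sqrtr0 ?addr0 // => i; rewrite inE. Qed.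

Lemma ellipsoid_from_scratch :
  from_scratch (@ellipsoid_problem R) Skip (fun x k => k * E_n x).
Proof.
apply: (@from_scratchI _ _ _ _ (route_for (ellipsoid_update true route_arg)) _ 15) => x ux.
move=> inst W E0; apply: wp_skip; first by rewrite /W /bigO; lia.
move=> s us; have := uniq_size_ord us; rewrite [customers _]/= => sn.
have nW : E_n x < W by rewrite /W /bigO /inst_size /= size_vec; lia.
apply: (wp_weaken (wp_route (k := E_n x * 4 + 7) (Inv := @ellipsoid_inv x) us _ _ _ _ _ _)) => //.
- by lia.
- exact: ellipsoid_inv0.
- move=> S m i iS IS ei; apply: wp_ellipsoid_update => //; try lia; exact: negbTE.
- rewrite /bigO /=; nia.
- by move=> m; apply: ellipsoid_inv_worst_case.
Qed.

Lemma ellipsoid_incremental :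
  incremental (@ellipsoid_problem R) true (fun x k => E_n x) (fun x => E_n x).
Proof.
apply: (@incrementalI R _ (@ellipsoid_problem R) _ _ _ Skip
  (fun b => ellipsoid_update b customer_arg) 7 (@ellipsoid_inv)) => x ux inst W M E0; split.
- by apply: wp_skip; [rewrite /W /bigO; lia|exact: ellipsoid_inv0].
- by move=> S m; apply: ellipsoid_inv_worst_case.
- move=> b S m i _ IS iS ei.
  apply: wp_weaken; first apply: wp_ellipsoid_update IS iS ei => //.
  + by rewrite /W /bigO /inst_size /= size_vec; lia.
  + by rewrite /M /bigO; lia.
  + by rewrite /bigO; lia.
  + by [].
Qed.

End Ellipsoid.

(** * Discrete sets *)

Section Discrete.
Variable R : realType.

(** On a convex hull, a linear function is a weighted mean of its values at the generators, hence at
    most their maximum. *)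
Lemma discrete_worst_case (x : discrete R) (S : {set 'I_(D_n x)}) (v : R) :
  (exists j, (\sum_(i in S) D_q j i ord0)%R = v) ->
  (forall j, (\sum_(i in S) D_q j i ord0 <= v)%R) ->
  is_worst_case_load (discrete_set (x := x)) S v.
Proof.
move=> [j0 vj0] vmax; split.
  exists (D_q j0) => //; exists (fun j => (j == j0)%:R%R).
  split=> [j||]; first exact: ler0n.
    by rewrite (bigD1 j0) //= eqxx big1 ?addr0 // => j /negbTE ->.
  by rewrite (bigD1 j0) //= eqxx big1 ?addr0 ?scale1r // => j /negbTE ->; rewrite scale0r.
move=> _ [w [w0 w1 ->]]; under eq_bigr do rewrite summxE.
rewrite exchange_big /= -[leRHS]mul1r -w1 mulr_suml; apply: ler_sum => j _.
under eq_bigr do rewrite mxE; rewrite -mulr_sumr; exact: ler_wpM2l.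
Qed.

(** Real array [1] holds the load of every scenario. The maximum is recomputed in full, since a
    removal may lower the scenario that attained it. *)
Definition discrete_update (b : bool) (e : iexp) : cmd :=
  let acc := RGet Work 1 (wi 1) in
  Seq (For 1 (inst_int 1)
        (SetR 1 (wi 1)
           (rupd b acc (RGet Inst 0 (IAdd (IMul (wi 1) (inst_int 0)) e)))))
 (Seq (setr0 0 (wr 1))
      (For 1 (inst_int 1) (If (BLeR acc (wr 0)) Skip (setr0 0 acc)))).

Definition discrete_inv (x : discrete R) (S : {set 'I_(D_n x)}) (m : memory R) : Prop :=
  [/\ forall j : 'I_(D_D x), rcell m 1 j = (\sum_(i in S) D_q j i ord0)%R,
      exists j : 'I_(D_D x), rcell m 1 j = output m
    & forall j : 'I_(D_D x), (rcell m 1 j <= output m)%R].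

Lemma wp_discrete_update (x : discrete R) table query W M
    (S : {set 'I_(D_n x)}) (i : 'I_(D_n x)) b e m :
  let inst := inst_memory (discrete_problem x) in
  D_D x <= W -> D_D x <= M -> discrete_inv S m -> (i \in S) = ~~ b ->
  evaluates inst table query m e i ->
  wp inst table query W M (discrete_update b e) m (D_D x * 7 + 5)
    (discrete_inv (update b i S)).
Proof.
move=> inst DW DM [I1 _ _] iS ei.
have M0 : 0 < M by apply: leq_trans DM; exact: D_D_gt0.
apply: (@wp_weaken _ _ _ _ _ _ _ _ (D_D x * (1 + 2) + 2 + (1 + (D_D x * (2 + 2) + 2))));
  last 2 first.
- by lia.
- by move=> m'; apply.
apply: wp_seq.
apply: wp_weaken; first apply: (wp_for (n := D_D x) (k := 1)
  (I := fun j m' => icell m' 0 = icell m 0 /\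
    forall k : 'I_(D_D x), rcell m' 1 k =
      (\sum_(i' in (if (k < j)%N then update b i S else S) : {set 'I_(D_n x)}) D_q k i' ord0)%R)) => //.
- move=> j m' jn [J0 J1] ej; apply: wp_lf => /=; rewrite !ej.
  split=> [|_]; first exact: leq_trans jn DM.
  split=> // k /=; rewrite /store /= ltnS leq_eqVlt.
  case: eqP => [kj|//]; rewrite /= sum_update // reval_rupd /= ej ei // -kj J1 kj ltnn -kj.
  congr (_ + _ * _)%R.
  exact: (nth_allpairs_ord _ (fun j i => D_q j i ord0)).
- by [].
move=> m' [J0 J1]; apply: wp_seq; apply: wp_lf => /=; split=> //.
apply: wp_weaken; first apply: (wp_for (n := D_D x) (k := 2)
  (I := fun j m'' => [/\ rcell m'' 1 = rcell m' 1,
     exists j : 'I_(D_D x), rcell m' 1 j = output m''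
    & forall k : 'I_(D_D x), k < j -> (rcell m' 1 k <= output m'')%R])) => //.
- by split=> //; exists (Ordinal (D_D_gt0 x)).
- move=> j m'' jn [K0 K1 K2] ej; apply: wp_lf => /=.
  rewrite ej K0 /= -/(output m''); case: leP => h /=; [|split=> //] => _.
    split=> // k; rewrite ltnS leq_eqVlt => /predU1P[->//|]; exact: K2.
  rewrite ?ej ?K0; split=> //; first by exists (Ordinal jn).
  move=> k; rewrite ltnS leq_eqVlt => /predU1P[->//|kj].
  exact: le_trans (K2 _ kj) (ltW h).
- by [].
move=> m'' [K0 K1 K2]; split.
- by move=> j; rewrite K0 J1 ltn_ord.
- by rewrite K0.
- by move=> j; rewrite K0 K2.
Qed.

Lemma discrete_inv_worst_case (x : discrete R) S m :
  discrete_inv (x := x) S m ->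
  is_worst_case_load (uset (discrete_problem x)) S (output m).
Proof.
by move=> [I1 [j <-] I3]; apply: discrete_worst_case; [exists j|move=> k]; rewrite -?I1 //.
Qed.

Lemma discrete_inv0 (x : discrete R) : discrete_inv (x := x) finset.set0 (zero_memory R).
Proof. by split=> *; rewrite ?big_set0 //=; exists (Ordinal (D_D_gt0 x)). Qed.

Lemma discrete_from_scratch :
  from_scratch (@discrete_problem R) Skip (fun x k => k * D_D x).
Proof.
apply: (@from_scratchI _ _ _ _ (route_for (discrete_update true route_arg)) _ 15) => x ux.
move=> inst W E0; apply: wp_skip; first by rewrite /W /bigO; lia.
move=> s us; have := uniq_size_ord us; rewrite [customers _]/= => sn.
have D0 := D_D_gt0 x.
have EW : W = 15 * (2 + D_D x * D_n x).+1.
  rewrite /W /bigO /inst_size /= size_allpairs_ord; lia.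
clearbody W.
apply: (wp_weaken (wp_route (k := D_D x * 7 + 5) (Inv := @discrete_inv x) us _ _ _ _ _ _)) => //.
- by lia.
- by nia.
- exact: discrete_inv0.
(* The instance has [D_D x * D_n x] real entries, so [D_D x] fits the word size as soon as there is
   a customer; here [i] is one. *)
- move=> S m i iS IS ei; apply: wp_discrete_update => //; try (have := ltn_ord i; nia).
  exact: negbTE.
- rewrite /bigO /=; nia.
- by move=> m; apply: discrete_inv_worst_case.
Qed.

Lemma discrete_incremental :
  incremental (@discrete_problem R) true (fun x k => D_D x) (fun x => D_D x).
Proof.
apply: (@incrementalI R _ (@discrete_problem R) _ _ _ Skip
  (fun b => discrete_update b customer_arg) 7 (@discrete_inv)) => x ux inst W M E0; split.
- by apply: wp_skip; [rewrite /W /bigO; lia|exact: discrete_inv0].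
- by move=> S m; apply: discrete_inv_worst_case.
- move=> b S m i _ IS iS ei.
  apply: wp_weaken; first apply: wp_discrete_update IS iS ei => //.
  + rewrite /W /bigO /inst_size /= size_allpairs_ord.
    have := ltn_ord i; rewrite [customers _]/=; nia.
  + by rewrite /M /bigO; lia.
  + by rewrite /bigO; lia.
  + by [].
Qed.

End Discrete.

(** * Budget sets *)

Section Budget.
Variable R : realType.
Implicit Types x : budget R.

(** [pick] returns some set containing [i]; by disjointness it is the only one. *)
Lemma budget_indexP x (i : 'I_(B_n x)) (l : 'I_(B_L x)) :
  (budget_index i == l) = (i \in B_B l).
Proof.
rewrite /budget_index; case: pickP => [k ik|none]; last first.
  by rewrite none; apply/eqP => h; have := ltn_ord l; rewrite -h ltnn.
rewrite val_eqE; case: eqVneq => [<-//|kl]; apply/esym/negP => il.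
by have /setP/(_ i) := B_disjoint kl; rewrite !inE ik il.
Qed.

Lemma budget_index_le x (i : 'I_(B_n x)) : budget_index i <= B_L x.
Proof. by rewrite /budget_index; case: pickP => // l _; exact/ltnW/ltn_ord. Qed.

Local Open Scope ring_scope.

(** The index [B_L x] stands for the customers in none of the sets, whose demand is bounded by the
    box alone. *)
Lemma budget_partition x (S : {set 'I_(B_n x)}) (f : 'I_(B_n x) -> R) :
  \sum_(i in S) f i = \sum_(i in S | budget_index i == B_L x) f i +
    \sum_(l < B_L x) \sum_(i in S | budget_index i == l) f i.
Proof.
rewrite (partition_big (fun i => inord (budget_index i) : 'I_(B_L x).+1) predT) //=.
rewrite big_ord_recr /= addrC; congr (_ + _).
  apply: eq_bigl => i; congr (_ && _).
  by rewrite -val_eqE /= inordK // ltnS budget_index_le.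
apply: eq_bigr => l _; apply: eq_bigl => i; congr (_ && _).
by rewrite -val_eqE /= inordK // ltnS budget_index_le.
Qed.

Definition range_sum x (S : {set 'I_(B_n x)}) (l : nat) : R :=
  \sum_(i in S | budget_index i == l) (B_hi x i 0 - B_lo x i 0).

Definition slack x (l : 'I_(B_L x)) : R := B_b l - \sum_(i in B_B l) B_lo x i 0.

Definition budget_load x (S : {set 'I_(B_n x)}) : R :=
  \sum_(i in S) B_lo x i 0 + range_sum S (B_L x) +
  \sum_(l < B_L x) Num.min (range_sum S l) (slack l).

Lemma slack_ge0 x (l : 'I_(B_L x)) : 0 <= slack l.
Proof. by rewrite subr_ge0 B_lo_b. Qed.

Lemma range_sum_ge0 x (S : {set 'I_(B_n x)}) l : 0 <= range_sum S l.
Proof. by apply: sumr_ge0 => i _; rewrite subr_ge0 B_lo_hi. Qed.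

(** The sets being disjoint, each contributes separately: the excess over [B_lo] within a set is
    bounded by the box and by the slack. The maximizer scales all ranges of a class by one factor
    [t l], which makes their sum equal to the smaller bound; customers off the route stay at
    [B_lo]. *)
Lemma budget_worst_case x (S : {set 'I_(B_n x)}) :
  is_worst_case_load (budget_set (x := x)) S (budget_load S).
Proof.
have split_lo (q : 'cV[R]_(B_n x)) : \sum_(i in S) q i 0 =
    \sum_(i in S) B_lo x i 0 + \sum_(i in S) (q i 0 - B_lo x i 0).
  by rewrite -big_split /=; apply: eq_bigr => i _; rewrite addrC subrK.
split; last first.
  move=> q [qb qB]; rewrite split_lo /budget_load -addrA lerD2l budget_partition.
  apply: lerD; first by apply: ler_sum => i _; rewrite lerD2r; case/andP: (qb i).
  apply: ler_sum => l _; rewrite le_min; apply/andP; split.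
    by apply: ler_sum => i _; rewrite lerD2r; case/andP: (qb i).
  (* The budget constraint also covers customers off the route, whose excess is nonnegative. *)
  apply: (@le_trans _ _ (\sum_(i in B_B l) (q i 0 - B_lo x i 0))).
    rewrite big_mkcond [leRHS]big_mkcond; apply: ler_sum => i _ /=.
    rewrite budget_indexP; case: (i \in S); case: (i \in B_B l) => //=.
    by rewrite subr_ge0; case/andP: (qb i).
  by rewrite sumrB lerD2r qB.
pose t l : R := if (insub l : option 'I_(B_L x)) is Some l' then
  Num.min (range_sum S l) (slack l') / range_sum S l else 1.
pose q : 'cV[R]_(B_n x) := \col_i
  (B_lo x i 0 + if i \in S then t (budget_index i) * (B_hi x i 0 - B_lo x i 0) else 0).
have t01 l : 0 <= t l <= 1.
  rewrite /t; case: insub => [l'|]; last by rewrite ler01 lexx.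
  (* A class of total range zero gets [t l = 0], since division by zero yields zero. *)
  have := range_sum_ge0 S l; rewrite le_eqVlt => /predU1P[<-|h].
    by rewrite invr0 mulr0 lexx ler01.
  rewrite divr_ge0 ?le_min ?slack_ge0 ?(ltW h) //=.
  by rewrite ler_pdivrMr // mul1r ge_min lexx.
have tE (l : 'I_(B_L x)) : \sum_(i in S | budget_index i == l)
    t (budget_index i) * (B_hi x i 0 - B_lo x i 0) = Num.min (range_sum S l) (slack l).
  under eq_bigr => i /andP[_ /eqP->] do [].
  rewrite -mulr_sumr -/(range_sum S l) /t valK.
  have [->|h] := eqVneq (range_sum S l) 0; last by rewrite divfK.
  by rewrite mulr0 min_l // slack_ge0.
exists q; last first.
  rewrite split_lo /budget_load -addrA; congr (_ + _); rewrite budget_partition.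
  congr (_ + _).
    apply: eq_bigr => i /andP[iS /eqP il]; rewrite !mxE iS il /t insubN ?ltnn //.
    by rewrite mul1r addrAC subrr add0r.
  apply: eq_bigr => l _; rewrite -tE; apply: eq_bigr => i /andP[iS _].
  by rewrite !mxE iS addrAC subrr add0r.
split=> [i|l].
  rewrite mxE; case: ifP => _; last by rewrite addr0 lexx B_lo_hi.
  have /andP[t0 t1] := t01 (budget_index i).
  have d0 : 0 <= B_hi x i 0 - B_lo x i 0 by rewrite subr_ge0 B_lo_hi.
  rewrite lerDl mulr_ge0 //= -lerBrDl.
  by rewrite -[leRHS]mul1r ler_wpM2r.
under eq_bigr do rewrite mxE.
rewrite big_split /= -lerBrDl -/(slack l).
apply: (@le_trans _ _ (Num.min (range_sum S l) (slack l))); last by rewrite ge_min lexx orbT.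
rewrite -tE le_eqVlt; apply/predU1P; left.
rewrite [LHS]big_mkcond [RHS]big_mkcond; apply: eq_bigr => i _ /=.
by rewrite budget_indexP; case: (i \in S); case: (i \in B_B l).
Qed.

Local Close Scope ring_scope.

Lemma range_sum_update x (S : {set 'I_(B_n x)}) i b l : (i \in S) = ~~ b ->
  (range_sum (update b i S) l = range_sum S l +
   if budget_index i == l then sgn R b * (B_hi x i ord0 - B_lo x i ord0) else 0)%R.
Proof.
move=> iS; rewrite /range_sum !big_mkcondr (sum_update _ iS) /=.
by case: eqP => // _; rewrite mulr0.
Qed.

(** Only the class of [i] is affected. Its term is truncated and not additive, so the old minimum is
    subtracted and the new one added; a customer in no set counts with [B_hi]. *)
Lemma budget_load_update x (S : {set 'I_(B_n x)}) i b : (i \in S) = ~~ b ->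
  (budget_load (update b i S) =
   if (insub (budget_index i) : option 'I_(B_L x)) is Some l then
     budget_load S - Num.min (range_sum S l) (slack l)
     + Num.min (range_sum (update b i S) l) (slack l) + sgn R b * B_lo x i ord0
   else budget_load S + sgn R b * B_hi x i ord0)%R.
Proof.
move=> iS; rewrite /budget_load (sum_update _ iS).
case: insubP => [l _ il|nl].
  rewrite [X in (_ + X)%R](bigD1 l) //= [in RHS](bigD1 l) //=.
  have -> : range_sum (update b i S) (B_L x) = range_sum S (B_L x).
    by rewrite range_sum_update // -il ltn_eqF ?ltn_ord ?addr0.
  have -> : (\sum_(k < B_L x | k != l) Num.min (range_sum (update b i S) k) (slack k) =
      \sum_(k < B_L x | k != l) Num.min (range_sum S k) (slack k))%R.
    apply: eq_bigr => k kl.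
    by rewrite range_sum_update // -il val_eqE eq_sym (negbTE kl) addr0.
  ring.
have iL : budget_index i == B_L x by rewrite eqn_leq budget_index_le leqNgt nl.
have -> : (\sum_(k < B_L x) Num.min (range_sum (update b i S) k) (slack k) =
    \sum_(k < B_L x) Num.min (range_sum S k) (slack k))%R.
  apply: eq_bigr => k _.
  by rewrite range_sum_update // (eqP iL) gtn_eqF ?ltn_ord // addr0.
rewrite range_sum_update // iL.
ring.
Qed.

(** The sets are encoded only by the index of each customer, so all slacks are obtained in one sweep
    over the customers. *)
Definition budget_init : cmd :=
  let l := IGet Inst 1 (wi 1) in
  Seq (For 1 (inst_int 1) (SetR 3 (wi 1) (RGet Inst 2 (wi 1))))
      (For 1 (inst_int 0)
         (If (BLeI (inst_int 1) l) Skip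
             (SetR 3 l (RSub (RGet Work 3 l) (RGet Inst 0 (wi 1)))))).

(** [reg] tells where the slacks lie: in [Table] if they come from preprocessing, in [Work] if
    initialization wrote them. The two uses of [cut] enclose the change of the range sum. *)
Definition budget_update (reg : region) (b : bool) (e : iexp) : cmd :=
  let l := IGet Inst 1 e in
  let acc := RGet Work 1 l in
  let lo := RGet Inst 0 e in
  let hi := RGet Inst 1 e in
  let cut op := If (BLeR acc (RGet reg 3 l)) (setr0 0 (op (wr 0) acc))
                   (setr0 0 (op (wr 0) (RGet reg 3 l))) in
  If (BLeI (inst_int 1) l) (setr0 0 (rupd b (wr 0) hi))
     (Seq (cut RSub) (Seq (SetR 1 l (rupd b acc (RSub hi lo)))
        (Seq (cut RAdd) (setr0 0 (rupd b (wr 0) lo))))).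

Lemma nth_budget_index x (i : 'I_(B_n x)) :
  nth 0 [seq budget_index i | i <- enum 'I_(B_n x)] i = budget_index i.
Proof. by rewrite (nth_map i) ?size_enum_ord // nth_ord_enum. Qed.

Definition budget_inv x (S : {set 'I_(B_n x)}) (m : memory R) : Prop :=
  (forall l : 'I_(B_L x), rcell m 1 l = range_sum S l) /\ output m = budget_load S.

Lemma wp_budget_init x (W M : nat) :
  let inst := inst_memory (budget_problem x) in
  let E0 := zero_memory R in
  B_n x <= W -> B_L x <= W -> B_L x <= M -> 0 < M ->
  wp inst E0 E0 W M budget_init E0 (B_L x * 3 + 2 + (B_n x * 4 + 2)) (fun m =>
    (forall l : 'I_(B_L x), rcell m 3 l = slack l) /\ budget_inv (x := x) finset.set0 m).
Proof.
move=> inst E0 nW LW LM M0.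
apply: (wp_weaken (wp_frame (k := B_L x * (1 + 2) + 2 + (B_n x * (2 + 2) + 2))
  (Q := fun m => forall l : 'I_(B_L x), rcell m 3 l = slack l) _)); last 2 first.
- by lia.
- move=> m [H [_ Hr]]; split=> //; split.
    move=> l; rewrite Hr // /range_sum big1 // => i; by rewrite inE.
  rewrite /output Hr // /budget_load /range_sum !big_set0 add0r.
  rewrite !big1 ?addr0 // => [l _|i]; rewrite ?inE //.
  by rewrite big1 ?min_l ?slack_ge0 // => i; rewrite inE.
apply: wp_seq.
apply: wp_weaken; first apply: (wp_for (n := B_L x) (k := 1)
  (I := fun j m => forall l : 'I_(B_L x), l < j -> rcell m 3 l = B_b l)) => //.
- move=> j m jL H ej; apply: wp_lf => /=; rewrite ej; split=> [|_ l].
    exact: leq_trans jL LM.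
  rewrite ltnS /= /store /= leq_eqVlt; case: eqP => [<- _|_ /=]; last exact: H.
  by rewrite (nth_map l) ?size_enum_ord // nth_ord_enum.
- by [].
move=> m H.
apply: wp_weaken; first apply: (wp_for (n := B_n x) (k := 2)
  (I := fun j m => forall l : 'I_(B_L x), rcell m 3 l =
    (B_b l - \sum_(i < B_n x | (i < j)%N) if i \in B_B l then B_lo x i ord0 else 0)%R)) => //.
- by move=> l; rewrite sum_lt_ord0 subr0 H.
- move=> j m' jn J ej; apply: wp_lf => /=; rewrite ej.
  rewrite (nth_budget_index (Ordinal jn)) (nth_vec _ (Ordinal jn)).
  case: (leqP (B_L x) (budget_index (Ordinal jn))) => [Li _ l|iL] /=.
    rewrite J sum_lt_ord -budget_indexP gtn_eqF ?addr0 //.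
    exact: leq_trans (ltn_ord l) Li.
  split=> [|_ l]; first exact: leq_trans iL LM.
  rewrite /store /= sum_lt_ord -budget_indexP eq_sym; case: eqP => [->|_].
    by rewrite J opprD addrA.
  by rewrite J addr0.
- by [].
move=> m' J l; rewrite J sum_lt_ord_max /slack; congr (_ - _)%R.
by rewrite -big_mkcond.
Qed.

Lemma wp_budget_update x table query W M
    (S : {set 'I_(B_n x)}) (i : 'I_(B_n x)) reg b e m :
  let inst := inst_memory (budget_problem x) in
  B_L x <= M -> 0 < M ->
  (forall m' (l : 'I_(B_L x)), rcell m' 3 = rcell m 3 ->
     rcell (environment inst table query m' reg) 3 l = slack l) ->
  budget_inv S m -> (i \in S) = ~~ b -> evaluates inst table query m e i ->
  wp inst table query W M (budget_update reg b e) m 7 (budget_inv (update b i S)).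
Proof.
move=> inst LM M0 sl [I1 I2] iS ei; apply: wp_lf => /=.
rewrite !ei // !(nth_budget_index, nth_vec) leqNgt; case: (ltnP (budget_index i) (B_L x)) => iL /=; last first.
  split=> //; split=> [l|] /=.
    rewrite /store /= range_sum_update // I1 (gtn_eqF (leq_trans (ltn_ord l) iL)) addr0 //.
  rewrite budget_load_update // insubN -?leqNgt //.
  by rewrite reval_rupd /= ei // nth_vec -I2.
have [l el] : exists l : 'I_(B_L x), budget_index i = l by exists (Ordinal iL).
have lM : l < M by apply: leq_trans LM.
rewrite el !(sl _ l) // I1.
have E1 : range_sum (update b i S) l =
    (range_sum S l + sgn R b * (B_hi x i ord0 - B_lo x i ord0))%R.
  by rewrite range_sum_update // el eqxx.
have E2 : budget_load (update b i S) =
    (budget_load S - Num.min (range_sum S l) (slack l)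
     + Num.min (range_sum (update b i S) l) (slack l) + sgn R b * B_lo x i ord0)%R.
  by rewrite budget_load_update // el valK.
have upd (m1 : memory R) : icell m1 0 = icell m 0 -> rcell m1 1 = rcell m 1 ->
    reval (environment inst table query m1) (rupd b (RGet Work 1 (IGet Inst 1 e))
      (RSub (RGet Inst 1 e) (RGet Inst 0 e))) = range_sum (update b i S) l.
  by move=> h1 h2; rewrite reval_rupd /= !ei // nth_budget_index !nth_vec el h2 I1 E1.
have inv' (m1 : memory R) : (forall k, rcell m1 1 k =
      if k == l then range_sum (update b i S) l else rcell m 1 k) ->
    output m1 = budget_load (update b i S) -> budget_inv (update b i S) m1.
  move=> h1 h2; split=> // k; rewrite h1; case: eqVneq => [/val_inj->//|kl].
  by rewrite range_sum_update // el eq_sym (negbTE kl) addr0 I1.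
rewrite !upd //.
case: (leP (range_sum S l) (slack l)) E2 => _ E2; do 2 split=> //.
all: rewrite /store /= eqxx.
all: case: (leP (range_sum (update b i S) l) (slack l)) E2 => _ E2; do 2 split=> //.
all: apply: inv' => [k|]; rewrite /output /store /= ?ei // ?nth_budget_index ?el //.
all: by rewrite reval_rupd /= ei // nth_vec /store /= ?eqxx E2 -I2.
Qed.


Lemma budget_inv_worst_case x S m : budget_inv (x := x) S m ->
  is_worst_case_load (uset (budget_problem x)) S (output m).
Proof. by move=> [_ ->]; exact: budget_worst_case. Qed.

Lemma budget_inst_size x :
  inst_size (budget_problem x) = 2 + B_n x + (B_n x + B_n x + B_L x).
Proof. by rewrite /inst_size /= !size_vec !size_map -!enumT !size_enum_ord; lia. Qed.

Lemma budget_from_scratch :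
  from_scratch (@budget_problem R) budget_init (fun x k => k).
Proof.
apply: (@from_scratchI _ _ _ _ (route_for (budget_update Table true route_arg)) _ 10) => x ux.
move=> inst W E0.
have EW : W = 10 * (2 + B_n x + (B_n x + B_n x + B_L x)).+1.
  by rewrite /W /bigO budget_inst_size.
clearbody W.
apply: (wp_weaken (wp_budget_init (W := W) (M := W) _ _ _ _)); try lia.
move=> table [sl _] s us; have := uniq_size_ord us; rewrite [customers _]/= => sn.
have inv0 : budget_inv (x := x) finset.set0 E0.
  split=> [l|]; first by rewrite /range_sum big1 // => i; rewrite inE.
  rewrite /output /= /budget_load /range_sum !big1 ?addr0 // => [l _|i|i]; rewrite ?inE //.
  by rewrite big1 ?min_l ?slack_ge0 // => i; rewrite inE.
apply: (wp_weaken (wp_route (k := 7) (Inv := @budget_inv x) us _ _ _ _ _ _)) => //.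
- by lia.
- by lia.
- move=> S m i iS IS ei; apply: wp_budget_update => //; try lia; last exact: negbTE.
- by rewrite /bigO /=; lia.
- by move=> m; apply: budget_inv_worst_case.
Qed.

Lemma budget_incremental :
  incremental (@budget_problem R) true (fun x k => 1) (fun x => B_L x).
Proof.
apply: (@incrementalI R _ (@budget_problem R) _ _ _ budget_init
  (fun b => budget_update Work b customer_arg) 10
  (fun x S m => (forall l : 'I_(B_L x), rcell m 3 l = slack l) /\ budget_inv S m))
  => x ux inst W M E0.
have EW : W = 10 * (2 + B_n x + (B_n x + B_n x + B_L x)).+1.
  by rewrite /W /bigO budget_inst_size.
have EM : M = 10 * (B_L x).+1 by [].
clearbody W M; split.
- by apply: (wp_weaken (wp_budget_init (W := W) (M := M) _ _ _ _)) => //; lia.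
- by move=> S m [_]; apply: budget_inv_worst_case.
- move=> b S m i _ [sl IS] iS ei.
  apply: wp_weaken; first apply: wp_frame; first apply: wp_budget_update IS iS ei => //.
  + by lia.
  + by lia.
  + by move=> m' l /= ->.
  + by [].
  + move=> m' [Im' [_ Hr]]; split=> // l; rewrite Hr //.
Qed.

End Budget.

(** * Selection in linear time *)

Section ApproximateMedian.
Variable R : realType.
Implicit Types (f g h : nat -> R) (s t : seq R) (v : R).

Definition seg f a n : seq R := [seq f i | i <- iota a n].

Lemma size_seg f a n : size (seg f a n) = n.
Proof. by rewrite size_map size_iota. Qed.

Lemma nth_seg f a n i : i < n -> nth 0%R (seg f a n) i = f (a + i).
Proof. by move=> h; rewrite (nth_map 0) ?size_iota // nth_iota. Qed.

Lemma eq_seg f g a n : (forall i, a <= i < a + n -> f i = g i) -> seg f a n = seg g a n.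
Proof. by move=> h; apply/eq_in_map => i; rewrite mem_iota; apply: h. Qed.

Lemma seg_cat f a n1 n2 : seg f a (n1 + n2) = seg f a n1 ++ seg f (a + n1) n2.
Proof. by rewrite /seg iotaD map_cat. Qed.

Lemma segS f n : seg f 0 n.+1 = rcons (seg f 0 n) (f n).
Proof. by rewrite -addn1 seg_cat cats1. Qed.

Notation merge := (merge (<=%R : rel R)).

(** The guard has the shape of the test in [merge_pass]: the left head is taken if it exists and no
    existing right head is strictly smaller, so ties go left. *)
Lemma merge_step s t i j : i <= size s -> j <= size t -> i + j < size s + size t ->
  merge (drop i s) (drop j t) =
  if (i < size s) && ~~ ((j < size t) && ~~ (s`_i <= t`_j)%R)
  then (s`_i)%R :: merge (drop i.+1 s) (drop j t)
  else (t`_j)%R :: merge (drop i s) (drop j.+1 t).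
Proof.
move=> si tj ij; case: (ltnP i (size s)) => hi /=.
  rewrite (drop_nth 0%R hi); case: (ltnP j (size t)) => hj /=.
    by rewrite [in LHS](drop_nth 0%R hj) /= (drop_nth 0%R hj); case: ifP.
  by rewrite [drop j t]drop_oversize //; case: (drop i.+1 s).
have hj : j < size t by lia.
rewrite (drop_oversize hi) (drop_nth 0%R hj) /=.
by case: (drop j.+1 t).
Qed.

(* The virtual output of a merge pass over runs of length [r]. *)
Definition merged f r q : seq R :=
  merge (seg f (q * (2 * r)) r) (seg f (q * (2 * r) + r) r).

Lemma size_merged f r q : size (merged f r q) = 2 * r.
Proof. by rewrite size_merge size_cat !size_seg mul2n addnn. Qed.

Definition pass_out f r k : R := nth 0%R (merged f r (k %/ (2 * r))) (k %% (2 * r)).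

Lemma pass_outE f r q i : i < 2 * r ->
  pass_out f r (q * (2 * r) + i) = nth 0%R (merged f r q) i.
Proof.
move=> ir; have r0 : 0 < 2 * r by lia.
by rewrite /pass_out divnMDl // modnMDl divn_small // modn_small // addn0.
Qed.

Definition sorted_runs f r N : Prop :=
  forall q, (q.+1 * r <= N) -> sorted <=%R (seg f (q * r) r).

Fixpoint odds s : seq R := if s is x :: y :: s' then y :: odds s' else [::].

Lemma odds_ind (P : seq R -> Prop) :
  P [::] -> (forall x, P [:: x]) -> (forall x y s, P s -> P (x :: y :: s)) ->
  forall s, P s.
Proof.
move=> P0 P1 P2 s; suff : P s /\ forall x, P (x :: s) by case.
by elim: s => [|x s [IH1 IH2]]; split=> // y; apply: P2.
Qed.

Lemma nth_odds s i : nth 0%R (odds s) i = nth 0%R s (2 * i).+1.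
Proof.
elim/odds_ind: s i => [|x|x y s IH] [|i]; rewrite ?mulnS //= ?nth_nil //. 
Qed.

Lemma size_odds s n : size s = 2 * n -> size (odds s) = n.
Proof.
elim/odds_ind: s n => [|x|x y s IH] [|n] //=; try by (move=> ?; lia).
by move=> h; rewrite (IH n) //; lia.
Qed.

Lemma odds_subseq s : subseq (odds s) s.
Proof.
elim/odds_ind: s => [|x|x y s IH] //; rewrite [odds _]/=.
by apply: (@subseq_trans _ (y :: s)); [rewrite /= eqxx|exact: subseq_cons].
Qed.

Lemma sorted_le_all (x : R) s : sorted <=%R (x :: s) -> all (fun y => x <= y)%R s.
Proof. exact/order_path_min/le_trans. Qed.

(** The elements [<= v] of a sorted list form a prefix, and each kept one is preceded by a discarded
    one that is also [<= v]. On this side thinning never overestimates. *)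
Lemma count_odds_le s v : sorted <=%R s ->
  2 * count (fun y => y <= v)%R (odds s) <= count (fun y => y <= v)%R s.
Proof.
elim/odds_ind: s => [|x|x y s IH] //= /andP[xy ys].
have := IH (path_sorted ys); case: (leP y v) => /= yv; last by lia.
by rewrite (le_trans xy yv) /=; lia.
Qed.

(** The elements [>= v] form a suffix; only its first kept element may have a discarded partner
    below [v], hence an error of at most one. *)
Lemma count_odds_ge s v : sorted <=%R s ->
  2 * count (fun y => v <= y)%R (odds s) <= (count (fun y => v <= y)%R s).+1.
Proof.
elim/odds_ind: s => [|x|x y s IH] //= /andP[xy ys].
have := IH (path_sorted ys); case: (leP v y) => /= vy; last by lia.
case: (leP v x) => /= vx; first by lia.
move=> _; have ally : all (fun z => v <= z)%R s.
  by apply/allP => z zs; apply: le_trans vy _; move/allP: (sorted_le_all ys); apply.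
have : all (fun z => v <= z)%R (odds s).
  by apply/allP => z /(mem_subseq (odds_subseq s)); move/allP: ally; apply.
rewrite !all_count => /eqP ->; move: ally; rewrite all_count => /eqP ->.
have : 2 * size (odds s) <= size s.
  by elim/odds_ind: s {IH ys} => //= ? ? ? h; lia.
by move: (size _) (size _) => a b; clear; lia.
Qed.

Lemma count_seg_blocks (P : pred R) f Q b :
  count P (seg f 0 (Q * b)) = \sum_(q < Q) count P (seg f (q * b) b).
Proof.
elim: Q => [|Q IH]; first by rewrite big_ord0.
by rewrite big_ord_recr /= mulSnr seg_cat count_cat IH add0n.
Qed.

(** * One round: two merge passes, the second of which discards half of the elements *)

Section Round.
Variables (f g h : nat -> R) (r Q : nat).
Hypothesis r0 : 0 < r.
Hypothesis srt : sorted_runs f r (Q * (4 * r)).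
Hypothesis Hg : forall p, p < Q * (4 * r) -> g p = pass_out f r p.
Hypothesis Hh : forall p, p < Q * (2 * r) -> h p = pass_out g (2 * r) (2 * p).+1.

Let M1 q := merged f r (2 * q).
Let M2 q := merged f r (2 * q).+1.

Let seg_g q : q < Q * 2 -> seg g (q * (2 * r)) (2 * r) = merged f r q.
Proof.
move=> qQ; apply: (@eq_from_nth _ 0%R); rewrite ?size_seg ?size_merged // => i ir.
rewrite nth_seg // Hg ?pass_outE //; nia.
Qed.

Let merged_g q : q < Q -> merged g (2 * r) q = merge (M1 q) (M2 q).
Proof.
move=> qQ; rewrite /merged; congr (path.merge _ _ _).
  have -> : q * (2 * (2 * r)) = (2 * q) * (2 * r) by lia.
  by rewrite seg_g //; lia.
have -> : q * (2 * (2 * r)) + 2 * r = (2 * q).+1 * (2 * r) by lia.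
by rewrite seg_g //; lia.
Qed.

Let seg_h q : q < Q -> seg h (q * (2 * r)) (2 * r) = odds (merge (M1 q) (M2 q)).
Proof.
move=> qQ; have sz : size (odds (merge (M1 q) (M2 q))) = 2 * r.
  by apply: size_odds; rewrite size_merge size_cat !size_merged; lia.
apply: (@eq_from_nth _ 0%R); rewrite ?size_seg // => i ir.
rewrite nth_seg // nth_odds Hh; last by nia.
have -> : (2 * (q * (2 * r) + i)).+1 = q * (2 * (2 * r)) + (2 * i).+1 by lia.
by rewrite pass_outE ?merged_g //; lia.
Qed.

Let sorted_merged q : q < Q * 2 -> sorted <=%R (merged f r q).
Proof.
move=> qQ; apply: merge_sorted; first exact: le_total.
  have -> : q * (2 * r) = (2 * q) * r by lia.
  by apply: srt; nia.
have -> : q * (2 * r) + r = (2 * q).+1 * r by lia.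
by apply: srt; nia.
Qed.

Let sorted_quad q : q < Q -> sorted <=%R (merge (M1 q) (M2 q)).
Proof.
by move=> qQ; apply: merge_sorted; [exact: le_total| |]; apply: sorted_merged; lia.
Qed.

Let count_quad (P : pred R) q :
  count P (merge (M1 q) (M2 q)) = count P (seg f (q * (4 * r)) (4 * r)).
Proof.
rewrite count_merge count_cat !count_merge !count_cat.
have -> : 2 * q * (2 * r) = q * (4 * r) by lia.
have -> : (2 * q).+1 * (2 * r) = q * (4 * r) + r + r by lia.
have -> : 4 * r = r + r + r + r by lia.
by rewrite !seg_cat !count_cat !addnA.
Qed.

Lemma round_sorted : sorted_runs h (2 * r) (Q * (2 * r)).
Proof.
move=> q qQ; have {}qQ : q < Q by nia.
rewrite seg_h //; apply: subseq_sorted (odds_subseq _) (sorted_quad qQ).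
exact: le_trans.
Qed.

Lemma round_count_le v :
  2 * count (fun y => y <= v)%R (seg h 0 (Q * (2 * r))) <=
  count (fun y => y <= v)%R (seg f 0 (Q * (4 * r))).
Proof.
rewrite !count_seg_blocks big_distrr /=; apply: leq_sum => q _.
by rewrite seg_h // -count_quad count_odds_le // sorted_quad.
Qed.

(** Each of the [Q] blocks of length [4 * r] is thinned once and adds at most one to the error. *)
Lemma round_count_ge v :
  2 * count (fun y => v <= y)%R (seg h 0 (Q * (2 * r))) <=
  count (fun y => v <= y)%R (seg f 0 (Q * (4 * r))) + Q.
Proof.
rewrite !count_seg_blocks big_distrr /= -[X in _ + X]card_ord -sum1_card -big_split /=.
apply: leq_sum => q _.
by rewrite seg_h // -count_quad addn1 count_odds_ge // sorted_quad.
Qed.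

End Round.

Lemma sorted_count_le s i : sorted <=%R s -> i < size s ->
  i < count (fun y => y <= s`_i)%R s.
Proof.
move=> ss si; rewrite -{2}(cat_take_drop i.+1 s) count_cat.
have : all (fun y => y <= s`_i)%R (take i.+1 s).
  apply/(all_nthP 0%R) => j; rewrite size_takel // ltnS => ji; rewrite nth_take //.
  by apply: (sorted_leq_nth le_trans le_refl); rewrite ?inE //; exact: leq_ltn_trans si.
by rewrite all_count size_takel // => /eqP ->; exact: leq_addr.
Qed.

Lemma sorted_count_ge s i : sorted <=%R s -> i < size s ->
  size s - i <= count (fun y => s`_i <= y)%R s.
Proof.
move=> ss si; rewrite -{3}(cat_take_drop i s) count_cat.
have : all (fun y => s`_i <= y)%R (drop i s).
  apply/(all_nthP 0%R) => j; rewrite size_drop => ji; rewrite nth_drop.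
  apply: (sorted_leq_nth le_trans le_refl); rewrite ?inE ?leq_addr //.
  by rewrite -ltn_subRL.
by rewrite all_count size_drop => /eqP ->; exact: leq_addl.
Qed.

End ApproximateMedian.

(** * Correctness of a merge pass *)

Section MergePass.
Variable R : realType.
Variables (inst table query : memory R) (W M : nat).
Local Notation E := (environment inst table query).

(* Merges adjacent runs of length [wi 12] of the first [wi 11] cells of [src],
   and keeps one output element out of [d]: since cell [k %/ d] is written for
   every [k], the surviving elements are those of index [d - 1] modulo [d]. *)
Definition merge_pass (src dst d : nat) : cmd :=
  let r := wi 12 in
  let k := wi 14 in
  let base := IMul (IDiv k (IMul (ILit 2) r)) (IMul (ILit 2) r) in
  let i := wi 13 in
  let j := ISub (ISub k base) i in
  let left := RGet Work src (IAdd base i) in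
  let right := RGet Work src (IAdd (IAdd base r) j) in
  For 14 (wi 11)
    (Seq (If (BLeI k base) (seti0 13 (ILit 0)) Skip)
         (If (BAnd (BNot (BLeI r i)) (BNot (BAnd (BNot (BLeI r j)) (BNot (BLeR left right)))))
            (Seq (SetR dst (IDiv k (ILit d)) left) (seti0 13 (IAdd i (ILit 1))))
            (SetR dst (IDiv k (ILit d)) right))).

(** Inside a block, [t] elements have been output, [i] from the left run and [t - i] from the right;
    the rest of the output is the merge of the unread parts. For [d = 2], cell [p] is written twice
    and keeps the second value, of index [2 p + 1]. *)
Lemma wp_merge_pass (src dst d : nat) (m : memory R) N r :
  (src, dst) \in [:: (5, 6); (6, 5)] -> 0 < d -> 0 < r -> (2 * r) %| N ->
  N <= W -> N <= M -> 0 < M -> icell m 11 0 = N -> icell m 12 0 = r ->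
  wp inst table query W M (merge_pass src dst d) m (N * 7 + 2)
    (fun m' => forall p, p.+1 * d <= N ->
       rcell m' dst p = pass_out (rcell m src) r (p * d + d).-1).
Proof.
move=> sd d0 r0 rN NW NM M0 eN er; set f := rcell m src.
have r20 : 0 < 2 * r by lia.
(* Nothing is claimed about cell [13] when [t = 0]: at a block boundary it still holds the count of
   the previous block, and the next iteration resets it. *)
pose I k (m' : memory R) := [/\ icell m' 11 0 = N, icell m' 12 0 = r, rcell m' src = f,
  (forall p, p.+1 * d <= k -> rcell m' dst p = pass_out f r (p * d + d).-1)
  & let q := k %/ (2 * r) in let t := k %% (2 * r) in let i := icell m' 13 0 in
    0 < t -> [/\ i <= r, i <= t, t - i <= r &
    drop t (merged f r q) = merge <=%R (drop i (seg f (q * (2 * r)) r))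
       (drop (t - i) (seg f (q * (2 * r) + r) r))]].
apply: wp_weaken; first apply: (wp_for (n := N) (k := 5) (I := I)) => //.
- by move=> j m' [].
- split=> //; first by move=> p; rewrite leqn0 muln_eq0 (gtn_eqF d0).
  by rewrite /= mod0n.
- move=> k m' kN [I1 I2 I3 I4 I5] ek.
  apply: (wp_weaken (k := 5) (Q := fun m1 => I k.+1 (seti m1 14 0 k.+1))) => //.
  have kW : k < W by lia.
  pose q := k %/ (2 * r); pose t := k %% (2 * r).
  have tE : k - q * (2 * r) = t by rewrite /q /t; have := divn_eq k (2 * r); lia.
  have t2r : t < 2 * r by rewrite ltn_mod.
  have kb : (k <= q * (2 * r)) = (t == 0) by have := divn_eq k (2 * r); rewrite -/q -/t; lia.
  set i := if t == 0 then 0 else icell m' 13 0.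
  have [ir it tir mE] : [/\ i <= r, i <= t, t - i <= r &
    drop t (merged f r q) = merge <=%R (drop i (seg f (q * (2 * r)) r))
       (drop (t - i) (seg f (q * (2 * r) + r) r))].
    rewrite /i; case: eqP => [->|/eqP t0]; first by rewrite !drop0.
    by apply: I5; rewrite lt0n.
  have step := @merge_step R (seg f (q * (2 * r)) r) (seg f (q * (2 * r) + r) r) i (t - i).
  rewrite !size_seg in step; have {}step := step ir tir _.
  have {mE}step : drop t (merged f r q) =
     if (i < r) && ~~ ((t - i < r) &&
         ~~ (f (q * (2 * r) + i)%N <= f (q * (2 * r) + r + (t - i))%N)%R)
     then f (q * (2 * r) + i) ::
       merge <=%R (drop i.+1 (seg f (q * (2 * r)) r))
           (drop (t.+1 - i.+1) (seg f (q * (2 * r) + r) r))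
     else f (q * (2 * r) + r + (t - i)) ::
       merge <=%R (drop i (seg f (q * (2 * r)) r))
           (drop (t.+1 - i) (seg f (q * (2 * r) + r) r)).
    rewrite mE step; last by lia.
    rewrite subSS subSn //.
    case: (ltnP i r) => hi; case: (ltnP (t - i) r) => hj /=; last by lia.
    - by rewrite !nth_seg.
    - by rewrite nth_seg.
    - by rewrite nth_seg.
  apply: wp_lf; rewrite /lf -/lf.
  (* [m1] abstracts the state after the conditional reset of cell [13], so that the merge step is
     not treated once per branch. *)
  have [m1 [J1 J2 J3 J4 J5] Hm1] : exists2 m1, [/\ icell m1 14 0 = k, icell m1 11 0 = N,
      icell m1 12 0 = r, rcell m1 = rcell m' & icell m1 13 0 = i] &
      forall Q, Q m1 -> if beval (E m') (BLeI (wi 14) (IMul (IDiv (wi 14) (IMul (ILit 2) (wi 12)))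
                (IMul (ILit 2) (wi 12)))) then lf inst table query W M (seti0 13 (ILit 0)) m' Q
         else lf inst table query W M Skip m' Q.
    exists (if t == 0 then seti m' 13 0 0 else m').
      by rewrite /i; case: ifP.
    by move=> Q; rewrite /= ek I2 -/q kb; case: ifP.
  apply: Hm1 => {I5}.
  rewrite /= J1 J3 J5 -/q tE J4 I3 -!ltnNge.
  have finish v i' m2 : drop t (merged f r q) = v :: merge <=%R
        (drop i' (seg f (q * (2 * r)) r)) (drop (t.+1 - i') (seg f (q * (2 * r) + r) r)) ->
      i' <= r -> i' <= t.+1 -> t.+1 - i' <= r ->
      icell m2 11 0 = N -> icell m2 12 0 = r -> icell m2 13 0 = i' ->
      rcell m2 = store (rcell m') dst (k %/ d) v -> I k.+1 (seti m2 14 0 k.+1).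
    move=> dE ir' it' tir' K1 K2 K3 K4.
    have vE : v = pass_out f r k.
      by rewrite /pass_out -/q -/t -[t in nth _ _ t]addn0 -nth_drop dE.
    split=> //=; rewrite ?K4.
    - rewrite -I3; apply/funext => p; rewrite /store.
      by move: sd; rewrite !inE => /orP[] /eqP[-> ->].
    - move=> p pk; rewrite /store eqxx /=; case: eqP => [pE|/eqP pE].
        rewrite vE; congr pass_out; move: pk; rewrite pE.
        have := divn_eq k d; have := ltn_pmod k d0; lia.
      apply: I4; rewrite leqNgt; apply: contraNN pE => pk'.
      have kE : k = p * d + d.-1 by lia.
      by rewrite kE divnMDl // divn_small ?addn0 //; lia.
    (* At the end of a block the next position is [0] modulo [2 * r], and the claim on the run heads
       is void. *)
    - have [tl|tl] := ltnP t.+1 (2 * r); last first.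
        have -> : k.+1 %% (2 * r) = 0; last by [].
        have -> : k.+1 = q.+1 * (2 * r) by have := divn_eq k (2 * r); rewrite -/q -/t; lia.
        by rewrite modnMl.
      have kE : k.+1 = q * (2 * r) + t.+1 by have := divn_eq k (2 * r); rewrite -/q -/t; lia.
      rewrite kE modnMDl divnMDl // divn_small // modn_small // addn0 /store /= K3 => _.
      by split=> //; rewrite -[t.+1]add1n -drop_drop dE /= drop0.
  have kdM : k %/ d < M by apply: leq_ltn_trans (leq_div _ _) _; lia.
  case: ifP step => cond step; split=> //.
    have hi : i < r by case/andP: cond.
    split=> //; first by lia.
    by apply: finish step _ _ _ _ _ _ _; rewrite /= ?addn1 ?J4 // ; lia.
  apply: finish step _ _ _ _ _ _ _; rewrite /= ?J4 //; try lia.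
- by lia.
- by move=> m' [].
Qed.

End MergePass.

(** * The pivot by thinning merge sort, and selection *)

Section Pivot.
Variable R : realType.
Variables (inst table query : memory R) (W M : nat).
Local Notation E := (environment inst table query).
Local Notation wp := (wp inst table query W M).

Definition merge_round : cmd :=
  Seq (merge_pass 5 6 1)
 (Seq (seti0 12 (IMul (ILit 2) (wi 12)))
 (Seq (merge_pass 6 5 2)
      (seti0 11 (IDiv (wi 11) (ILit 2))))).

(** A round consumes groups of four runs, so only a prefix of the candidates is sampled, of length
    the greatest power of [4] that fits. A round halves [wi 11] and doubles [wi 12]; their quotient
    drops by a factor of four until a single sorted run is left. *)
Definition pivot_cmd : cmd :=
  Seq (seti0 11 (ILit 1))
 (Seq (While (BLeI (IMul (ILit 4) (wi 11)) (wi 10)) (seti0 11 (IMul (ILit 4) (wi 11))))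
 (Seq (For 14 (wi 11) (SetR 5 (wi 14) (RGet Work 4 (wi 14))))
 (Seq (seti0 12 (ILit 1))
 (Seq (While (BNot (BLeI (wi 11) (wi 12))) merge_round)
      (setr0 9 (RGet Work 5 (IDiv (wi 12) (ILit 4)))))))).

Lemma wp_merge_round Q r m :
  0 < r -> 0 < Q -> Q * (4 * r) <= W -> Q * (4 * r) <= M ->
  icell m 11 0 = Q * (4 * r) -> icell m 12 0 = r ->
  sorted_runs (rcell m 5) r (Q * (4 * r)) ->
  wp merge_round m (14 * (Q * (4 * r)) + 6) (fun m' =>
    [/\ icell m' 11 0 = Q * (2 * r), icell m' 12 0 = 2 * r,
        sorted_runs (rcell m' 5) (2 * r) (Q * (2 * r)),
        forall v, 2 * count (fun y => y <= v)%R (seg (rcell m' 5) 0 (Q * (2 * r))) <=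
                  count (fun y => y <= v)%R (seg (rcell m 5) 0 (Q * (4 * r)))
      & forall v, 2 * count (fun y => v <= y)%R (seg (rcell m' 5) 0 (Q * (2 * r))) <=
                  count (fun y => v <= y)%R (seg (rcell m 5) 0 (Q * (4 * r))) + Q]).
Proof.
move=> r0 Q0 NW NM eN er srt; set N := Q * (4 * r) in NW NM eN srt *.
have M0 : 0 < M by apply: leq_trans NM; rewrite /N; nia.
apply: (@wp_weaken _ _ _ _ _ _ _ _ ((N * 7 + 2) + (1 + ((N * 7 + 2) + 1)))); last 2 first.
- by lia.
- by move=> m'; apply.
apply: wp_seq.
apply: wp_weaken; first apply: wp_frame; first apply: (wp_merge_pass inst table query (N := N) (r := r)) => //.
- by rewrite /N; apply/dvdnP; exists (2 * Q); lia.
- by [].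
move=> m1 [H1 [Hi Hr]]; apply: wp_seq; apply: wp_lf => /=.
rewrite Hi // er; split=> //; first by apply: leq_trans NW; rewrite /N; nia.
apply: wp_seq; apply: wp_weaken; first apply: wp_frame;
  first apply: (wp_merge_pass inst table query (N := N) (r := 2 * r)) => //.
- by lia.
- by rewrite /N; apply/dvdnP; exists Q; lia.
- by rewrite /= /store /= Hi.
- by [].
move=> m2 [H2 [Hi2 Hr2]]; apply: wp_lf => /=.
rewrite !Hi2 //= /store /= Hi // eN.
have -> : N %/ 2 = Q * (2 * r).
  by rewrite /N (_ : Q * (4 * r) = Q * (2 * r) * 2) ?mulnK //; lia.
split=> //; first by apply: leq_trans NW; rewrite /N; nia.
have Hg p : p < Q * (4 * r) -> rcell m1 6 p = pass_out (rcell m 5) r p.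
  by move=> pN; rewrite H1 ?muln1 ?addn1.
have Hh p : p < Q * (2 * r) -> rcell m2 5 p = pass_out (rcell m1 6) (2 * r) (2 * p).+1.
  move=> pN; rewrite H2 /=; last by rewrite /N; nia.
  by congr pass_out; lia.
split=> //=.
- by rewrite Hi2.
- exact: round_sorted r0 srt Hg Hh.
- by move=> v; apply: round_count_le r0 srt Hg Hh v.
- by move=> v; apply: round_count_ge r0 srt Hg Hh v.
Qed.

(** Each survivor stands for [w] elements, and the hypothesis on [e] means [e <= (N - N / r) / 2].
    The error affects the [>=] side only, which the position [r / 4] compensates: at least
    [w r / 4 = N / 4] elements are [<=] the pivot, and at least [3 N / 4 - N / 2] are [>=] it. *)
Lemma pivot_rank r w e N d a1 a2 c1 c2 :
  0 < r -> w * r = N -> 2 * r * e + N <= N * r -> d = r %/ 4 ->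
  d < a1 -> r - d <= a2 -> w * a1 <= c1 -> w * a2 <= c2 + e ->
  N <= 4 * c1 /\ N <= 4 * c2.
Proof.
move=> r0 wr er -> da1 da2 h1 h2.
have e2N : 2 * e <= N by rewrite -(leq_pmul2l r0); lia.
have d4 : r %/ 4 * 4 <= r by exact: leq_trunc_div.
have d5 : r <= 4 * (r %/ 4).+1 by have := divn_eq r 4; have := ltn_pmod r (isT : 0 < 4); lia.
split.
  have : w * r <= 4 * (w * a1) by rewrite mulnCA leq_mul2l; apply/orP; right; lia.
  by lia.
have : w * (3 * r) <= w * (4 * a2) by rewrite leq_mul2l; apply/orP; right; lia.
by lia.
Qed.

Lemma wp_pivot m n : 0 < n -> n <= W -> n <= M -> icell m 10 0 = n ->
  wp pivot_cmd m (60 * n) (fun m' => let l := seg (rcell m 4) 0 n in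
    n <= 16 * count (fun y => y <= rcell m' 9 0)%R l /\
    n <= 16 * count (fun y => rcell m' 9 0 <= y)%R l).
Proof.
move=> n0 nW nM en; set X := rcell m 4.
have M0 : 0 < M by lia.
apply: (@wp_weaken _ _ _ _ _ _ _ _
  (1 + ((2 * n).+1 + ((n * 3 + 2) + (1 + ((40 * n).+1 + 1)))))); last 2 first.
- by lia.
- by move=> m'; apply.
apply: wp_seq; apply: wp_lf => /=; split=> //; first by lia.
apply: wp_seq.
apply: wp_weaken; first apply: (wp_while
  (I := fun m' => [/\ icell m' 10 0 = n, rcell m' 4 = X &
          exists2 a, icell m' 11 0 = 4 ^ a & 4 ^ a <= n])
  (phi := fun m' => 2 * (n - icell m' 11 0))).
- move=> m' [I1 I2 [a I3 an]] /=; rewrite I1 I3 => h; exists 1.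
  apply: wp_lf => /=; rewrite I3; split=> //; first by lia.
  rewrite /store /= -expnS in h *; split.
    by split=> //; exists a.+1.
  have : 0 < 4 ^ a by rewrite expn_gt0.
  rewrite expnS in h *; lia.
- by split=> //; exists 0.
- by rewrite /= /store /=; lia.
move=> m1 [[I1 I2 [a I3 an]]] /=; rewrite I1 I3 => /negbT; rewrite -ltnNge => na.
(* As [n < 4 * N], a quarter of the [N] sampled elements is at least a sixteenth of all
   candidates. *)
set N := 4 ^ a in I3 an na.
have N0 : 0 < N by rewrite expn_gt0.
apply: wp_seq; apply: wp_weaken; first apply: wp_frame; first apply: (wp_for (n := N) (k := 1)
  (I := fun k m' => [/\ icell m' 11 0 = N, rcell m' 4 = X &
     forall p, p < k -> rcell m' 5 p = X p])) => //.
- by lia.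
- by move=> k m' [].
- move=> k m' kN [K1 K2 K3] ek; apply: wp_lf => /=; rewrite ek; split; first by lia.
  move=> _; split=> // p; rewrite ltnS leq_eqVlt /= /store /= K2.
  by case: eqP => [->|_ /K3].
- by lia.
move=> m2 [[K1 K2 K3] _]; apply: wp_seq; apply: wp_lf => /=; split=> //; first by lia.
pose l0 := seg X 0 N.
(* [w] counts the original elements per survivor and [e] is the accumulated rank error. A round adds
   [w * Q = N / (4 * r)] to [e] and doubles [r]; the last inequality sums this geometric series. *)
pose J (m' : memory R) := exists r j w e,
  [/\ 0 < r, icell m' 11 0 = r * 4 ^ j /\ icell m' 12 0 = r, w * (r * 4 ^ j) = N,
     sorted_runs (rcell m' 5) r (r * 4 ^ j)
   & [/\ forall v, w * count (fun y => y <= v)%R (seg (rcell m' 5) 0 (r * 4 ^ j)) <=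
                   count (fun y => y <= v)%R l0,
        forall v, w * count (fun y => v <= y)%R (seg (rcell m' 5) 0 (r * 4 ^ j)) <=
                   count (fun y => v <= y)%R l0 + e
      & 2 * r * e + N <= N * r]].
apply: wp_seq; apply: wp_weaken; first apply: (wp_while (I := J)
  (phi := fun m' => 40 * icell m' 11 0)).
- move=> m' [r [[|j] [w [e [r0 [J1 J2] J3 J4 [J5 J6 J7]]]]]] /=; rewrite J1 J2.
    by rewrite muln1 leqnn.
  move=> _; set Q := 4 ^ j.
  have EN : r * 4 ^ j.+1 = Q * (4 * r) by rewrite expnS -/Q; lia.
  have Q0 : 0 < Q by rewrite expn_gt0.
  rewrite EN in J1 J3 J4 J5 J6 *.
  have w0 : 0 < w by case: (w) J3 N0 => // <-.
  have QN : Q * (4 * r) <= N by rewrite -J3 leq_pmull.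
  (* A round halves the potential [40 * wi 11] and so releases [20] per element, against a cost of
     about [14]. *)
  exists (14 * (Q * (4 * r)) + 6).
  apply: wp_weaken; first apply: (@wp_merge_round Q r m') => //; try lia.
  move=> m'' [H1 H2 H3 H4 H5]; rewrite H1; split; last by nia.
  have EN' : 2 * r * 4 ^ j = Q * (2 * r) by rewrite -/Q; lia.
  exists (2 * r), j, (2 * w), (e + w * Q); rewrite EN'; split=> //; first by lia.
    by rewrite -J3; lia.
  split=> [v|v|].
  + apply: leq_trans (J5 v); rewrite -mulnA mulnCA leq_mul2l.
    by rewrite (H4 v) orbT.
  + rewrite -mulnA mulnCA addnA; apply: leq_trans (leq_add (J6 v) (leqnn _)).
    by rewrite -mulnDr leq_mul2l (H5 v) orbT.
  + nia.
- exists 1, a, 1, 0; rewrite mul1n /= /store /=; split=> //.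
  + by rewrite mul1n.
  + have -> : seg (rcell m2 5) 0 (4 ^ a) = l0.
      by apply: eq_seg => i /andP[_]; rewrite add0n; apply: K3.
    by split=> [v|v|]; rewrite ?mul1n ?addn0 ?muln0 ?muln1.
- by rewrite /= /store /= K1; lia.
move=> m3 [[r [j [w [e [r0 [J1 J2] J3 J4 [J5 J6 J7]]]]]]] /=; rewrite J1 J2 => /negbFE rj.
have {}rj : 4 ^ j = 1.
  by have : 0 < 4 ^ j by [rewrite expn_gt0]; nia.
rewrite rj muln1 in J3 J4 J5 J6.
apply: wp_lf => /=; split=> //; rewrite J2 /store /=.
set p := rcell m3 5 (r %/ 4).
have r4 : r %/ 4 < r by apply: ltn_Pdiv.
have seg0 : sorted <=%R (seg (rcell m3 5) 0 r) by apply: (J4 0); rewrite mul1n.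
have pE : p = nth 0%R (seg (rcell m3 5) 0 r) (r %/ 4) by rewrite nth_seg.
have hle := sorted_count_le seg0 (i := r %/ 4).
have hge := sorted_count_ge seg0 (i := r %/ 4).
rewrite size_seg -pE in hle hge; have {}hle := hle r4; have {}hge := hge r4.
have lX (P : pred R) : count P l0 <= count P (seg X 0 n).
  by rewrite -(subnKC an) seg_cat count_cat leq_addr.
have [H1 H2] := pivot_rank r0 J3 J7 erefl hle hge (J5 p) (J6 p).
have L1 := lX (fun y => y <= p)%R; have L2 := lX (fun y => p <= y)%R.
split; [apply: leq_trans (_ : 16 * count (fun y => y <= p)%R l0 <= _) |
        apply: leq_trans (_ : 16 * count (fun y => p <= y)%R l0 <= _)].
- move: na H1; move: (count _ _) => c; clear; lia.
- by rewrite leq_mul2l L1.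
- move: na H2; move: (count _ _) => c; clear; lia.
- by rewrite leq_mul2l L2.
Qed.

(** [s] may be fractional and [lam] need not occur in [l]: the condition says that [lam] minimizes
    the dual objective [s lam + sum max(0, y - lam)]. *)
Definition threshold (l : seq R) (s lam : R) : Prop :=
  ((count (fun y => lam < y) l)%:R <= s <= (count (fun y => lam <= y) l)%:R)%R.

Lemma count_tri (l : seq R) p :
  size l = count (fun y => p < y)%R l + count (fun y => y == p) l + count (fun y => y < p)%R l.
Proof. by elim: l => //= y l ->; case: ltgtP; lia. Qed.

Lemma count_ge_tri (l : seq R) p :
  count (fun y => p <= y)%R l = count (fun y => p < y)%R l + count (fun y => y == p) l.
Proof. by elim: l => //= y l ->; case: ltgtP; lia. Qed.

Lemma count_le_tri (l : seq R) p :
  count (fun y => y <= p)%R l = count (fun y => y == p) l + count (fun y => y < p)%R l.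
Proof. by elim: l => //= y l ->; case: ltgtP; lia. Qed.

(** If more than [s] elements exceed the pivot, so does any threshold of those elements, and the
    discarded ones enter neither count. *)
Lemma threshold_gt (l : seq R) s p lam :
  (s < (count (fun y => p < y) l)%:R)%R ->
  threshold [seq y <- l | (p < y)%R] s lam -> threshold l s lam.
Proof.
move=> sG; rewrite /threshold !count_filter => /andP[h1 h2].
have pl : (p < lam)%R.
  rewrite ltNge; apply/negP => lp; move: (le_lt_trans h1 sG).
  rewrite ltr_nat ltnNge => /negP; apply; apply: sub_count => y py /=.
  by rewrite py andbT (le_lt_trans lp).
rewrite (eq_count (a2 := fun y => lam < y)%R) in h1; last first.
  by move=> y /=; apply: andb_idr; exact: lt_trans.
rewrite (eq_count (a2 := fun y => lam <= y)%R) in h2; last first.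
  by move=> y /=; apply: andb_idr; exact: lt_le_trans.
by rewrite h1 h2.
Qed.

(** All elements [>= p] lie above the threshold, hence the rank drops by their number; the strict
    inequality [sG] forces [lam < p]. *)
Lemma threshold_lt (l : seq R) s p lam :
  ((count (fun y => p <= y) l)%:R < s)%R ->
  threshold [seq y <- l | (y < p)%R] (s - (count (fun y => p <= y) l)%:R)%R lam ->
  threshold l s lam.
Proof.
move=> sG; rewrite /threshold !count_filter => /andP[h1 h2].
have lp : (lam < p)%R.
  rewrite ltNge; apply/negP => pl; move: h2.
  rewrite [count (predI _ _) l](eq_count (a2 := pred0)) ?count_pred0; last first.
    move=> y /=; apply/negbTE/negP => /andP[yp ly].
    by have := le_lt_trans yp ly; rewrite ltNge pl.
  by rewrite subr_le0 leNgt sG.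
have E (c : rel R) : (forall y, p <= y -> c lam y)%R ->
    count (c lam) l = (count (fun y => p <= y)%R l +
      count (predI (c lam) (fun y => y < p)%R) l)%N.
  move=> cp; elim: l {sG h1 h2} => //= y l ->.
  by case: (leP p y) => [/cp->|_] /=; rewrite ?andbT ?andbF; lia.
rewrite (E <%R) => [|y]; last exact: lt_le_trans.
rewrite (E <=%R) => [|y]; last by move/(lt_le_trans lp)/ltW.
by rewrite !natrD; apply/andP; split; [rewrite -lerBrDl|rewrite -lerBlDl].
Qed.

(** Filtering in place is safe because the write index [wi 15] never overtakes the read index
    [wi 17]. *)
Definition keep_cmd (cond : bexp) : cmd :=
  Seq (seti0 15 (ILit 0))
 (Seq (For 17 (wi 10) (If cond
     (Seq (SetR 4 (wi 15) (RGet Work 4 (wi 17))) (seti0 15 (IAdd (wi 15) (ILit 1)))) Skip))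
      (seti0 10 (wi 15))).

Lemma wp_keep (P : pred R) cond m n :
  n <= W -> n <= M -> 0 < M -> icell m 10 0 = n ->
  (forall m', rcell m' 9 = rcell m 9 ->
     beval (E m') cond = P (rcell m' 4 (icell m' 17 0))) ->
  let l := seq.filter P (seg (rcell m 4) 0 n) in
  wp (keep_cmd cond) m (n * 5 + 4) (fun m' =>
    icell m' 10 0 = size l /\ seg (rcell m' 4) 0 (size l) = l).
Proof.
move=> nW nM M0 en condE l; set X := rcell m 4 in l *.
apply: (@wp_weaken _ _ _ _ _ _ _ _ (1 + ((n * (3 + 2) + 2) + 1))); last 2 first.
- by lia.
- by move=> m'; apply.
apply: wp_seq; apply: wp_lf => /=; split=> //.
pose I k m' := let l' := seq.filter P (seg X 0 k) in
  [/\ icell m' 10 0 = n, rcell m' 9 = rcell m 9, icell m' 15 0 = size l',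
      seg (rcell m' 4) 0 (size l') = l' & forall i, k <= i -> rcell m' 4 i = X i].
apply: wp_seq; apply: wp_weaken; first apply: (wp_for (n := n) (k := 3) (I := I)) => //.
- by move=> k m' [].
- move=> k m' kn [I1 I2 I3 I4 I5] ek; apply: wp_lf => /=.
  rewrite condE // ek I5 // I3 /I segS filter_rcons.
  have lk : size (seq.filter P (seg X 0 k)) <= k.
    by rewrite size_filter (leq_trans (count_size _ _)) // size_seg.
  case PX: (P (X k)); last first.
    by move=> _; split=> // i ki; apply: I5; lia.
  split; first by lia.
  split=> //; first by lia.
  move=> _; rewrite size_rcons addn1; split=> //.
    rewrite segS; congr rcons.
      rewrite -[RHS]I4; apply: eq_seg => i /andP[_]; rewrite add0n => ik.
      by rewrite /= /store /= ltn_eqF.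
    by rewrite /= /store !eqxx.
  move=> i ki; rewrite /= /store /= gtn_eqF; last by lia.
  by apply: I5; lia.
- by [].
move=> m' [I1 I2 I3 I4 I5]; apply: wp_lf => /=; split=> //.
by rewrite I3 size_filter (leq_trans (count_size _ _)) // size_seg.
Qed.

Definition tally_cmd : cmd :=
  let x := RGet Work 4 (wi 17) in
  Seq (seti0 15 (ILit 0))
 (Seq (seti0 16 (ILit 0))
      (For 17 (wi 10) (If (BLeR x (wr 9))
         (If (BLeR (wr 9) x) (seti0 16 (IAdd (wi 16) (ILit 1))) Skip)
         (seti0 15 (IAdd (wi 15) (ILit 1)))))).

Lemma wp_tally m n : n <= W -> 0 < M -> icell m 10 0 = n ->
  let l := seg (rcell m 4) 0 n in let p := rcell m 9 0 in
  wp tally_cmd m (n * 5 + 4) (fun m' =>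
    icell m' 15 0 = count (fun y => p < y)%R l /\
    icell m' 16 0 = count (fun y => y == p) l).
Proof.
move=> nW M0 en l p; rewrite /l {l}; set X := rcell m 4.
apply: (@wp_weaken _ _ _ _ _ _ _ _ (1 + (1 + (n * (3 + 2) + 2)))); last 2 first.
- by lia.
- by move=> m'; apply.
apply: wp_seq; apply: wp_lf => /=; split=> //.
apply: wp_seq; apply: wp_lf => /=; split=> //.
pose I k m' := [/\ icell m' 10 0 = n, rcell m' = rcell m,
    icell m' 15 0 = count (fun y => p < y)%R (seg X 0 k) &
    icell m' 16 0 = count (fun y => y == p) (seg X 0 k)].
apply: wp_weaken; first apply: (wp_for (n := n) (k := 3) (I := I)) => //.
- by move=> k m' [].
- move=> k m' kn [I1 I2 I3 I4] ek; apply: wp_lf => /=.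
  have c (P : pred R) : count P (seg X 0 k) <= k by rewrite -[leqRHS](size_seg X 0) count_size.
  have e1 : count (fun y => p < y)%R (seg X 0 k.+1) =
      count (fun y => p < y)%R (seg X 0 k) + (p < X k)%R.
    by rewrite segS -cats1 count_cat /= addn0.
  have e2 : count (fun y => y == p) (seg X 0 k.+1) =
      count (fun y => y == p) (seg X 0 k) + (X k == p).
    by rewrite segS -cats1 count_cat /= addn0.
  rewrite ek I2 -/X -/p I3 I4 /I e1 e2.
  have b1 := c (fun y => p < y)%R; have b2 := c (fun y => y == p).
  by case: (ltgtP (X k) p) => h; rewrite ?addn0 ?addn1 /=; do ?split=> //;
    apply: leq_trans nW; apply: leq_ltn_trans kn.
- by [].
- by move=> m' [].
Qed.

(* The first [wi 10] cells of the real array [4] are the candidates, [wr 8] is the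
   remaining rank, [wr 9] the pivot, and the threshold ends up in [wr 7]. *)
Definition select_cmd : cmd :=
  let x := RGet Work 4 (wi 17) in
  let ge := RNat (IAdd (wi 15) (wi 16)) in
  Seq (seti0 18 (ILit 0))
    (While (BLeI (wi 18) (ILit 0))
       (Seq pivot_cmd (Seq tally_cmd
          (If (BNot (BLeR (RNat (wi 15)) (wr 8)))
             (keep_cmd (BNot (BLeR x (wr 9))))
             (If (BLeR (wr 8) ge)
                (Seq (setr0 7 (wr 9)) (seti0 18 (ILit 1)))
                (Seq (setr0 8 (RSub (wr 8) ge)) (keep_cmd (BNot (BLeR (wr 9) x))))))))).

(** A round on [k] candidates costs at most [70 k + 11] and, unless it ends the search, discards a
    sixteenth of them. A potential of [1600] per candidate then releases [100 k], which is enough as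
    [k > 0]. *)
Lemma wp_select m n : 0 < n -> n <= W -> n <= M -> icell m 10 0 = n ->
  (0 <= rcell m 8 0 <= n%:R)%R ->
  wp select_cmd m (1600 * n + 3) (fun m' =>
    threshold (seg (rcell m 4) 0 n) (rcell m 8 0) (rcell m' 7 0)).
Proof.
move=> n0 nW nM en s01; set l0 := seg (rcell m 4) 0 n; set s0 := rcell m 8 0 in s01 *.
have M0 : 0 < M by lia.
pose I (m' : memory R) := if icell m' 18 0 == 0 then
    exists l, [/\ icell m' 10 0 = size l, seg (rcell m' 4) 0 (size l) = l,
      0 < size l <= n, (0 <= rcell m' 8 0 <= (size l)%:R)%R &
      forall lam, threshold l (rcell m' 8 0) lam -> threshold l0 s0 lam]
  else threshold l0 s0 (rcell m' 7 0).
pose phi (m' : memory R) := if icell m' 18 0 == 0 then 1600 * icell m' 10 0 + 1 else 0.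
apply: (@wp_weaken _ _ _ _ _ _ _ _ (1 + (1600 * n + 1).+1)); last 2 first.
- by lia.
- by move=> m'; apply.
apply: wp_seq; apply: wp_lf => /=; split=> //.
apply: wp_weaken; first apply: (wp_while (I := I) (phi := phi)).
- move=> m1 + /=; rewrite /I /phi leqn0 => + d0; rewrite d0.
  move=> [l [I1 I2 /andP[l0' ln] s1 I3]].
  have lW : size l <= W by apply: leq_trans nW.
  have lM : size l <= M by apply: leq_trans nM.
  exists (60 * size l + ((size l * 5 + 4) + (size l * 5 + 4 + 3))).
  apply: wp_seq; apply: wp_weaken; first apply: wp_frame; first apply: (wp_pivot l0') => //.
    by [].
  rewrite I2 => m2 [[P1 P2] [Hi2 Hr2]]; set p := rcell m2 9 0 in P1 P2 *.
  apply: wp_seq; apply: wp_weaken; first apply: wp_frame;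
    first apply: (wp_tally lW M0) => //.
  + by rewrite Hi2.
  + by [].
  rewrite (Hr2 4 isT) I2 -/p => m3 [[T1 T2] [Hi3 Hr3]].
  have sz := count_tri l p; have ge3 := count_ge_tri l p.
  have r8 : rcell m3 8 = rcell m1 8 by rewrite Hr3 // Hr2.
  have r9 : rcell m3 9 0 = p by rewrite Hr3.
  have X3 : rcell m3 4 = rcell m1 4 by rewrite Hr3 // Hr2.
  have e10 : icell m3 10 0 = size l by rewrite Hi3 // Hi2.
  have e18 : icell m3 18 0 = 0 by rewrite Hi3 // Hi2 //; apply/eqP.
  apply: (@wp_weaken _ _ _ _ _ _ _ _ (size l * 5 + 4 + 1).+2); last 2 first.
  + by lia.
  + by move=> m'; apply.
  apply: wp_if; rewrite /= T1 r8 -ltNge.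
  rewrite count_le_tri in P1; rewrite ge3 in P2.
  have keepP (P : pred R) cond m4 : icell m4 10 0 = size l -> rcell m4 4 = rcell m1 4 ->
      icell m4 18 0 = 0 ->
      (forall m', rcell m' 9 = rcell m4 9 ->
        beval (E m') cond = P (rcell m' 4 (icell m' 17 0))) ->
      wp (keep_cmd cond) m4 (size l * 5 + 4) (fun m' => [/\
        icell m' 10 0 = size (seq.filter P l), seg (rcell m' 4) 0 (size (seq.filter P l)) = seq.filter P l,
        rcell m' 8 = rcell m4 8 & icell m' 18 0 = 0]).
    move=> e4 X4 f4 condE.
    apply: wp_weaken; first apply: wp_frame; first apply: (wp_keep lW lM M0 e4 condE) => //.
      by [].
    rewrite X4 I2 => m5 [[K1 K2] [Hi5 Hr5]]; split=> //; first by rewrite Hr5.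
    by rewrite Hi5.
  have [sG|Gs] := ltP (rcell m1 8 0) (count (fun y => p < y)%R l)%:R%R.
    apply: wp_weaken; first apply: (keepP (fun y => p < y)%R) => //.
    + by move=> m' e9; rewrite /= e9 r9 -ltNge.
    + by lia.
    move=> m4 [K1 K2 K3 K4]; rewrite K4 eqxx K1 I1; split; last first.
      rewrite size_filter; move: sz P1; do 3 move: (count _ _).
      move=> a b c; move: l0'; move: (size l) => sl; clear; lia.
    exists [seq y <- l | (p < y)%R]; rewrite K3 r8; split=> //.
    (* A candidate is left because more than [s >= 0] elements exceed the pivot. *)
    + rewrite size_filter (leq_trans (count_size _ _)) // andbT -(ltr_nat R).
      by apply: le_lt_trans sG; case/andP: s1.
    + by case/andP: s1 => -> _ /=; rewrite size_filter ltW.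
    + by move=> lam h; apply: I3; exact: threshold_gt h.
  rewrite /=; apply: wp_if; rewrite /= T1 T2 r8 -ge3.
  have [sE|Es] := leP (rcell m1 8 0) (count (fun y => p <= y)%R l)%:R%R.
    apply: (wp_weaken (k := 2)); last first.
    + by move=> m'; apply.
    + by lia.
    apply: wp_lf => /=; do 2 split=> //; first by lia.
    split; last by rewrite /store /= I1; lia.
    rewrite /store /= r9; apply: I3.
    by rewrite /threshold Gs sE.
  apply: (@wp_weaken _ _ _ _ _ _ _ _ (1 + (size l * 5 + 4))); last 2 first.
  + by lia.
  + by move=> m'; apply.
  apply: wp_seq; apply: wp_lf => /=; split=> //.
  rewrite T1 T2 r8 -ge3.
  apply: wp_weaken; first apply: (keepP (fun y => y < p)%R) => //.
  + by move=> m'; rewrite /= /store /= => e9; rewrite e9 r9 -ltNge.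
  + by [].
  move=> m4 [K1 K2 K3 K4]; rewrite K4 eqxx K1 I1; split; last first.
    rewrite size_filter; move: sz P2; do 3 move: (count _ _).
    move=> a b c; move: l0'; move: (size l) => sl; clear; lia.
  have ltE : ((count (fun y => y < p)%R l)%:R =
      (size l)%:R - (count (fun y => p <= y)%R l)%:R :> R)%R.
    by rewrite sz -ge3 natrD addrAC subrr add0r.
  exists [seq y <- l | (y < p)%R]; rewrite K3 /= /store /=; split=> //.
  + rewrite size_filter (leq_trans (count_size _ _)) // andbT -(ltr_nat R) ltE subr_gt0.
    by apply: lt_le_trans Es _; case/andP: s1.
  + rewrite size_filter ltE subr_ge0 (ltW Es) lerD2r.
    by case/andP: s1.
  + by move=> lam h; apply: I3; exact: threshold_lt h.
- exists l0; rewrite /= size_seg; split=> //.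
  by rewrite n0 leqnn.
- by rewrite /phi /= /store /= en.
- move=> m' [+ /=]; rewrite /I leqn0 => + h; by rewrite h.
Qed.

End Pivot.

(** * Optimal scenarios of cardinality-constrained sets and factor models *)

Section Threshold.
Local Open Scope ring_scope.
Variable R : realType.

Lemma natr_count (T : Type) (P : pred T) (l : seq T) :
  (count P l)%:R = \sum_(i <- l) (P i)%:R :> R.
Proof. by elim: l => [|x l IH]; rewrite ?big_nil // big_cons -IH natrD. Qed.

(** A primal solution from a threshold: weight [1] above, [0] below, and a common weight [th] on the
    ties that makes the total [s]. Without ties the hypothesis forces [s = G], and [th] is zero by
    the convention on division. *)
Lemma threshold_weights (I : finType) (A : {set I}) (a : I -> R) (s lam : R) :
  \sum_(i in A) (lam < a i)%R%:R <= s <= \sum_(i in A) (lam <= a i)%R%:R ->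
  exists eta : I -> R,
    [/\ forall i, 0 <= eta i <= 1, \sum_(i in A) eta i = s,
        forall i, lam < a i -> eta i = 1 & forall i, a i < lam -> eta i = 0].
Proof.
move=> /andP[h1 h2].
set G := \sum_(i in A) (lam < a i)%R%:R in h1.
pose Eq : R := \sum_(i in A) (a i == lam)%:R.
have sE : \sum_(i in A) (lam <= a i)%R%:R = G + Eq.
  rewrite -big_split /=; apply: eq_bigr => i _.
  by case: (ltgtP lam (a i)) => _; rewrite ?addr0 ?add0r.
have E0 : 0 <= Eq by apply: sumr_ge0 => i _; rewrite ler0n.
rewrite sE in h2.
pose th := (s - G) / Eq.
have th01 : 0 <= th <= 1.
  have [z|nz] := eqVneq Eq 0; first by rewrite /th z invr0 mulr0 lexx ler01.
  have Ep : 0 < Eq by rewrite lt_def nz.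
  by rewrite /th divr_ge0 ?subr_ge0 //= ler_pdivrMr // mul1r lerBlDl.
have thE : th * Eq = s - G.
  have [z|nz] := eqVneq Eq 0; last by rewrite divfK.
  by rewrite z mulr0; move: h2; rewrite z addr0 => h2; apply/esym/eqP; rewrite subr_eq0 eq_le h1 h2.
exists (fun i => if lam < a i then 1 else if a i == lam then th else 0); split.
- by move=> i; case: ifP => _; [rewrite ler01 lexx|case: ifP => // _; rewrite lexx ler01].
- rewrite -[RHS](subrK G) -thE mulr_sumr addrC -big_split /=; apply: eq_bigr => i _.
  by case: (ltgtP lam (a i)) => _; rewrite ?mulr1 ?mulr0 ?addr0 ?add0r.
- by move=> i ->.
- by move=> i h; rewrite ltNge (ltW h) /= lt_eqF.
Qed.

(** Complementary slackness, with [lam] the multiplier of the cardinality constraint: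
    [sum d xi = sum (d - lam) xi + lam sum xi] for every competitor, and [eta] maximizes both
    terms. *)
Lemma cardinality_certificate (x : cardinality R) (S : {set 'I_(G_n x)})
    (eta : 'I_(G_n x) -> R) (lam : R) :
  (forall i, i \in S -> 0 <= eta i <= 1) -> \sum_(i in S) eta i <= G_Gamma x -> 0 <= lam ->
  (forall i, i \in S -> lam < G_dev x i 0 -> eta i = 1) ->
  (forall i, i \in S -> G_dev x i 0 < lam -> eta i = 0) ->
  lam * (G_Gamma x - \sum_(i in S) eta i) = 0 ->
  is_worst_case_load (cardinality_set (x := x)) S
    (\sum_(i in S) G_q0 x i 0 + \sum_(i in S) G_dev x i 0 * eta i).
Proof.
move=> e01 eG lam0 e1 e0 comp; split.
  pose xi : 'cV[R]_(G_n x) := \col_i if i \in S then eta i else 0.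
  exists (\col_i (G_q0 x i 0 + G_dev x i 0 * xi i 0)); last first.
    by rewrite -big_split /=; apply: eq_bigr => i iS; rewrite !mxE iS.
  have xi01 i : 0 <= xi i 0 <= 1.
    by rewrite mxE; case: ifP => [/e01//|_]; rewrite lexx ler01.
  split.
    move=> i; rewrite mxE; have /andP[x0 x1] := xi01 i.
    by rewrite lerDl mulr_ge0 ?G_dev_ge0 //= lerD2l ler_piMr ?G_dev_ge0.
  exists xi; split=> //; last by move=> i; rewrite mxE.
  apply: le_trans eG; rewrite [leRHS]big_mkcond.
  by apply: ler_sum => i _; rewrite mxE.
move=> q [_ [xi [xi01 xiG qE]]].
under eq_bigr do rewrite qE.
rewrite big_split /= lerD2l.
have : \sum_(i in S) (G_dev x i 0 - lam) * xi i 0 <= \sum_(i in S) (G_dev x i 0 - lam) * eta i.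
  apply: ler_sum => i iS; have /andP[x0 x1] := xi01 i.
  case: (ltgtP lam (G_dev x i 0)) => h.
  - by rewrite e1 // ler_wpM2l // subr_ge0 ltW.
  - by rewrite e0 // mulr0 mulr_le0_ge0 // subr_le0 ltW.
  - by rewrite h subrr !mul0r.
have : lam * \sum_(i in S) xi i 0 <= lam * \sum_(i in S) eta i.
  have -> : lam * \sum_(i in S) eta i = lam * G_Gamma x.
    by apply/esym/eqP; rewrite -subr_eq0 -mulrBr comp.
  apply: ler_wpM2l => //; apply: le_trans xiG.
  rewrite big_mkcond; apply: ler_sum => i _; case: ifP => // _.
  by case/andP: (xi01 i).
rewrite !mulr_sumr => h1 h2; have := lerD h2 h1; rewrite -!big_split /=.
by under eq_bigr do rewrite -mulrDl subrK; under [leRHS]eq_bigr do rewrite -mulrDl subrK.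
Qed.

(** The value is the dual objective [Gamma lam + sum max(0, d - lam)], which can be computed from
    [lam] without the weights. The first case is a slack constraint, with multiplier [0]. *)
Lemma cardinality_threshold (x : cardinality R) (S : {set 'I_(G_n x)}) (lam : R) :
  (lam = 0 /\ #|S|%:R <= G_Gamma x) \/
  [/\ G_Gamma x < #|S|%:R, \sum_(i in S) (lam < G_dev x i 0)%R%:R <= G_Gamma x
    & G_Gamma x <= \sum_(i in S) (lam <= G_dev x i 0)%R%:R] ->
  is_worst_case_load (cardinality_set (x := x)) S
    (\sum_(i in S) G_q0 x i 0 + G_Gamma x * lam +
     \sum_(i in S) if G_dev x i 0 <= lam then 0 else G_dev x i 0 - lam).
Proof.
case=> [[-> SG]|[SG h1 h2]].
  have -> : \sum_(i in S) (if G_dev x i 0 <= 0 then 0 else G_dev x i 0 - 0) =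
      \sum_(i in S) G_dev x i 0 * 1.
    apply: eq_bigr => i _; have := G_dev_ge0 i; rewrite mulr1 subr0 => d0.
    by case: leP => // d1; apply/esym/eqP; rewrite eq_le d0 d1.
  rewrite mulr0 addr0; apply: (@cardinality_certificate x S (fun => 1) 0) => //.
  - by rewrite ler01 lexx.
  - by rewrite sumr_const.
  - by move=> i _; rewrite ltNge G_dev_ge0.
  - by rewrite mul0r.
(* A negative [lam] lies below all deviations, so that the first count would be [#|S|], more than
   [G_Gamma x]. *)
have lam0 : 0 <= lam.
  rewrite leNgt; apply/negP => lam_lt0; move: SG; rewrite ltNge => /negP; apply.
  apply: le_trans h1; rewrite -sumr_const; apply: ler_sum => i _.
  by rewrite (lt_le_trans lam_lt0) // G_dev_ge0.
have [eta [e01 eS e1 e0]] : exists eta : 'I_(G_n x) -> R,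
    [/\ forall i, 0 <= eta i <= 1, \sum_(i in S) eta i = G_Gamma x,
        forall i, lam < G_dev x i 0 -> eta i = 1 & forall i, G_dev x i 0 < lam -> eta i = 0].
  by apply: threshold_weights; rewrite h1 h2.
have := @cardinality_certificate x S eta lam.
rewrite eS subrr mulr0 => /(_ (fun i _ => e01 i) (lexx _) lam0 (fun i _ => e1 i) (fun i _ => e0 i) erefl).
congr (is_worst_case_load _ _ _); rewrite -addrA; congr (_ + _).
rewrite -eS mulr_suml -big_split /=; apply: eq_bigr => i _.
case: (ltgtP (G_dev x i 0) lam) => h.
- by rewrite e0 // mulr0 mul0r addr0.
- by rewrite e1 // mulr1 mul1r addrC subrK.
- by rewrite h addr0 mulrC.
Qed.

(** Substituting [eta = (xi + 1) / 2] leaves [0 <= eta <= 1] with a total [s] between two bounds,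
    since [sum xi = 2 s - F]. The multiplier [lam] of this total is [<= 0] at the lower bound,
    [>= 0] at the upper one and [0] otherwise; the value is the dual objective, with [|c f - lam|]
    in place of a positive part. *)
Lemma factor_threshold (x : Defs.factor R) (S : {set 'I_(F_n x)}) (s lam : R) :
  let c f := \sum_(i in S) F_Psi x i f in
  let F := (F_F x)%:R in
  \sum_f (lam < c f)%R%:R <= s <= \sum_f (lam <= c f)%R%:R ->
  F * (1 - F_beta x) / 2 <= s <= F * (1 + F_beta x) / 2 ->
  [\/ lam = 0, lam <= 0 /\ s = F * (1 - F_beta x) / 2
    | 0 <= lam /\ s = F * (1 + F_beta x) / 2] ->
  is_worst_case_load (factor_set (x := x)) S
    (\sum_(i in S) F_q0 x i 0 + lam * (2 * s - F) + \sum_f `|c f - lam|).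
Proof.
move=> c F h /andP[sa sb] hlam.
have load (xi : 'cV[R]_(F_F x)) : \sum_(i in S) (F_q0 x + F_Psi x *m xi) i 0 =
    \sum_(i in S) F_q0 x i 0 + (lam * \sum_f xi f 0 + \sum_f (c f - lam) * xi f 0).
  under eq_bigr do rewrite !mxE; rewrite big_split /=; congr (_ + _).
  rewrite exchange_big /= mulr_sumr -big_split /=; apply: eq_bigr => f _.
  by rewrite -mulr_suml -/(c f) -mulrDl addrC subrK.
split.
  have setTE (u : 'I_(F_F x) -> R) : \sum_(i in [set: 'I_(F_F x)]%SET) u i = \sum_i u i.
    by apply: eq_bigl => i; rewrite inE.
  have [eta [e01 eS e1 e0]] : exists eta : 'I_(F_F x) -> R,
    [/\ forall i, 0 <= eta i <= 1, \sum_(i in [set: 'I_(F_F x)]%SET) eta i = s,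
        forall i, lam < c i -> eta i = 1 & forall i, c i < lam -> eta i = 0].
    by apply: threshold_weights; rewrite !setTE.
  rewrite setTE in eS.
  pose xi : 'cV[R]_(F_F x) := \col_f (2 * eta f - 1).
  have xiS : \sum_f xi f 0 = 2 * s - F.
    under eq_bigr do rewrite mxE.
    by rewrite sumrB -mulr_sumr eS sumr_const card_ord.
  exists (F_q0 x + F_Psi x *m xi).
    exists xi; split=> //.
      by move=> f; rewrite mxE; have := e01 f; lra.
    rewrite xiS ler_norml; apply/andP; split; lra.
  rewrite load xiS -addrA; congr (_ + (_ + _)); apply: eq_bigr => f _; rewrite mxE.
  case: (ltgtP lam (c f)) => hf.
  - by rewrite e1 // ger0_norm ?subr_ge0 ?(ltW hf) //; ring.
  - by rewrite e0 // ler0_norm ?subr_le0 ?(ltW hf) //; ring.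
  - by rewrite hf subrr mul0r normr0.
move=> _ [xi [xi1 xiS ->]]; rewrite load -addrA lerD2l; apply: lerD.
  have /andP[l1 l2] : - (F_beta x * F) <= \sum_f xi f 0 <= F_beta x * F by rewrite -ler_norml.
  case: hlam => [->|[l0 ->]|[l0 ->]]; first by rewrite !mul0r.
    by apply: ler_wnM2l => //; lra.
  by apply: ler_wpM2l => //; lra.
apply: ler_sum => f _; apply: le_trans (ler_norm _) _; rewrite normrM ler_piMr //.
by rewrite ler_norml xi1.
Qed.

End Threshold.

(** * Cardinality-constrained sets from scratch *)

Section CardinalityScratch.
Variable R : realType.
Implicit Types x : cardinality R.

Lemma sum_uniq_set (I : finType) (S : {set I}) (l : seq I) (f : I -> R) :
  uniq l -> l =i S -> (\sum_(i <- l) f i = \sum_(i in S) f i)%R.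
Proof. by move=> ul lS; rewrite big_uniq //; apply: eq_bigl. Qed.

Lemma seg_rcons (f : nat -> R) (s : seq R) v g :
  seg f 0 (size s) = s -> (forall p, p < size s -> g p = f p) -> g (size s) = v ->
  seg g 0 (size s).+1 = rcons s v.
Proof.
move=> fs gf gv; rewrite segS gv -[in RHS]fs; congr rcons.
by apply: eq_seg => i /andP[_]; apply: gf.
Qed.

Definition gamma : rexp := RGet Inst 2 (ILit 0).

(** Deviations are written twice: selection destroys array [4], while the final pass reads them from
    array [2]. *)
Definition collect_cmd (e : iexp) : cmd :=
  Seq (setr0 1 (RAdd (wr 1) (RGet Inst 0 e)))
 (Seq (SetR 2 (wi 1) (RGet Inst 1 e))
 (Seq (SetR 4 (wi 1) (RGet Inst 1 e))
      (seti0 1 (IAdd (wi 1) (ILit 1))))).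

Definition total_cmd : cmd :=
  let d := RGet Work 2 (wi 2) in
  Seq (setr0 7 (RNat (ILit 0)))
 (Seq (If (BLeR (RNat (wi 1)) gamma) Skip
         (Seq (setr0 8 gamma) (Seq (seti0 10 (wi 1)) select_cmd)))
 (Seq (setr0 0 (RAdd (wr 1) (RMul gamma (wr 7))))
      (For 2 (wi 1) (If (BLeR d (wr 7)) Skip (setr0 0 (RAdd (wr 0) (RSub d (wr 7)))))))).

Definition collect_inv x (S : {set 'I_(G_n x)}) (m : memory R) : Prop :=
  exists l, [/\ uniq l, l =i S, icell m 1 0 = size l,
    forall a, a \in [:: 2; 4] ->
      seg (rcell m a) 0 (size l) = [seq G_dev x i ord0 | i <- l]
  & rcell m 1 0 = (\sum_(i in S) G_q0 x i ord0)%R].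

Lemma wp_collect x table query W M (S : {set 'I_(G_n x)}) (i : 'I_(G_n x)) e m :
  let inst := inst_memory (cardinality_problem x) in
  G_n x <= W -> G_n x <= M -> 0 < M -> collect_inv S m -> i \notin S ->
  evaluates inst table query m e i ->
  wp inst table query W M (collect_cmd e) m 4 (collect_inv (update true i S)).
Proof.
move=> inst nW nM M0 [l [ul lS cl Hl b]] iS ei.
have il : i \notin l by rewrite lS.
have ln : size l < G_n x.
  by have := @uniq_size_ord _ (i :: l); rewrite /= il ul; apply.
apply: wp_lf => /=; rewrite /store /= cl !ei // !nth_vec.
split=> //; split; first by lia.
split; first by lia.
split=> //; first by lia.
exists (rcons l i); split.
- by rewrite rcons_uniq il.
- by move=> j; rewrite mem_rcons !inE lS.
- by rewrite /= /store /= size_rcons addn1.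
- move=> a a24; have Ha := Hl a a24; rewrite map_rcons size_rcons.
  rewrite -(size_map (fun i => G_dev x i ord0)) in Ha *.
  apply: seg_rcons Ha _ _; move: a24; rewrite !inE => /orP[] /eqP -> /=.
  + by move=> p; rewrite size_map /store /= => pl; rewrite ltn_eqF.
  + by move=> p; rewrite size_map /store /= => pl; rewrite ltn_eqF.
  + by rewrite size_map /store /= eqxx.
  + by rewrite size_map /store /= eqxx.
- by rewrite /= /store /= b big_setU1 // addrC.
Qed.

Lemma wp_total x table query W M (S : {set 'I_(G_n x)}) m :
  let inst := inst_memory (cardinality_problem x) in
  G_n x <= W -> G_n x <= M -> 0 < M -> collect_inv S m ->
  wp inst table query W M total_cmd m (1606 * #|S| + 12)
    (fun m' => is_worst_case_load (cardinality_set (x := x)) S (output m')).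
Proof.
move=> inst nW nM M0 [l [ul lS cl Hl b]].
have lc : size l = #|S| by rewrite -(card_uniqP ul); apply: eq_card.
have ln : size l <= G_n x by exact: uniq_size_ord.
apply: (@wp_weaken _ _ _ _ _ _ _ _
  (1 + ((1 + (1 + (1600 * size l + 3))).+1 + (1 + (size l * (2 + 2) + 2))))); last 2 first.
- by rewrite lc; lia.
- by move=> m'; apply.
apply: wp_seq; apply: wp_lf => /=; split=> //; set m1 := setr m 7 0 _.
pose d := [seq G_dev x i ord0 | i <- l].
pose lam_ok (lam : R) := (lam = 0 /\ #|S|%:R <= G_Gamma x)%R \/
  [/\ G_Gamma x < #|S|%:R, \sum_(i in S) (lam < G_dev x i ord0)%R%:R <= G_Gamma x
    & G_Gamma x <= \sum_(i in S) (lam <= G_dev x i ord0)%R%:R]%R.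
apply: wp_seq; apply: (wp_weaken (k := (1 + (1 + (1600 * size l + 3))).+1)
  (Q := fun m2 => [/\ icell m2 1 0 = size l, rcell m2 1 = rcell m 1,
     rcell m2 2 = rcell m 2 & lam_ok (rcell m2 7 0)])); [|by []|].
  apply: wp_if => /=; rewrite cl lc; case: leP => Sg.
    apply: wp_skip; first by lia.
    by split=> //; [rewrite /= cl lc|left].
  apply: (wp_weaken (wp_frame (Q := fun m2 => lam_ok (rcell m2 7 0)) _) (leqnn _)) => //.
    2: by move=> m2 [H [Hi Hr]]; split=> //; rewrite ?Hi ?Hr //= cl.
  have S0 : 0 < #|S|.
    by rewrite -(ltr_nat R); apply: le_lt_trans Sg; case/andP: (G_Gamma_bnd x).
  apply: wp_seq; apply: wp_lf => /=; split=> //.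
  apply: wp_seq; apply: wp_lf => /=; rewrite cl; split=> //; first by lia.
  apply: wp_weaken; first apply: (@wp_select _ _ _ _ _ _ _ (size l)).
  - by rewrite lc.
  - by lia.
  - by lia.
  - by rewrite /= /store.
  - rewrite /= /store /= lc (ltW Sg) andbT; by case/andP: (G_Gamma_bnd x).
  - by rewrite lc.
  move=> m2; rewrite /= /store /= (Hl 4) // /threshold !natr_count !big_map.
  rewrite !(sum_uniq_set _ ul lS) => /andP[h1 h2].
  by right; split.
move=> m2 [I1 I2 I3 I4]; apply: wp_seq; apply: wp_lf => /=; split=> //.
rewrite I2 b; set lam := rcell m2 7 0 in I4 *.
have := cardinality_threshold I4; set v0 := (_ + _ * lam)%R => wc.
pose g y : R := (if y <= lam then 0 else y - lam)%R.
apply: wp_weaken; first apply: (wp_for (n := size l) (k := 2)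
  (I := fun k m' => [/\ icell m' 1 0 = size l, rcell m' 2 = rcell m 2, rcell m' 7 0 = lam
    & output m' = (v0 + \sum_(y <- seg (rcell m 2) 0 k) g y)%R])) => //.
- by lia.
- by move=> k m' [].
- by split=> //; rewrite big_nil addr0.
- move=> k m' kl [J1 J2 J3 J4] ek; apply: wp_lf => /=.
  have seq' : (\sum_(y <- seg (rcell m 2) 0 k.+1) g y =
      \sum_(y <- seg (rcell m 2) 0 k) g y + g (rcell m 2 k))%R.
    by rewrite segS big_rcons /= addrC.
  rewrite ek J2 J3 seq' /g /=; case: (rcell m 2 k <= lam)%R; [move=> _|split=> // _]; split=> //.
  + by rewrite addr0.
  + by rewrite /store /= -[rcell m' 0 0]/(output m') J4 -addrA.
- by [].
move=> m' [_ _ _ ->]; move: wc; congr (is_worst_case_load _ _ (_ + _)).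
by rewrite (Hl 2) // big_map (sum_uniq_set _ ul lS).
Qed.

Lemma cardinality_from_scratch :
  from_scratch (@cardinality_problem R) Skip (fun x k => k).
Proof.
apply: (@from_scratchI _ _ _ _ (Seq (route_for (collect_cmd route_arg)) total_cmd) _ 1612)
  => x ux.
move=> inst W E0.
have EW : W = 1612 * (1 + (G_n x + G_n x + 1)).+1.
  by rewrite /W /bigO /inst_size /= !size_vec; lia.
clearbody W.
apply: wp_skip; first by lia.
move=> s us; have := uniq_size_ord us; rewrite [customers _]/= => sn.
have sc : #|[set i in s]%SET| = size s by rewrite cardsE (card_uniqP us).
apply: (@wp_weaken _ _ _ _ _ _ _ _ ((size s * (4 + 2) + 2) + (1606 * size s + 12)));
  last 2 first.
- by rewrite /bigO; move: (size s) => k; clear; lia.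
- by move=> m'; apply.
apply: wp_seq; apply: (wp_weaken (wp_route (k := 4) (Inv := @collect_inv x) us _ _ _ _ _ _)) => //.
- by lia.
- by lia.
- exists [::]; split=> //; first by move=> i; rewrite !inE.
  by rewrite big_set0.
- by move=> S m i iS IS ei; apply: wp_collect => //; lia.
by move=> m Im; rewrite -sc; apply: wp_total => //; lia.
Qed.

End CardinalityScratch.

(** * Factor models *)

Section Factor.
Variable R : realType.
Implicit Types x : Defs.factor R.

Definition half_range (op : rexp -> rexp -> rexp) : rexp :=
  RDiv (RMul (RNat (inst_int 1)) (op (RNat (ILit 1)) (RGet Inst 2 (ILit 0)))) (RNat (ILit 2)).

(** Selection consumes the rank in [wr 8]; [wr 3] keeps the original value for the final formula. *)
Definition select_rank (s : rexp) : cmd :=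
  Seq (setr0 3 s) (Seq (setr0 8 s) (Seq (seti0 10 (inst_int 1)) select_cmd)).

(** Without the bound on the sum, an optimal [xi] is [1] on the [npos] positive factor loads and
    [-1] elsewhere. If [npos] is admissible, the multiplier is [0]; otherwise the violated bound
    becomes the rank for the selection. *)
Definition factor_update (b : bool) (e : iexp) : cmd :=
  let c := RGet Work 2 (wi 1) in
  let npos := RNat (wi 2) in
  Seq (setr0 1 (rupd b (wr 1) (RGet Inst 0 e)))
 (Seq (For 1 (inst_int 1)
        (Seq (SetR 2 (wi 1) (rupd b c (RGet Inst 1 (IAdd (IMul e (inst_int 1)) (wi 1)))))
             (SetR 4 (wi 1) c)))
 (Seq (seti0 2 (ILit 0))
 (Seq (For 1 (inst_int 1)
        (If (BLeR c (RNat (ILit 0))) Skip (seti0 2 (IAdd (wi 2) (ILit 1)))))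
 (Seq (setr0 7 (RNat (ILit 0)))
 (Seq (setr0 3 npos)
 (Seq (If (BLeR (half_range RSub) npos)
         (If (BLeR npos (half_range RAdd)) Skip (select_rank (half_range RAdd)))
         (select_rank (half_range RSub)))
 (Seq (setr0 0 (RAdd (wr 1)
        (RMul (wr 7) (RSub (RMul (RNat (ILit 2)) (wr 3)) (RNat (inst_int 1))))))
      (For 1 (inst_int 1)
        (If (BLeR c (wr 7)) (setr0 0 (RAdd (wr 0) (RSub (wr 7) c)))
                            (setr0 0 (RAdd (wr 0) (RSub c (wr 7))))))))))))).

Definition factor_load x (S : {set 'I_(F_n x)}) (f : 'I_(F_F x)) : R :=
  (\sum_(i in S) F_Psi x i f)%R.

Definition factor_inv x (S : {set 'I_(F_n x)}) (m : memory R) : Prop :=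
  [/\ rcell m 1 0 = (\sum_(i in S) F_q0 x i ord0)%R,
      forall f : 'I_(F_F x), rcell m 2 f = factor_load S f
    & is_worst_case_load (factor_set (x := x)) S (output m)].

Lemma sum_seg_ord n (g : nat -> R) (h : R -> R) :
  (\sum_(y <- seg g 0 n) h y = \sum_(f < n) h (g f))%R.
Proof. by rewrite /seg big_map -(big_mkord predT (fun i => h (g i))) /index_iota subn0. Qed.

Lemma wp_factor_update x table query W M
    (S : {set 'I_(F_n x)}) (i : 'I_(F_n x)) b e m :
  let inst := inst_memory (factor_problem x) in
  F_F x <= W -> F_F x <= M -> factor_inv S m -> (i \in S) = ~~ b ->
  evaluates inst table query m e i ->
  wp inst table query W M (factor_update b e) m (1613 * F_F x + 22)
    (factor_inv (update b i S)).
Proof.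
move=> inst FW FM [I1 I2 _] iS ei.
have F0 := F_F_gt0 x; have M0 : 0 < M by lia.
set F := F_F x in FW FM F0 *.
apply: (@wp_weaken _ _ _ _ _ _ _ _ (1 + ((F * (2 + 2) + 2) + (1 + ((F * (2 + 2) + 2) +
  (1 + (1 + ((1 + (1 + (1 + (1600 * F + 3)))).+2 + (1 + (F * (2 + 2) + 2))))))))));
  last 2 first.
- by lia.
- by move=> m'; apply.
set S' := update b i S; pose c f : R := factor_load S' f.
apply: wp_seq; apply: wp_lf => /=; split=> //.
rewrite reval_rupd /= ei // nth_vec I1 -sum_update // -/S'.
set base := (\sum_(i in S') _)%R.
pose J1 k (m' : memory R) := [/\ icell m' 0 = icell m 0, rcell m' 1 0 = base,
   forall f : 'I_F, rcell m' 2 f = if f < k then c f else factor_load S f &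
   forall f : 'I_F, f < k -> rcell m' 4 f = c f].
apply: wp_seq; apply: wp_weaken; first apply: (wp_for (n := F) (k := 2) (I := J1)) => //.
- move=> k m' kF [K1 K2 K3 K4] ek; apply: wp_lf => /=; rewrite ek.
  do 2 (split; first by lia).
  rewrite reval_rupd /= ei // ek (K3 (Ordinal kF)) ltnn.
  rewrite (nth_allpairs_ord _ (fun i j => F_Psi x i j) i (Ordinal kF)).
  have -> : (factor_load S (Ordinal kF) + sgn R b * F_Psi x i (Ordinal kF))%R = c (Ordinal kF).
    by rewrite /c /factor_load sum_update.
  move=> _; split=> //= f; rewrite /store /= ltnS leq_eqVlt ?eqxx.
    by case: eqP => [fk|_ //]; rewrite (_ : f = Ordinal kF) //; apply: val_inj.
  case: eqP => [fk _|_ /K4 //]; rewrite (_ : f = Ordinal kF) //; exact: val_inj.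
- by [].
move=> m1 [_ K2 K3 K4].
have {}K3 (f : 'I_F) : rcell m1 2 f = c f by rewrite K3 ltn_ord.
have {}K4 (f : 'I_F) : rcell m1 4 f = c f by rewrite K4 ?ltn_ord.
apply: wp_seq; apply: wp_lf => /=; split=> //.
pose npos k := \sum_(f < F | f < k) (0 < c f)%R.
have nposS k (kF : k < F) : npos k.+1 = npos k + (0 < c (Ordinal kF))%R.
  rewrite /npos (bigD1 (Ordinal kF)) //= addnC; congr (_ + _); apply: eq_bigl => f.
  by rewrite -val_eqE /= ltnS andbC -ltn_neqAle.
have npos_le k : k <= F -> npos k <= k.
  elim: k => [|k IH] kF; first by rewrite /npos big_pred0.
  by rewrite (nposS _ kF); have := IH (ltnW kF); case: (0 < _)%R; lia.
apply: wp_seq; apply: wp_weaken; first apply: wp_frame; first apply: (wp_for (n := F) (k := 2)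
  (I := fun k m' => rcell m' = rcell m1 /\ icell m' 2 0 = npos k)) => //.
- by split=> //; rewrite /npos big_pred0.
- move=> k m' kF [L1 L2] ek; apply: wp_lf => /=.
  rewrite ek L1 (K3 (Ordinal kF)) leNgt nposS L2.
  have := npos_le k (ltnW kF).
  case: ltP => _ /= h; first by split=> //; lia.
  by rewrite addn0.
- by [].
move=> m2 [[L1 L2] _].
apply: wp_seq; apply: wp_lf => /=; split=> //.
apply: wp_seq; apply: wp_lf => /=; rewrite /store /= L2; split=> //.
set m3 := setr (setr m2 7 0 0) 3 0 _.
pose beta := F_beta x.
have b01 : (0 <= beta <= 1)%R := F_beta01 x.
have F0R : (0 < F%:R :> R)%R by rewrite ltr0n.
pose lo : R := (F%:R * (1 - beta) / 2)%R; pose hi : R := (F%:R * (1 + beta) / 2)%R.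
have lo0 : (0 <= lo)%R by rewrite /lo; nra.
have hiF : (hi <= F%:R)%R by rewrite /hi; nra.
have lohi : (lo <= hi)%R by rewrite /lo /hi; nra.
have P_R : ((npos F)%:R = \sum_f (0 < c f)%R%:R :> R)%R.
  by rewrite natr_sum; apply: eq_bigl => f; rewrite ltn_ord.
pose ok (m4 : memory R) := let s := rcell m4 3 0 in let lam := rcell m4 7 0 in
  [/\ \sum_f (lam < c f)%R%:R <= s <= \sum_f (lam <= c f)%R%:R, lo <= s <= hi
    & [\/ lam = 0, lam <= 0 /\ s = lo | 0 <= lam /\ s = hi]]%R.
have selectP (s : R) e' m4 : (0 <= s <= F%:R)%R -> rcell m4 4 = rcell m1 4 ->
    (forall m', reval (environment inst table query m') e' = s) ->
    wp inst table query W M (select_rank e') m4 (1 + (1 + (1 + (1600 * F + 3))))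
      (fun m5 => [/\ rcell m5 3 0 = s, rcell m5 1 = rcell m4 1, rcell m5 2 = rcell m4 2 &
         \sum_f (rcell m5 7 0 < c f)%R%:R <= s <= \sum_f (rcell m5 7 0 <= c f)%R%:R]%R).
  move=> s0F X4 es.
  apply: wp_seq; apply: wp_lf => /=; split=> //.
  apply: wp_seq; apply: wp_lf => /=; split=> //.
  apply: wp_seq; apply: wp_lf => /=; split=> //.
  apply: wp_weaken; first apply: wp_frame; first apply: (@wp_select _ _ _ _ _ _ _ F) => //.
  - by rewrite /= /store /= es.
  - by [].
  move=> m5 [h [_ Hr]]; split; rewrite ?(Hr 1%N isT) ?(Hr 2%N isT) ?(Hr 3%N isT) //= /store /= ?es //.
  move: h; rewrite /threshold /= /store /= X4 es !natr_count !sum_seg_ord.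
  have K4' (P : R -> R) : (\sum_(f < F) P (rcell m1 4 f) = \sum_f P (c f))%R.
    by apply: eq_bigr => f _; rewrite K4.
  by rewrite (K4' (fun y => (rcell m5 7 0 < y)%R%:R%R)) (K4' (fun y => (rcell m5 7 0 <= y)%R%:R%R)).
have hi0 : (0 <= hi)%R by apply: le_trans lohi.
have loF : (lo <= F%:R)%R by apply: le_trans hiF.
have selP e' s m4 : (forall m', reval (environment inst table query m') e' = s) ->
    (s = lo /\ (npos F)%:R < lo \/ s = hi /\ hi < (npos F)%:R)%R -> rcell m4 = rcell m3 ->
    wp inst table query W M (select_rank e') m4 (1 + (1 + (1 + (1600 * F + 3))))
      (fun m5 => [/\ rcell m5 1 = rcell m1 1, rcell m5 2 = rcell m1 2 & ok m5]).
  move=> es slh e4.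
  have s0F : (0 <= s <= F%:R)%R by case: slh => -[-> _]; rewrite ?lo0 ?hi0.
  apply: wp_weaken; first apply: (selectP s e' m4 s0F _ es) => //.
  - by rewrite e4 /= /store /= L1.
  - by [].
  move=> m5 [h1 h2 h3 h4]; split.
  - by rewrite h2 e4 /= /store /= L1.
  - by rewrite h3 e4 /= /store /= L1.
  rewrite /ok h1; split=> //; first by case: slh => -[-> _]; rewrite lexx ?lohi.
  (* Sign of the multiplier: [lam > 0] at [s = lo] would give [lo <= #{c >= lam} <= npos < lo], and
     symmetrically at [hi]. *)
  case: slh => -[sE Ps]; [apply: Or32|apply: Or33]; split=> //.
    rewrite leNgt; apply/negP => l0; have := Ps; rewrite ltNge => /negP; apply.
    case/andP: h4 => _; rewrite sE => /le_trans; apply; rewrite P_R.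
    apply: ler_sum => f _; rewrite ler_nat; case: (leP _ (c f)) => //= l1.
    by rewrite (lt_le_trans l0 l1).
  rewrite leNgt; apply/negP => l0; have := Ps; rewrite ltNge => /negP; apply.
  case/andP: h4 => + _; rewrite sE; apply: le_trans; rewrite P_R.
  apply: ler_sum => f _; rewrite ler_nat; case: (ltP 0%R (c f)) => //= l1.
  by rewrite (lt_trans l0 l1).
apply: wp_seq; apply: (wp_weaken (k := (1 + (1 + (1 + (1600 * F + 3)))).+2)
  (Q := fun m5 => [/\ rcell m5 1 = rcell m1 1, rcell m5 2 = rcell m1 2 & ok m5])); [|by []|].
  have evlo m' : reval (environment inst table query m') (half_range RSub) = lo by [].
  have evhi m' : reval (environment inst table query m') (half_range RAdd) = hi by [].
  apply: wp_if.
  have -> : beval (environment inst table query m3) (BLeR (half_range RSub) (RNat (wi 2))) =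
    (lo <= (npos F)%:R)%R by rewrite /= L2.
  case: leP => Plo; last first.
    apply: wp_weaken; first apply: (selP _ lo) => //; first by left.
    - by [].
    - by [].
  apply: wp_if.
  have -> : beval (environment inst table query m3) (BLeR (RNat (wi 2)) (half_range RAdd)) =
    ((npos F)%:R <= hi)%R by rewrite /= L2.
  case: leP => Phi; last first.
    by apply: (selP _ hi) => //; right.
  apply: wp_skip; first by [].
  split; rewrite /= /store /= ?L1 //.
  rewrite /ok /= /store /=; split; [|by rewrite Plo Phi|exact: Or31].
  rewrite P_R lexx /=; apply: ler_sum => f _; rewrite ler_nat.
  by case: (ltP 0%R (c f)) => // /ltW ->.
move=> m5 [B1 B2 [t1 t2 t3]]; apply: wp_seq; apply: wp_lf => /=; split=> //.
set v0 := (_ + _ * _)%R.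
have B2' (f : 'I_F) : rcell m5 2 f = c f by rewrite B2 K3.
apply: wp_weaken; first apply: wp_frame; first apply: (wp_for (n := F) (k := 2)
  (I := fun k m' => [/\ rcell m' 2 = rcell m5 2, rcell m' 7 = rcell m5 7
    & output m' = (v0 + \sum_(f < F | (f < k)%N) `|c f - rcell m5 7 0|)%R])) => //.
- by split=> //; rewrite sum_lt_ord0 addr0.
- move=> k m' kF [C1 C2 C3] ek; apply: wp_lf => /=.
  rewrite /output /= in C3; rewrite ek C1 C2 (B2' (Ordinal kF)) C3.
  case: leP => h; split=> // _; split=> //; rewrite /output /= /store /= sum_lt_ord -addrA.
    by rewrite ler0_norm ?subr_le0 // opprB.
  by rewrite ger0_norm // subr_ge0 ltW.
- by [].
move=> m6 [[C1 C2 C3] [_ Hr]]; split.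
- by rewrite Hr //= /store /= B1.
- by move=> f; rewrite C1 B2'.
rewrite C3 sum_lt_ord_max /v0 B1 K2.
exact: factor_threshold t1 t2 t3.
Qed.

Lemma factor_inv0 x : factor_inv (x := x) finset.set0 (zero_memory R).
Proof.
split; first by rewrite big_set0.
  by move=> f; rewrite /factor_load big_set0.
have F0 : (0 < (F_F x)%:R :> R)%R by rewrite ltr0n F_F_gt0.
have b01 := F_beta01 x.
split; last by move=> q _; rewrite big_set0.
exists (F_q0 x); last by rewrite big_set0.
exists 0%R; split=> [k||].
- by rewrite mxE; lra.
- rewrite big1 => [|k _]; last by rewrite mxE.
  by rewrite normr0; nra.
- by rewrite mulmx0 addr0.
Qed.

Lemma factor_inst_size x :
  inst_size (factor_problem x) = 2 + (F_n x + F_n x * F_F x + 1).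
Proof. by rewrite /inst_size /= size_vec /flat size_allpairs_ord; lia. Qed.

(** Selection is repeated after every insertion; being linear in [F], it stays within the term
    [|S| F]. *)
Lemma factor_from_scratch :
  from_scratch (@factor_problem R) Skip
    (fun x k => k * F_F x + F_F x * log2 (F_F x)).
Proof.
apply: (@from_scratchI _ _ _ _ (route_for (factor_update true route_arg)) _ 1640) => x ux.
move=> inst W E0.
have EW : W = 1640 * (2 + (F_n x + F_n x * F_F x + 1)).+1.
  by rewrite /W /bigO factor_inst_size.
clearbody W; apply: wp_skip; first by lia.
move=> s us; have := uniq_size_ord us; rewrite [customers _]/= => sn.
have F0 := F_F_gt0 x.
apply: (wp_weaken (wp_route (k := 1613 * F_F x + 22) (Inv := @factor_inv x) us _ _ _ _ _ _)) => //.
- by lia.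
- by lia.
- exact: factor_inv0.
- move=> S m i iS IS ei; have n0 := ltn_ord i; apply: wp_factor_update => //.
  + by nia.
  + by nia.
  + exact: negbTE.
- rewrite /bigO; set L := F_F x * log2 (F_F x).
  have : size s <= size s * F_F x by rewrite leq_pmulr.
  move: (size s) (F_F x) L => a f L; clear; lia.
- by move=> m [].
Qed.

Lemma factor_incremental :
  incremental (@factor_problem R) true
    (fun x k => F_F x * log2 (F_F x)) (fun x => F_F x).
Proof.
apply: (@incrementalI R _ (@factor_problem R) _ _ _ Skip
  (fun b => factor_update b customer_arg) 1640 (@factor_inv)) => x ux inst W M E0.
have EW : W = 1640 * (2 + (F_n x + F_n x * F_F x + 1)).+1.
  by rewrite /W /bigO factor_inst_size.
have EM : M = 1640 * (F_F x).+1 by [].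
have F0 := F_F_gt0 x.
clearbody W M; split.
- by apply: wp_skip; [lia|exact: factor_inv0].
- by move=> S m [].
- move=> b S m i _ IS iS ei; have := ltn_ord i; rewrite [customers _]/= => n0.
  apply: wp_weaken; first apply: wp_factor_update IS iS ei => //.
  + by nia.
  + by nia.
  (* For [F = 1] the product [F log F] vanishes and the successor in [bigO] supplies the constant;
     otherwise [log F >= 1]. *)
  + rewrite /bigO /log2; have [F1|F2] := leqP (F_F x) 1.
      have -> : F_F x = 1 by lia.
      by [].
    have : 0 < trunc_log 2 (F_F x) by rewrite trunc_log_gt0.
    move: (trunc_log _ _) => L L0.
    have : F_F x <= F_F x * L by rewrite leq_pmulr.
    lia.
  + by [].
Qed.

End Factor.

(** * A pair of tournament trees *)

Section Tournament.
Variable R : realType.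
Variables (inst table query : memory R) (W M : nat).
Local Notation E := (environment inst table query).
Local Notation wp := (wp inst table query W M).
Implicit Types (m : memory R) (b : bool).

(* Every slot [v > 0] of an implicit binary tree has a flag. For each mode [b],
   node [v] holds the best slot with flag [code b] in the subtree of [v], and
   its value: the least value for [true], the greatest for [false]. Slot [0]
   stands for no slot.
   Integer arrays: [1] number of slots in use, [2] integral part of [Gamma],
   [3] number of flags [code true], [5] current node, [6] customer of a slot,
   [7] flag of a slot, [8] slot of a customer, [9] and [10] best slots, [11] to
   [13] selected slots. Real arrays: [1] nominal load of the route, [2] total
   deviation of the slots with flag [code true], [3] deviation of a slot, [4]
   and [5] values of the best slots. *)
Definition code b : nat := if b then 1 else 2.
Definition best_slot b : nat := if b then 9 else 10.
Definition best_value b : nat := if b then 4 else 5.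
Definition better b (x y : R) : bool := (if b then x <= y else y <= x)%R.
Definition better_exp b (e f : rexp) : bexp := if b then BLeR e f else BLeR f e.

(** A pair with slot [0] never beats a proper slot, whatever its value; ties keep the first
    argument. *)
Definition prefer b (a c : nat * R) : nat * R :=
  if (0 < c.1) && ~~ ((0 < a.1) && better b a.2 c.2) then c else a.

Definition node b m v : nat * R := (icell m (best_slot b) v, rcell m (best_value b) v).
Definition own b m v : nat * R := (if icell m 7 v == code b then v else 0, rcell m 3 v).
Definition local_best b m v : Prop :=
  node b m v = prefer b (prefer b (own b m v) (node b m (2 * v))) (node b m (2 * v).+1).

Definition pull_child b (q : iexp) : cmd :=
  let p := wi 5 in
  let bs := IGet Work (best_slot b) in
  let bv := RGet Work (best_value b) in
  If (BAnd (BLeI (ILit 1) (bs q))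
           (BNot (BAnd (BLeI (ILit 1) (bs p)) (better_exp b (bv p) (bv q)))))
     (Seq (SetI (best_slot b) p (bs q)) (SetR (best_value b) p (bv q))) Skip.

Definition pull b : cmd :=
  let p := wi 5 in
  let flag := IGet Work 7 p in
  Seq (If (BAnd (BLeI flag (ILit (code b))) (BLeI (ILit (code b)) flag))
          (SetI (best_slot b) p p) (SetI (best_slot b) p (ILit 0)))
 (Seq (SetR (best_value b) p (RGet Work 3 p))
 (Seq (pull_child b (IMul (ILit 2) p))
      (pull_child b (IAdd (IMul (ILit 2) p) (ILit 1))))).

Definition fix_path (e : iexp) : cmd :=
  Seq (seti0 5 e)
    (While (BLeI (ILit 1) (wi 5))
       (Seq (pull true) (Seq (pull false) (seti0 5 (IDiv (wi 5) (ILit 2)))))).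

Lemma beval_better env b e f :
  beval env (better_exp b e f) = better b (reval env e) (reval env f).
Proof. by case: b. Qed.

Lemma better_refl b x : better b x x.
Proof. by case: b => /=. Qed.

Lemma better_trans b x y z : better b x y -> better b y z -> better b x z.
Proof. by case: b => /= h1 h2; [exact: le_trans h2|exact: le_trans h1]. Qed.

Lemma better_total b x y : ~~ better b x y -> better b y x.
Proof. by case: b; rewrite /= -ltNge => /ltW. Qed.

Lemma prefer_cases b a c : prefer b a c = a \/ prefer b a c = c.
Proof. by rewrite /prefer; case: ifP; [right|left]. Qed.

Lemma prefer_left b a c : 0 < a.1 -> 0 < (prefer b a c).1 /\ better b (prefer b a c).2 a.2.
Proof.
move=> a0; rewrite /prefer a0 /=; case: ifP => [/andP[c0 h]|_]; last by rewrite better_refl.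
by split=> //; exact: better_total.
Qed.

Lemma prefer_right b a c : 0 < c.1 -> 0 < (prefer b a c).1 /\ better b (prefer b a c).2 c.2.
Proof.
move=> c0; rewrite /prefer c0 /=; case: ifP => [_|/negbFE/andP[]//].
by rewrite better_refl.
Qed.

Lemma wp_pull_child b q p v m : icell m 5 0 = p -> p < M -> 0 < p ->
  (forall m', icell m' 5 0 = p -> ieval (E m') q = v) -> v != p ->
  icell m (best_slot b) v <= W ->
  wp (pull_child b q) m 3 (fun m' =>
    node b m' p = prefer b (node b m p) (node b m v) /\
    (forall u, u != p -> node b m' u = node b m u)).
Proof.
move=> e5 pM p0 qv vp vW; apply: wp_lf; rewrite /lf /=.
have s5 x : store (icell m) (best_slot b) p x 5 0 = p by case: (b).
rewrite beval_better e5 /= !(qv m) // e5 !qv //= s5.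
rewrite /prefer [(node b m v).1]/= [(node b m v).2]/= [(node b m p).1]/= [(node b m p).2]/=.
case: (_ && _); last by split.
split=> //; split=> //; rewrite /node /= /store !eqxx /=; split=> // u up.
by rewrite (negbTE up).
Qed.

Lemma wp_pull b p m : icell m 5 0 = p -> p < M -> 0 < p -> p <= W ->
  (forall v, icell m (best_slot b) v <= W) ->
  wp (pull b) m 9 (fun m' =>
    node b m' p = prefer b (prefer b (own b m p) (node b m (2 * p))) (node b m (2 * p).+1) /\
    (forall u, u != p -> node b m' u = node b m u)).
Proof.
move=> e5 pM p0 pW mW.
apply: (@wp_weaken _ _ _ _ _ _ _ _ (2 + (1 + (3 + 3)))); [|by []|by move=> m'; apply].
have [p2 p21] : 2 * p != p /\ (2 * p).+1 != p by lia.
apply: wp_seq.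
pose m1 := seti m (best_slot b) p (own b m p).1.
have s5 : (5 == best_slot b) = false by case: (b).
apply: (wp_weaken (Q := fun m' => m' = m1) (k := 2)); [|by []|move=> _ ->].
  apply: wp_lf => /=; rewrite e5 -eqn_leq /m1 /own /=.
  by case: (_ == _); split.
apply: wp_seq; apply: wp_lf => /=; rewrite /store s5 /= e5; split=> //.
set m2 := setr _ _ _ _.
have n2p : node b m2 p = own b m p by rewrite /node /own /m2 /= /store !eqxx.
have n2u u : u != p -> node b m2 u = node b m u.
  by move=> up; rewrite /node /m2 /= /store !eqxx (negbTE up).
have e52 : icell m2 5 0 = p by rewrite /= /store s5.
apply: wp_seq; apply: wp_weaken; first apply: wp_frame;
  first apply: (wp_pull_child (v := 2 * p) e52 pM p0) => //.
- by move=> m' /= ->.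
- rewrite (congr1 fst (n2u _ p2) : icell m2 (best_slot b) (2 * p) = _).
  exact: mW.
- by [].
move=> m3 [[n3p n3u] [Hi _]].
have e53 : icell m3 5 0 = p by rewrite Hi ?e52 //; case: (b).
apply: wp_weaken; first apply: (wp_pull_child (v := (2 * p).+1) e53 pM p0) => //.
- by move=> m' /= ->; rewrite addn1.
- rewrite (congr1 fst (etrans (n3u _ p21) (n2u _ p21)) :
    icell m3 (best_slot b) (2 * p).+1 = _).
  exact: mW.
- by [].
move=> m4 [n4p n4u]; split; first by rewrite n4p n3p n2p n2u // n3u // n2u.
by move=> u up; rewrite n4u // n3u // n2u.
Qed.

(** Children of a node may lie beyond [M]. They are read but never written, so they hold slot [0]
    and act as empty subtrees. *)
Definition bounded m : Prop :=
  forall b v, icell m (best_slot b) v <= W /\ (M <= v -> icell m (best_slot b) v = 0).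

(* [fix_path] repairs the nodes on the path from its argument [p0] to the root;
   [x] is a further node that may be left in an inconsistent state. *)
Lemma wp_fix_path e p0 x m :
  0 < p0 < M -> p0 <= W -> bounded m -> ieval (E m) e = p0 ->
  (forall b v, 0 < v -> v != p0 -> v != x -> local_best b m v) ->
  wp (fix_path e) m (20 * trunc_log 2 p0 + 24) (fun m' =>
    bounded m' /\ (forall b v, 0 < v -> v != x -> local_best b m' v)).
Proof.
move=> /andP[p00 p0M] p0W bm ep Lm.
have M0 : 0 < M by lia.
apply: (@wp_weaken _ _ _ _ _ _ _ _ (1 + (20 * (trunc_log 2 p0).+1).+1));
  [|by lia|by move=> m'; apply].
apply: wp_seq; apply: wp_lf => /=; rewrite ep; split=> //.
(* Besides [x], only the current node may be inconsistent. Repairing it can disturb no node but its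
   parent, and at index [0] nothing is left to repair. *)
pose I m' := [/\ icell m' 5 0 < M, icell m' 5 0 <= W, bounded m' &
  forall b v, 0 < v -> v != icell m' 5 0 -> v != x -> local_best b m' v].
apply: wp_weaken; first apply: (wp_while (I := I)
  (phi := fun m' => if icell m' 5 0 == 0 then 0 else 20 * (trunc_log 2 (icell m' 5 0)).+1)).
- move=> m1 [I1 I2 I3 I4] /=; set p := icell m1 5 0 in I1 I2 I4 * => p_gt0.
  have [p2 p21] : 2 * p != p /\ (2 * p).+1 != p by lia.
  exists (9 + (9 + 1)).
  apply: wp_seq; apply: wp_weaken; first apply: wp_frame;
    first apply: (wp_pull (b := true) (p := p)) => //.
  + by move=> v; have [] := I3 true v.
  + by [].
  move=> m2 [[n2p n2u] [Hi2 Hr2]].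
  have e52 : icell m2 5 0 = p by rewrite Hi2.
  have nF2 v : node false m2 v = node false m1 v by rewrite /node Hi2 // Hr2.
  have o2 b v : own b m2 v = own b m1 v by rewrite /own Hi2 // Hr2.
  apply: wp_seq; apply: wp_weaken; first apply: wp_frame;
    first apply: (wp_pull (b := false) (p := p)) => //.
  + by move=> v; rewrite Hi2 //; have [] := I3 false v.
  + by [].
  move=> m3 [[n3p n3u] [Hi3 Hr3]].
  have e53 : icell m3 5 0 = p by rewrite Hi3.
  have nT3 v : node true m3 v = node true m2 v by rewrite /node Hi3 // Hr3.
  have o3 b v : own b m3 v = own b m1 v by rewrite -o2 /own Hi3 // Hr3.
  have n3 b v : v != p -> node b m3 v = node b m1 v.
    by case: b => vp; rewrite ?nT3 ?n2u // n3u // nF2.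
  have L3 b : local_best b m3 p.
    rewrite /local_best o3 !(n3 b _ p2, n3 b _ p21); case: b.
      by rewrite nT3 n2p.
    by rewrite n3p o2 !nF2.
  apply: wp_lf => /=; rewrite e53; split=> //.
    by apply: leq_trans I2; exact: leq_div.
  set m4 := seti m3 5 0 _.
  have n4 b v : node b m4 v = node b m3 v by rewrite /node /=; case: b.
  have o4 b v : own b m4 v = own b m3 v by rewrite /own /=.
  split; last first.
    rewrite /store /= (gtn_eqF p_gt0); case: eqP => [_|/eqP h]; first by lia.
    have p1 : 1 < p by rewrite -lt0n divn_gt0 // in h.
    by rewrite (trunc_log2S p1) -divn2; lia.
  rewrite /I /= /store /=; split.
  + by apply: leq_ltn_trans I1; exact: leq_div.
  + by apply: leq_trans I2; exact: leq_div.
  + move=> b v; have en : icell m4 (best_slot b) v = (node b m3 v).1 by rewrite -n4.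
    rewrite en; have [->|vp] := eqVneq v p; last first.
      by rewrite n3 //; exact: I3.
    split; last by rewrite leqNgt I1.
    have oW : (own b m3 p).1 <= W by rewrite o3 /own /=; case: ifP.
    rewrite L3; case: (prefer_cases b (prefer b (own b m3 p) (node b m3 (2 * p))) (node b m3 (2 * p).+1)) => ->.
      case: (prefer_cases b (own b m3 p) (node b m3 (2 * p))) => -> //.
      by rewrite n3 //; have [] := I3 b (2 * p).
    by rewrite n3 //; have [] := I3 b (2 * p).+1.
  + move=> b v v0 vp vx; rewrite /local_best !n4 o4.
    have [->|vp'] := eqVneq v p; first exact: L3.
    have [v2 v21] : 2 * v != p /\ (2 * v).+1 != p by lia.
    by rewrite o3 !n3 //; exact: I4.
- rewrite /I /= /store /=; split=> //.
  + by move=> b v; have := bm b v; case: b.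
  + by move=> b v v0 vp vx; have := Lm b v v0 vp vx; case: b.
- by rewrite /= /store /= (gtn_eqF p00).
- move=> m1 [[I1 I2 I3 I4] /= /negbT]; rewrite -eqn0Ngt => /eqP e0; split=> // b v v0 vx.
  by apply: I4 => //; rewrite e0 -lt0n.
Qed.

End Tournament.

(** * Customers in the slots of the trees *)

Section Store.
Variable R : realType.
Variables (inst table query : memory R) (W M n : nat) (dev : 'I_n -> R).
Local Notation E := (environment inst table query).
Local Notation wp := (wp inst table query W M).
Implicit Types (m : memory R) (b : bool) (C T : {set 'I_n}) (i j : 'I_n).

Definition consistent m : Prop :=
  bounded W M m /\ (forall b v, 0 < v -> local_best b m v).

Lemma code_inj b1 b2 : code b1 = code b2 -> b1 = b2.
Proof. by case: b1; case: b2. Qed.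

(** Induction from the leaves, on [M - u]: nodes from index [M] on are empty, and any other node
    takes its slot and value from itself or from a child. *)
Lemma best_valid m b v : consistent m -> 0 < v -> 0 < icell m (best_slot b) v ->
  icell m 7 (icell m (best_slot b) v) = code b /\
  rcell m (best_value b) v = rcell m 3 (icell m (best_slot b) v).
Proof.
move=> [bm Lm].
suff H u : 0 < u -> 0 < (node b m u).1 ->
    icell m 7 (node b m u).1 = code b /\ (node b m u).2 = rcell m 3 (node b m u).1.
  by exact: H.
move: {2}(M - u) (leqnn (M - u)) => k; elim: k u => [|k IH] u uk u0.
  by have [_ z] := bm b u; rewrite /= z //; lia.
have [uM|uM] := leqP M u; first by have [_ z] := bm b u; rewrite /= z.
rewrite Lm //; case: (prefer_cases b (prefer b (own b m u) (node b m (2 * u)))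
  (node b m (2 * u).+1)) => ->; last by apply: IH; lia.
case: (prefer_cases b (own b m u) (node b m (2 * u))) => ->; last by apply: IH; lia.
by rewrite /own; case: eqP.
Qed.

(** Climbing from [v] to the root by halving the index, [prefer] never gets worse. *)
Lemma best_dominates m b v : consistent m -> 0 < v -> icell m 7 v = code b ->
  0 < icell m (best_slot b) 1 /\ better b (rcell m (best_value b) 1) (rcell m 3 v).
Proof.
move=> [_ Lm] v0 fv.
have own1 : 0 < (own b m v).1 by rewrite /own fv eqxx.
have [h1 d1] := @prefer_left R b (own b m v) (node b m (2 * v)) own1.
have [h2 d2] := @prefer_left R b _ (node b m (2 * v).+1) h1.
rewrite -Lm // in h2 d2.
have {d1 d2 own1 h1} dv := better_trans d2 d1.
suff H u : 0 < u -> 0 < (node b m u).1 ->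
    0 < (node b m 1).1 /\ better b (node b m 1).2 (node b m u).2.
  by have [h3 d3] := H v v0 h2; split=> //; exact: better_trans d3 dv.
have [k] := ubnP u; elim: k u => // k IH u uk u0 hu.
have [e|u1] := eqVneq u 1.
  by rewrite e in hu *; split=> //; exact: better_refl.
have w0 : 0 < u %/ 2 by lia.
have [hw dw] : 0 < (node b m (u %/ 2)).1 /\ better b (node b m (u %/ 2)).2 (node b m u).2.
  rewrite Lm //; have : u = 2 * (u %/ 2) \/ u = (2 * (u %/ 2)).+1 by lia.
  case=> <-; last exact: prefer_right.
  have [a1 a2] := @prefer_right R b (own b m (u %/ 2)) (node b m u) hu.
  have [a3 a4] := @prefer_left R b _ (node b m u.+1) a1.
  by split=> //; exact: better_trans a4 a2.
have [h3 d3] : 0 < (node b m 1).1 /\ better b (node b m 1).2 (node b m (u %/ 2)).2.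
  by apply: IH => //; lia.
by split=> //; exact: better_trans d3 dw.
Qed.

(* The customers of [C] occupy the slots [1..#|C|]; [sl] gives their slots, and
   the customers of [T] are those with flag [code true]. *)
Definition stored C T (sl : 'I_n -> nat) m : Prop :=
  [/\ T \subset C, icell m 1 0 = #|C|,
      forall i, i \in C -> [/\ 0 < sl i <= #|C|, icell m 6 (sl i) = i,
        rcell m 3 (sl i) = dev i & icell m 7 (sl i) = code (i \in T)],
      forall p, 0 < p <= #|C| -> exists2 i, i \in C & sl i = p
    & forall p, ~~ (0 < p <= #|C|) -> icell m 7 p = 0].

Lemma stored_inj C T sl m i j : stored C T sl m ->
  i \in C -> j \in C -> sl i = sl j -> i = j.
Proof.
move=> [_ _ H _ _] iC jC e; have [_ hi _ _] := H i iC; have [_ hj _ _] := H j jC.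
by apply: val_inj; rewrite /= -hi e.
Qed.

(** This is the interface of the trees, of which the later programs read only the roots: an empty
    root means that no stored customer has the flag, otherwise the root is extremal. *)
Lemma stored_root C T sl m b : stored C T sl m -> consistent m ->
  (icell m (best_slot b) 1 = 0 /\ forall j, j \in C -> (j \in T) = ~~ b) \/
  exists i, [/\ i \in C, (i \in T) = b, icell m (best_slot b) 1 = sl i,
    rcell m (best_value b) 1 = dev i
  & forall j, j \in C -> (j \in T) = b -> better b (dev i) (dev j)].
Proof.
move=> [TC kC Hs Hp Hf] cm.
have [z|pos] := posnP (icell m (best_slot b) 1).
  left; split=> // j jC; have [/andP[j0 jk] _ _ fj] := Hs j jC.
  case: (eqVneq (j \in T) b) => [e|]; last by case: (j \in T); case: (b).
  by have [] := best_dominates cm j0 (b := b); rewrite ?fj ?e // z.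
right; have [f1 v1] := best_valid cm (ltn0Sn 0) pos.
set p := icell m (best_slot b) 1 in pos f1 v1 *.
have pC : 0 < p <= #|C|.
  by apply/negPn/negP => /Hf; rewrite f1; case: (b).
have [i iC ip] := Hp p pC; have [_ _ vi fi] := Hs i iC.
exists i; split=> //.
- by apply: code_inj; rewrite -fi ip.
- by rewrite v1 -ip vi.
move=> j jC jb; have [/andP[j0 _] _ vj fj] := Hs j jC.
rewrite -vi -vj ip -v1; apply: (best_dominates cm j0 _).2.
by rewrite fj jb.
Qed.

Definition set_flag (e : iexp) b : cmd := Seq (SetI 7 e (ILit (code b))) (fix_path e).

Lemma card_slot_lt C T sl m i : stored C T sl m -> i \in C -> 0 < sl i <= #|C|.
Proof. by move=> [_ _ H _ _] /H[]. Qed.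

Lemma wp_set_flag C T sl m i b e :
  stored C T sl m -> consistent m -> i \in C -> #|C| < M -> #|C| <= W -> 2 <= W ->
  (forall m', icell m' 11 = icell m 11 -> icell m' 12 = icell m 12 ->
     ieval (E m') e = sl i) ->
  wp (set_flag e b) m (20 * trunc_log 2 #|C| + 25) (fun m' =>
    stored C (update b i T) sl m' /\ consistent m').
Proof.
move=> st [bm Lm] iC CM CW W2 ei; have [TC kC Hs Hp Hf] := st.
have /andP[s0 sC] := card_slot_lt st iC.
apply: (@wp_weaken _ _ _ _ _ _ _ _ (1 + (20 * trunc_log 2 (sl i) + 24)));
  [|by have := leq_trunc_log 2 sC; lia|by move=> m'; apply].
apply: wp_seq; apply: wp_lf => /=; rewrite ei //; split=> //.
- by apply: leq_ltn_trans CM.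
- by apply: leq_trans W2; case: (b).
set m1 := seti m 7 _ _.
apply: wp_weaken; first apply: wp_frame;
  first apply: (wp_fix_path (p0 := sl i) (x := 0) (m := m1)) => //.
- by rewrite s0 /=; apply: leq_ltn_trans CM.
- by apply: leq_trans CW.
- by move=> b' v; have := bm b' v; rewrite /m1; case: b'.
- by rewrite ei.
- move=> b' v v0 vi _; have := Lm b' v v0; rewrite /local_best /node /own /m1 /=.
  by rewrite /store /= (negbTE vi); case: b'.
- by [].
move=> m2 [[bm2 Lm2] [Hi Hr]]; split; last first.
  by split=> // b' v v0; apply: Lm2 => //; rewrite -lt0n.
have f7 p : icell m2 7 p = if p == sl i then code b else icell m 7 p.
  by rewrite Hi //= /store eqxx.
split.
- apply/fintype.subsetP => j; rewrite /update; case: (b); rewrite !inE.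
    by move=> /predU1P[->//|/(fintype.subsetP TC)].
  by move=> /andP[_ /(fintype.subsetP TC)].
- by rewrite Hi.
- move=> j jC; have [h1 h2 h3 h4] := Hs j jC; rewrite Hi // Hr //; split=> //.
  rewrite f7; case: eqP => [/(stored_inj st jC iC) ->|/eqP ji].
    by rewrite /update; case: (b); rewrite !inE eqxx.
  have {}ji : j != i by apply: contraNneq ji => ->.
  by rewrite h4 /update; case: (b); rewrite !inE (negbTE ji).
- by [].
- move=> p pC; rewrite f7; case: eqP => [pi|_]; last exact: Hf.
  by move: pC; rewrite pi s0 sC.
Qed.

Hypothesis inst_dev : forall i, rcell inst 1 i = dev i.

(** A newcomer starts outside [T]; promoting it is left to the rebalancing. *)
Definition append_cmd (e : iexp) : cmd :=
  Seq (seti0 1 (IAdd (wi 1) (ILit 1)))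
 (Seq (SetR 3 (wi 1) (RGet Inst 1 e))
 (Seq (SetI 6 (wi 1) e)
 (Seq (SetI 7 (wi 1) (ILit (code false))) (fix_path (wi 1))))).

(** The newcomer inherits the flag of the customer it displaces, which lies outside [T]. *)
Definition replace_cmd (e : iexp) : cmd :=
  Seq (SetR 3 (wi 11) (RGet Inst 1 e))
 (Seq (SetI 6 (wi 11) e) (fix_path (wi 11))).

Lemma local_best_frame m m' b v :
  (forall b, icell m' (best_slot b) = icell m (best_slot b)) ->
  (forall b, rcell m' (best_value b) = rcell m (best_value b)) ->
  icell m' 7 v = icell m 7 v -> rcell m' 3 v = rcell m 3 v ->
  local_best b m v -> local_best b m' v.
Proof. by move=> h1 h2 h3 h4; rewrite /local_best /node /own h1 h2 h3 h4. Qed.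

Lemma bounded_frame m m' :
  (forall b, icell m' (best_slot b) = icell m (best_slot b)) ->
  bounded W M m -> bounded W M m'.
Proof. by move=> h bm b v; rewrite h; exact: bm. Qed.

Lemma wp_append C T sl m i e :
  stored C T sl m -> consistent m -> i \notin C -> #|C|.+1 < M -> #|C|.+1 <= W ->
  n <= W -> 2 <= W -> evaluates inst table query m e i ->
  wp (append_cmd e) m (20 * trunc_log 2 #|C|.+1 + 28) (fun m' =>
    stored (i |: C)%SET T (fun j => if j == i then #|C|.+1 else sl j) m' /\ consistent m').
Proof.
move=> st [bm Lm] iC CM CW nW W2 ei; have [TC kC Hs Hp Hf] := st.
have M0 : 0 < M by lia.
have iW : i <= W by apply: leq_trans nW; exact/ltnW/ltn_ord.
apply: (@wp_weaken _ _ _ _ _ _ _ _ (1 + (1 + (1 + (1 + (20 * trunc_log 2 #|C|.+1 + 24))))));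
  [|by lia|by move=> m'; apply].
apply: wp_seq; apply: wp_lf => /=; rewrite kC addn1; split=> //.
apply: wp_seq; apply: wp_lf => /=; rewrite ei //; split=> //.
apply: wp_seq; apply: wp_lf => /=; rewrite ei //; split=> //.
apply: wp_seq; apply: wp_lf => /=; split=> //.
rewrite /store /= inst_dev; set m1 := seti _ 7 _ _.
have f7 p : icell m1 7 p = if p == #|C|.+1 then 2 else icell m 7 p.
  by rewrite /m1 /= /store /=.
have f6 p : icell m1 6 p = if p == #|C|.+1 then nat_of_ord i else icell m 6 p.
  by rewrite /m1 /= /store /=.
have f3 p : rcell m1 3 p = if p == #|C|.+1 then dev i else rcell m 3 p.
  by rewrite /m1 /= /store /=.
apply: wp_weaken; first apply: wp_frame;
  first apply: (wp_fix_path (p0 := #|C|.+1) (x := 0) (m := m1)) => //.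
- by apply: bounded_frame bm => -[].
- move=> b v v0 vi _; apply: local_best_frame (Lm b v v0); rewrite ?f7 ?f3 ?(negbTE vi) //.
    by case.
  by case.
- by [].
move=> m2 [[bm2 Lm2] [Hi Hr]]; split; last first.
  by split=> // b' v v0; apply: Lm2 => //; rewrite -lt0n.
have cC : #|(i |: C)%SET| = #|C|.+1 by rewrite cardsU1 iC.
split.
- by apply: fintype.subset_trans TC _; exact: finset.subsetUr.
- by rewrite Hi // cC.
- move=> j; rewrite !inE cC (Hi 6 isT) (Hi 7 isT) (Hr 3 isT) f6 f3 f7 => /predU1P[->|jC].
    have iT : i \notin T by apply: contra iC; exact: (fintype.subsetP TC).
    by rewrite !eqxx leqnn (negbTE iT).
  have ji : j != i by apply: contraNneq iC => <-.
  have [/andP[h0 h1] h2 h3 h4] := Hs j jC.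
  by rewrite (negbTE ji) ltn_eqF ?ltnS // h2 h3 h4 h0 ltnW.
- move=> p; rewrite cC => /andP[p0]; rewrite leq_eqVlt => /predU1P[->|pC].
    by exists i; rewrite ?setU11 ?eqxx // !inE eqxx.
  have [j jC <-] := Hp p ltac:(rewrite p0; exact: pC).
  exists j; first by rewrite !inE jC orbT.
  by case: eqP => // ji; move: iC; rewrite -ji jC.
- move=> p; rewrite cC Hi // f7 => pC; case: eqP => [pE|_].
    by move: pC; rewrite pE leqnn.
  by apply: Hf; apply: contra pC => /andP[-> /leqW].
Qed.

Lemma wp_replace C T sl m w i e :
  stored C T sl m -> consistent m -> i \notin C -> w \in C -> w \notin T ->
  icell m 11 0 = sl w -> #|C| < M -> #|C| <= W -> n <= W ->
  evaluates inst table query m e i ->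
  wp (replace_cmd e) m (20 * trunc_log 2 #|C| + 26) (fun m' =>
    stored (i |: C :\ w)%SET T (fun j => if j == i then sl w else sl j) m' /\ consistent m').
Proof.
move=> st [bm Lm] iC wC wT ew CM CW nW ei; have [TC kC Hs Hp Hf] := st.
have M0 : 0 < M by lia.
have iW : i <= W by apply: leq_trans nW; exact/ltnW/ltn_ord.
have /andP[s0 sC] := card_slot_lt st wC.
have sM : sl w < M by apply: leq_ltn_trans CM.
apply: (@wp_weaken _ _ _ _ _ _ _ _ (1 + (1 + (20 * trunc_log 2 (sl w) + 24))));
  [|by have := leq_trunc_log 2 sC; lia|by move=> m'; apply].
apply: wp_seq; apply: wp_lf => /=; rewrite ew ei // inst_dev; split=> //.
apply: wp_seq; apply: wp_lf => /=; rewrite ew ei //; split=> //.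
set m1 := seti _ 6 _ _.
have f6 p : icell m1 6 p = if p == sl w then nat_of_ord i else icell m 6 p.
  by rewrite /m1 /= /store /=.
have f3 p : rcell m1 3 p = if p == sl w then dev i else rcell m 3 p.
  by rewrite /m1 /= /store /=.
apply: wp_weaken; first apply: wp_frame;
  first apply: (wp_fix_path (p0 := sl w) (x := 0) (m := m1)) => //.
- by rewrite s0.
- by apply: leq_trans CW.
- by apply: bounded_frame bm => -[].
- move=> b v v0 vi _; apply: local_best_frame (Lm b v v0); rewrite ?f3 ?(negbTE vi) //.
    by case.
  by case.
- by [].
move=> m2 [[bm2 Lm2] [Hi Hr]]; split; last first.
  by split=> // b' v v0; apply: Lm2 => //; rewrite -lt0n.
have cC : #|(i |: C :\ w)%SET| = #|C|.
  by rewrite cardsU1 !inE (negbTE iC) andbF /= (cardsD1 w C) wC.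
have iT : i \notin T by apply: contra iC; exact: (fintype.subsetP TC).
split.
- apply/fintype.subsetP => j jT; rewrite !inE (fintype.subsetP TC _ jT) andbT.
  by apply/orP; right; apply: contraNneq wT => <-.
- by rewrite Hi // cC.
- move=> j; rewrite !inE cC (Hi 6 isT) (Hi 7 isT) (Hr 3 isT) f6 f3 => /predU1P[->|/andP[jw jC]].
    rewrite !eqxx s0 sC; split=> //; have [_ _ _] := Hs w wC.
    by rewrite /m1 /= /store /= (negbTE wT) (negbTE iT).
  have ji : j != i by apply: contraNneq iC => <-.
  have [h1 h2 h3 h4] := Hs j jC.
  have jw' : sl j != sl w by apply: contraNneq jw => /(stored_inj st jC wC) ->.
  by rewrite (negbTE ji) (negbTE jw') h2 h3; split.
- move=> p; rewrite cC => pC; have [j jC jp] := Hp p pC.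
  have [jw|jw] := eqVneq j w.
    by exists i; rewrite ?inE eqxx // -jw.
  exists j; first by rewrite !inE jw jC orbT.
  by case: eqP => // ji; move: iC; rewrite -ji jC.
- by move=> p; rewrite cC Hi // => pC; exact: Hf.
Qed.

(* The last slot is moved into the slot [wi 13] of the removed customer, so that
   the slots in use remain an initial segment. *)
Definition remove_cmd : cmd :=
  Seq (SetR 3 (wi 13) (RGet Work 3 (wi 1)))
 (Seq (SetI 6 (wi 13) (IGet Work 6 (wi 1)))
 (Seq (SetI 8 (IGet Work 6 (wi 1)) (wi 13))
 (Seq (SetI 7 (wi 13) (IGet Work 7 (wi 1)))
 (Seq (SetI 7 (wi 1) (ILit 0))
 (Seq (fix_path (wi 1))
 (Seq (fix_path (wi 13))
      (seti0 1 (ISub (wi 1) (ILit 1))))))))).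

Lemma wp_remove C T sl m i :
  stored C T sl m -> consistent m -> i \in C -> (forall j, j \in C -> icell m 8 j = sl j) ->
  icell m 13 0 = sl i -> #|C| < M -> #|C| <= W -> n <= W -> n <= M -> 2 <= W ->
  wp remove_cmd m (40 * trunc_log 2 #|C| + 54) (fun m' => exists sl',
    [/\ stored (C :\ i)%SET (T :\ i)%SET sl' m', consistent m' &
        forall j, j \in (C :\ i)%SET -> icell m' 8 j = sl' j]).
Proof.
move=> st [bm Lm] iC Hpos ei CM CW nW nM W2; have [TC kC Hs Hp Hf] := st.
have M0 : 0 < M by lia.
have /andP[s0 sC] := card_slot_lt st iC.
have sM : sl i < M by apply: leq_ltn_trans CM.
have C0 : 0 < #|C| by apply: leq_trans sC.
have [l lC ll] : exists2 l, l \in C & sl l = #|C| by apply: Hp; rewrite C0 leqnn.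
have [_ l6 l3 l7] := Hs l lC; rewrite ll in l6 l3 l7.
have lM : l < M by apply: leq_trans nM.
have lW : l <= W by apply: leq_trans nW; exact/ltnW/ltn_ord.
apply: (@wp_weaken _ _ _ _ _ _ _ _ (1 + (1 + (1 + (1 + (1 +
  ((20 * trunc_log 2 #|C| + 24) + ((20 * trunc_log 2 (sl i) + 24) + 1))))))));
  [|by have := leq_trunc_log 2 sC; lia|by move=> m'; apply].
apply: wp_seq; apply: wp_lf => /=; rewrite ei kC l3; split=> //.
apply: wp_seq; apply: wp_lf => /=; rewrite ei kC l6; split=> //.
apply: wp_seq; apply: wp_lf => /=; rewrite /store /= ei kC.
have -> : (if #|C| == sl i then nat_of_ord l else icell m 6 #|C|) = l.
  by case: ifP.
split=> //; first exact: leq_trans CW.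
apply: wp_seq; apply: wp_lf => /=; rewrite /store /= ei kC l7; split=> //.
  by apply: leq_trans W2; case: (_ \in _).
apply: wp_seq; apply: wp_lf => /=; rewrite /store /= kC; split=> //.
set m1 := seti _ 7 #|C| _.
pose sl' j := if sl j == #|C| then sl i else sl j.
have f6 p : icell m1 6 p = if p == sl i then nat_of_ord l else icell m 6 p.
  by rewrite /m1 /= /store /=.
have f8 p : icell m1 8 p = if p == l then sl i else icell m 8 p.
  by rewrite /m1 /= /store /=.
have f7 p : icell m1 7 p = if p == #|C| then 0 else if p == sl i then code (l \in T) else icell m 7 p.
  by rewrite /m1 /= /store /=.
have f3 p : rcell m1 3 p = if p == sl i then dev l else rcell m 3 p.
  by rewrite /m1 /= /store /=.
(* The repair from the vacated last slot leaves [sl i] inconsistent, as the parameter [x] allows;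
   the second repair starts there. If the two slots coincide, the flag written last, [0],
   prevails. *)
apply: wp_seq; apply: wp_weaken; first apply: wp_frame;
  first apply: (wp_fix_path (p0 := #|C|) (x := sl i) (m := m1)) => //.
- by rewrite C0.
- by apply: bounded_frame bm => -[].
- move=> b v v0 vC vi; apply: local_best_frame (Lm b v v0);
    rewrite ?f7 ?f3 ?(negbTE vi) ?(negbTE vC) //.
    by case.
  by case.
- by [].
move=> m2 [[bm2 Lm2] [Hi2 Hr2]].
apply: wp_seq; apply: wp_weaken; first apply: wp_frame;
  first apply: (wp_fix_path (p0 := sl i) (x := 0) (m := m2)) => //.
- by rewrite s0.
- by apply: leq_trans CW.
- by rewrite /= Hi2 //= /store /= ei.
- by move=> b v v0 vi _; apply: Lm2.
- by [].
move=> m3 [[bm3 Lm3] [Hi3 Hr3]].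
apply: wp_lf => /=; rewrite Hi3 // Hi2 //= /store /= kC subn1; split=> //.
  by apply: leq_trans CW; exact: leq_pred.
set m4 := seti _ 1 _ _.
have g6 p : icell m4 6 p = if p == sl i then nat_of_ord l else icell m 6 p.
  by rewrite /m4 /= /store /= -/(store _ _ _ _) Hi3 // Hi2 // f6.
have g8 p : icell m4 8 p = if p == l then sl i else icell m 8 p.
  by rewrite /m4 /= /store /= Hi3 // Hi2 // f8.
have g7 p : icell m4 7 p = if p == #|C| then 0 else if p == sl i then code (l \in T) else icell m 7 p.
  by rewrite /m4 /= /store /= Hi3 // Hi2 // f7.
have g3 p : rcell m4 3 p = if p == sl i then dev l else rcell m 3 p.
  by rewrite /m4 /= Hr3 // Hr2 // f3.
have cC : #|(C :\ i)%SET| = #|C|.-1 by rewrite (cardsD1 i C) iC.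
have predC p : (0 < p <= #|C|.-1) = (0 < p <= #|C|) && (p != #|C|) by lia.
have slE j : j \in C -> (sl j == #|C|) = (j == l).
  move=> jC; rewrite -ll; apply/eqP/eqP => [|->//]; exact: (stored_inj st).
have slI j : j \in C -> (sl j == sl i) = (j == i).
  move=> jC; apply/eqP/eqP => [|->//]; exact: (stored_inj st).
exists sl'; split.
- split.
  + by apply/fintype.subsetP => j; rewrite !inE => /andP[-> /(fintype.subsetP TC)].
  + by rewrite /m4 /= /store /= cC.
  + move=> j; rewrite !inE cC => /andP[ji jC]; rewrite ji /sl' slE //.
    have [h1 h2 h3 h4] := Hs j jC.
    have [jl|jl] := eqVneq j l.
      have iC' : (sl i == #|C|) = false by rewrite slE // -jl eq_sym; exact: negbTE.
      by rewrite g6 g3 g7 !eqxx predC s0 sC iC' jl.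
    rewrite g6 g3 g7 slI // slE // (negbTE ji) (negbTE jl) predC h1 slE // jl.
  + move=> p; rewrite cC predC => /andP[pC pnC]; have [j jC jp] := Hp p pC.
    have [ji|ji] := eqVneq j i.
      exists l; last by rewrite /sl' ll eqxx -jp ji.
      rewrite !inE lC andbT; apply: contraNneq pnC => li.
      by rewrite -jp ji -li ll.
    by exists j; rewrite ?inE ?ji ?jC // /sl' jp (negbTE pnC).
  + move=> p; rewrite cC predC negb_and negbK g7 => /orP[pC|/eqP->]; last by rewrite eqxx.
    case: eqP => // _; case: eqP => [pi|_]; last exact: Hf.
    by move: pC; rewrite pi s0 sC.
- split; first by apply: bounded_frame bm3 => -[].
  move=> b v v0; apply: local_best_frame (Lm3 b v v0 _); try by case.
  + by [].
  + by [].
  + by rewrite -lt0n.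
- move=> j; rewrite !inE => /andP[ji jC].
  rewrite -[icell m3 8 j]/(icell m4 8 j) g8 /sl' slE // val_eqE.
  by case: eqP => // _; exact: Hpos.
Qed.

End Store.

(** * Restoring the [K] greatest deviations after one change *)

Section Rebalance.
Variable R : realType.
Variables (inst table query : memory R) (W M n : nat) (dev : 'I_n -> R).
Variables (g : R) (K : nat).
Local Notation E := (environment inst table query).
Local Notation wp := (wp inst table query W M).
Implicit Types (m : memory R) (C T : {set 'I_n}) (i j t u : 'I_n).
Local Notation stored := (stored dev).
Local Notation consistent := (consistent W M).

Hypothesis inst_gamma : rcell inst 2 0 = g.

Definition ordered_except (X C T : {set 'I_n}) : Prop :=
  forall t u, t \in T -> u \in C -> u \notin T -> u \notin X -> (dev u <= dev t)%R.

Definition balanced C T : Prop := #|T| = minn K #|C| /\ ordered_except finset.set0 C T.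

(** The states that one insertion or removal can leave: [T] is short with at most one customer
    outside, [T] lost one member and is still ordered, or [T] is full and at most one outsider is
    out of order. *)
Definition nearly_balanced C T : Prop :=
  (#|T| < K /\ (#|C :\: T| <= 1 \/ #|T|.+1 = K /\ ordered_except finset.set0 C T)) \/
  (#|T| = K /\ exists2 X : {set 'I_n}, #|X| <= 1 & ordered_except X C T).

Definition tallied T m : Prop :=
  [/\ icell m 2 0 = K, icell m 3 0 = #|T| & rcell m 2 0 = (\sum_(i in T) dev i)%R].

(** With [K] the integral part of [g], members of [T] count fully and the greatest deviation outside
    counts with the fractional part. *)
Definition reports C T m : Prop :=
  (C \subset T /\ output m = (rcell m 1 0 + \sum_(i in T) dev i)%R) \/
  exists u, [/\ u \in C, u \notin T, forall j, j \in C -> j \notin T -> (dev j <= dev u)%R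
    & output m = (rcell m 1 0 + \sum_(i in T) dev i + (g - K%:R) * dev u)%R].

Definition report_cmd : cmd :=
  If (BLeI (ILit 1) (IGet Work (best_slot false) (ILit 1)))
     (setr0 0 (RAdd (RAdd (wr 1) (wr 2))
        (RMul (RSub (RGet Inst 2 (ILit 0)) (RNat (wi 2))) (RGet Work (best_value false) (ILit 1)))))
     (setr0 0 (RAdd (wr 1) (wr 2))).

Definition exchange_cmd : cmd :=
  let bu := RGet Work (best_value false) (ILit 1) in
  let bt := RGet Work (best_value true) (ILit 1) in
  If (BLeI (ILit 1) (wi 11))
     (If (BNot (BLeI (wi 2) (wi 3)))
        (Seq (seti0 3 (IAdd (wi 3) (ILit 1)))
        (Seq (setr0 2 (RAdd (wr 2) bu)) (set_flag (wi 11) true)))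
        (If (BAnd (BLeI (ILit 1) (wi 12)) (BNot (BLeR bu bt)))
           (Seq (setr0 2 (RAdd (wr 2) (RSub bu bt)))
           (Seq (set_flag (wi 11) true) (set_flag (wi 12) false)))
           Skip))
     Skip.

(** The slots at both roots are saved first, because moving one customer already changes the
    trees. *)
Definition rebalance_cmd : cmd :=
  Seq (seti0 11 (IGet Work (best_slot false) (ILit 1)))
 (Seq (seti0 12 (IGet Work (best_slot true) (ILit 1)))
 (Seq exchange_cmd report_cmd)).

Lemma consistent_frame m m' :
  (forall b, icell m' (best_slot b) = icell m (best_slot b)) ->
  (forall b, rcell m' (best_value b) = rcell m (best_value b)) ->
  icell m' 7 = icell m 7 -> rcell m' 3 = rcell m 3 -> consistent m -> consistent m'.
Proof.
move=> h1 h2 h3 h4 [bm Lm]; split; first exact: bounded_frame bm.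
by move=> b v v0; apply: local_best_frame (Lm b v v0); rewrite ?h3 ?h4.
Qed.

Lemma stored_frame C T sl m m' :
  icell m' 1 = icell m 1 -> icell m' 6 = icell m 6 -> icell m' 7 = icell m 7 ->
  rcell m' 3 = rcell m 3 -> stored C T sl m -> stored C T sl m'.
Proof.
by move=> h1 h6 h7 h3 [TC kC Hs Hp Hf]; split; rewrite ?h1 ?h6 ?h7 ?h3.
Qed.

Lemma wp_report C T sl m : 0 < M ->
  stored C T sl m -> consistent m -> tallied T m ->
  wp report_cmd m 2 (fun m' =>
    [/\ stored C T sl m', consistent m', tallied T m' & reports C T m']).
Proof.
move=> M0 st cm [t1 t2 t3]; apply: wp_lf => /=.
have keep v : stored C T sl (setr m 0 0 v) /\ consistent (setr m 0 0 v).
  split; first exact: stored_frame st.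
  by apply: consistent_frame cm => // -[].
case: (stored_root false st cm) => [[/= z allT]|[u [uC uT /= su vu umax]]].
  rewrite z /=; split=> //; have [k1 k2] := keep (rcell m 1 0 + rcell m 2 0)%R.
  split=> //; left; split; last by rewrite /output /= /store /= t3.
  by apply/fintype.subsetP => j jC; rewrite allT.
have /andP[s0 _] := card_slot_lt st uC.
rewrite su s0 vu t1 inst_gamma; split=> //; set v := (_ + _ + _ * _)%R.
have [k1 k2] := keep v; split=> //; right; exists u; split=> //; first by rewrite uT.
  by move=> j jC jT; apply: umax => //; exact: negbTE.
by rewrite /output /= /store /= /v t3.
Qed.

Lemma balanced_stop C T : T \subset C -> #|T| <= K ->
  (C \subset T \/ #|T| = K /\ ordered_except finset.set0 C T) -> balanced C T.
Proof.
move=> TC TK; have lTC := subset_leq_card TC.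
case=> [CT|[TKe o]]; last by split=> //; rewrite -TKe; apply/esym/minn_idPl.
have e : #|T| = #|C| by apply/eqP; rewrite eqn_leq lTC subset_leq_card.
split; first by rewrite e; apply/esym/minn_idPr; rewrite -e.
by move=> t u tT uC; rewrite (fintype.subsetP CT).
Qed.

(** One exchange suffices: when [T] is full, an outsider beating its least member must be the single
    element of [X], and after the swap [T] dominates everything outside. *)
Lemma wp_exchange C T sl m : 0 < M -> #|C| < M -> #|C| <= W -> 2 <= W -> K <= W ->
  stored C T sl m -> consistent m -> tallied T m -> nearly_balanced C T ->
  icell m 11 0 = icell m (best_slot false) 1 ->
  icell m 12 0 = icell m (best_slot true) 1 ->
  wp exchange_cmd m (1 + ((20 * trunc_log 2 #|C| + 25) + (20 * trunc_log 2 #|C| + 25))).+3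
    (fun m' => exists T', [/\ stored C T' sl m', consistent m', tallied T' m' & balanced C T']).
Proof.
move=> M0 CM CW W2 KW st cm [t1 t2 t3] near e11 e12.
have [TC kC Hs Hp Hf] := st.
have TK : #|T| <= K by case: near => -[]; lia.
apply: wp_if; rewrite /= e11.
case: (stored_root false st cm) => [[/= z allT]|[u [uC /negbT uT /= su vu umax]]].
  rewrite z /=; apply: wp_skip => //; exists T; split=> //; apply: balanced_stop => //.
  by left; apply/fintype.subsetP => j jC; rewrite allT.
have /andP[s0 _] := card_slot_lt st uC.
rewrite su s0 /= in e11 *.
have {}umax j : j \in C -> j \notin T -> (dev j <= dev u)%R.
  by move=> jC jT; apply: umax => //; exact: negbTE.
apply: wp_if; rewrite /= t1 t2 -ltnNge; case: ltnP => TK'.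
  apply: (@wp_weaken _ _ _ _ _ _ _ _ (1 + (1 + (20 * trunc_log 2 #|C| + 25))));
    [|by move: (trunc_log _ _); clear; lia|by move=> m'; apply].
  apply: wp_seq; apply: wp_lf => /=; rewrite t2 addn1; split=> //; first exact: leq_trans KW.
  apply: wp_seq; apply: wp_lf => /=; split=> //; set m1 := setr _ 2 0 _.
  have st1 : stored C T sl m1 by exact: stored_frame st.
  have cm1 : consistent m1 by apply: consistent_frame cm => // -[].
  apply: wp_weaken; first apply: wp_frame;
    first apply: (wp_set_flag (i := u) true st1 cm1) => //.
  - by move=> m' /= ->.
  - by [].
  move=> m2 [[st2 cm2] [Hi Hr]]; exists (u |: T)%SET.
  have TuC : (u |: T)%SET \subset C.
    by apply/fintype.subsetP => j; rewrite !inE => /predU1P[->|/(fintype.subsetP TC)].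
  have cT : #|(u |: T)%SET| = #|T|.+1 by rewrite cardsU1 uT.
  split=> //.
    split; first by rewrite Hi.
      by rewrite Hi //= /store /= cT.
    by rewrite Hr //= /store /= vu t3 big_setU1 //= addrC.
  apply: balanced_stop => //; first by rewrite cT.
  case: near => [[_ near]|[TKe _]]; last by lia.
  case: near => [U1|[TK1 o]].
    left; apply/fintype.subsetP => j jC; rewrite !inE.
    case: (boolP (j \in T)) => [|jT]; first by rewrite orbT.
    rewrite orbF; apply/eqP; apply: (card_le1_eqP U1); by rewrite inE ?uT ?jT.
  right; split; first by rewrite cT.
  move=> t v; rewrite !inE negb_or => tT vC /andP[vu' vT] _.
  case/predU1P: tT => [->|tT]; first exact: umax.
  by apply: o => //; rewrite inE.
have TKe : #|T| = K by apply/eqP; rewrite eqn_leq TK.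
have {near} [X X1 oX] : exists2 X : {set 'I_n}, #|X| <= 1 & ordered_except X C T.
  by case: near => [[]|[_ [X]]]; [lia|move=> *; exists X].
apply: wp_if; rewrite /= e12.
case: (stored_root true st cm) => [[/= z allT]|[t [tC tT /= st' vt tmin]]].
  rewrite z /=; apply: wp_skip => //; exists T; split=> //; apply: balanced_stop => //.
  by right; split=> // t v tT; have := allT t (fintype.subsetP TC t tT); rewrite tT.
have /andP[s0' _] := card_slot_lt st tC.
rewrite st' s0' vu vt /= in e12 *; rewrite -ltNge; case: ltP => [tu|ut]; last first.
  apply: wp_skip => //; exists T; split=> //; apply: balanced_stop => //.
  right; split=> // a v aT vC vT _; apply: (le_trans (umax v vC vT)).
  by apply: (le_trans ut); apply: tmin => //; exact: (fintype.subsetP TC).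
have uX : u \in X.
  by apply/negPn/negP => uX; have := oX t u tT uC uT uX; rewrite leNgt tu.
apply: wp_seq; apply: wp_lf => /=; split=> //; set m1 := setr _ 2 0 _.
have st1 : stored C T sl m1 by exact: stored_frame st.
have cm1 : consistent m1 by apply: consistent_frame cm => // -[].
apply: wp_seq; apply: wp_weaken; first apply: wp_frame;
  first apply: (wp_set_flag (i := u) true st1 cm1) => //.
- by move=> m' /= ->.
- by [].
move=> m2 [[st2 cm2] [Hi2 Hr2]].
apply: wp_weaken; first apply: wp_frame;
  first apply: (wp_set_flag (i := t) false st2 cm2) => //.
- by move=> m' _ /= ->; rewrite Hi2.
- by [].
move=> m3 [[st3 cm3] [Hi3 Hr3]]; rewrite /update /= in st3.
exists ((u |: T) :\ t)%SET.
have tu' : t != u by apply: contraNneq uT => <-.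
have cT : #|((u |: T) :\ t)%SET| = #|T|.
  have := cardsD1 t (u |: T)%SET; rewrite cardsU1 uT !inE tT orbT.
  by move/addnI => <-.
split=> //.
  split; first by rewrite Hi3 // Hi2.
    by rewrite Hi3 // Hi2 //= cT.
  rewrite Hr3 // Hr2 //= /store /= vu vt t3.
  have tUT : t \in (u |: T)%SET by rewrite !inE tT orbT.
  have : (\sum_(i in (u |: T)%SET) dev i =
      dev t + \sum_(i in ((u |: T) :\ t)%SET) dev i)%R by exact: big_setD1.
  by rewrite big_setU1 //= => h; rewrite addrCA addrA h addrAC subrr add0r.
apply: balanced_stop; [|by rewrite cT|right; split; first by rewrite cT].
  apply/fintype.subsetP => j; rewrite !inE => /andP[_ /predU1P[->//|/(fintype.subsetP TC)//]].
move=> a v; rewrite !inE negb_and negbK negb_or => /andP[at' aUT] vC vUT _.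
have vt' : v = t \/ v \notin T /\ v != u.
  by case/orP: vUT => [/eqP|/andP[]]; [left|right].
case: vt' => [->|[vT vu']].
  case/predU1P: aUT => [->|aT]; first exact: ltW.
  by apply: tmin => //; exact: (fintype.subsetP TC).
case/predU1P: aUT => [->|aT]; first exact: umax.
apply: oX => //; apply: contraNN vu' => vX; apply/eqP.
exact: (card_le1_eqP X1).
Qed.

Lemma wp_rebalance C T sl m : 0 < M -> #|C| < M -> #|C| <= W -> 2 <= W -> K <= W ->
  stored C T sl m -> consistent m -> tallied T m -> nearly_balanced C T ->
  wp rebalance_cmd m (40 * trunc_log 2 #|C| + 60) (fun m' => exists T',
    [/\ stored C T' sl m', consistent m', tallied T' m', balanced C T' & reports C T' m']).
Proof.
move=> M0 CM CW W2 KW st cm [t1 t2 t3] near.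
have bW b : icell m (best_slot b) 1 <= W by have [bm _] := cm; have [] := bm b 1.
apply: (@wp_weaken _ _ _ _ _ _ _ _ (1 + (1 + ((1 + ((20 * trunc_log 2 #|C| + 25) +
  (20 * trunc_log 2 #|C| + 25))).+3 + 2)))); [|by lia|by move=> m'; apply].
apply: wp_seq; apply: wp_lf => /=; split=> //; first exact: (bW false).
apply: wp_seq; apply: wp_lf => /=; rewrite /store /=; split=> //; first exact: (bW true).
set m1 := seti (seti m 11 0 _) 12 0 _.
have st1 : stored C T sl m1 by exact: stored_frame st.
have cm1 : consistent m1 by apply: consistent_frame cm => // -[].
apply: wp_seq; apply: (wp_weaken (wp_exchange M0 CM CW W2 KW st1 cm1 _ near _ _)) => //.
move=> m' [T' [k1 k2 k3 k4]].
apply: (wp_weaken (wp_report M0 k1 k2 k3)) => // m'' [l1 l2 l3 l4].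
by exists T'.
Qed.

End Rebalance.

(** * Cardinality-constrained sets incrementally *)

Section CardinalityIncremental.
Variable R : realType.
Implicit Types (x : cardinality R) (m : memory R).

Definition dev x (i : 'I_(G_n x)) : R := G_dev x i ord0.
Definition rank x : nat := Num.truncn (G_Gamma x).

Lemma rank_itv x : ((rank x)%:R <= G_Gamma x < (rank x).+1%:R)%R.
Proof. by apply: truncn_itv; case/andP: (G_Gamma_bnd x). Qed.

Lemma rank_le x : rank x <= G_n x.
Proof.
rewrite -(ler_nat R); have /andP[h _] := rank_itv x; apply: le_trans h _.
by case/andP: (G_Gamma_bnd x).
Qed.

(** The certificate has weight [1] on [T], the fractional part of [Gamma] on [u] and [0] elsewhere,
    with the deviation of [u] as multiplier. A customer discarded from [C] is dominated by all of
    [C], hence by [u], and may have weight [0]. *)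
Lemma kept_worst_case x (S C T : {set 'I_(G_n x)}) m :
  T \subset C -> C \subset S -> balanced (@dev x) (rank x) C T ->
  (S <> C -> #|C| = (rank x).+1 /\
     forall j c, j \in S -> j \notin C -> c \in C -> (dev j <= dev c)%R) ->
  rcell m 1 0 = (\sum_(i in S) G_q0 x i ord0)%R ->
  reports (@dev x) (G_Gamma x) (rank x) C T m ->
  is_worst_case_load (cardinality_set (x := x)) S (output m).
Proof.
move=> TC CS [cT oT] disc base; have /andP[KG GK] := rank_itv x.
have TS := fintype.subset_trans TC CS.
case=> [[CT ->]|[u [uC uT umax ->]]].
  have eTC : T = C by apply/eqP; rewrite finset.eqEsubset TC.
  subst T.
  have CK : #|C| <= rank x by rewrite cT geq_minl.
  (* Discarding requires [rank x + 1] kept customers, but here all kept ones are in [T], which has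
     at most [rank x]. *)
  have eS : S = C by apply: contrapT => /disc[]; lia.
  rewrite base -eS in cT CK *.
  have := @cardinality_certificate R x S (fun => 1%R) 0%R.
  rewrite sumr_const mul0r; under [X in (_ + X)%R]eq_bigr do rewrite mulr1.
  apply=> //.
  - by move=> i _; rewrite ler01 lexx.
  - by apply: le_trans KG; rewrite ler_nat.
  - by move=> i _; rewrite ltNge G_dev_ge0.
have uS := fintype.subsetP CS u uC.
have cTK : #|T| = rank x.
  have : #|T| < #|C| by apply: proper_card; apply/properP; split=> //; exists u.
  by rewrite cT; move: (rank x) (#|C|) => a b; clear; lia.
pose eta i : R := (if i \in T then 1 else if i == u then G_Gamma x - (rank x)%:R else 0)%R.
have sum_eta (f : 'I_(G_n x) -> R) : (\sum_(i in S) f i * eta i =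
    \sum_(i in T) f i + (G_Gamma x - (rank x)%:R) * f u)%R.
  rewrite (bigID (mem T)) /=; congr (_ + _)%R.
    apply: eq_big => [i|i /andP[_ iT]]; last by rewrite /eta iT mulr1.
    by apply: andb_idl; exact: (fintype.subsetP TS).
  rewrite (bigD1 u) ?uS //= big1 ?addr0; first by rewrite /eta (negbTE uT) eqxx mulrC.
  by move=> i /andP[/andP[_ iT] iu]; rewrite /eta (negbTE iT) (negbTE iu) mulr0.
have eta_sum : (\sum_(i in S) eta i = G_Gamma x)%R.
  have := sum_eta (fun => 1%R); under eq_bigr do rewrite mul1r.
  by move=> ->; rewrite sumr_const cTK mulr1 addrC subrK.
have := @cardinality_certificate R x S eta (dev u).
rewrite sum_eta base addrA; apply=> //.
- move=> i _; rewrite /eta; case: ifP => _; first by rewrite ler01 lexx.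
  case: ifP => _; last by rewrite ler01 lexx.
  rewrite subr_ge0 KG lerBlDl -natr1 in GK *; exact: ltW.
- by rewrite eta_sum.
- exact: G_dev_ge0.
- move=> i iS ui; rewrite /eta; case: ifP => // /negbT iT.
  have [iC|iC] := boolP (i \in C); first by have := umax i iC iT; rewrite leNgt ui.
  have [|_ d] := disc; first by move=> e; move: iC; rewrite -e iS.
  by have := d i u iS iC uC; rewrite leNgt ui.
- move=> i iS iu; rewrite /eta; case: ifP => iT.
    by have := oT i u iT uC uT; rewrite inE leNgt iu => /(_ isT).
  by case: eqP => // e; move: iu; rewrite e ltxx.
- by rewrite eta_sum subrr mulr0.
Qed.

(** The machine has no rounding of reals; counting up to [Gamma <= n] takes linear time, paid once
    at initialization. *)
Definition rank_cmd : cmd :=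
  While (BLeR (RNat (IAdd (wi 2) (ILit 1))) (RGet Inst 2 (ILit 0)))
    (seti0 2 (IAdd (wi 2) (ILit 1))).

Lemma wp_rank x table query W M : G_n x <= W -> 0 < M ->
  wp (inst_memory (cardinality_problem x)) table query W M rank_cmd (zero_memory R)
    (2 * G_n x + 1)
    (fun m => [/\ icell m 2 0 = rank x, forall a, a != 2 -> icell m a = fun _ => 0
       & forall a, rcell m a = fun _ => 0%R]).
Proof.
move=> nW M0; have /andP[KG GK] := rank_itv x.
apply: wp_weaken; first apply: wp_frame; first apply: (wp_while
  (I := fun m => icell m 2 0 <= rank x)
  (phi := fun m => 2 * (rank x - icell m 2 0))) => //.
- move=> m Im /= h; exists 1.
  have lt : icell m 2 0 < rank x.
    by rewrite -ltnS -(ltr_nat R) -addn1; apply: le_lt_trans GK.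
  apply: wp_lf => /=; rewrite addn1; split=> //.
    by apply: leq_trans lt _; apply: leq_trans nW; exact: rank_le.
  by rewrite /store /=; split=> //; lia.
- have := rank_le x; rewrite /=; lia.
move=> m [[Im /= h] [Hi Hr]]; split.
- apply/eqP; rewrite eqn_leq Im /= -ltnS -(ltr_nat R).
  by apply: le_lt_trans KG _; rewrite ltNge -addn1 h.
- by move=> a a2; rewrite Hi // inE.
- by move=> a; rewrite Hr.
Qed.

Lemma stored0 x W M m : (forall a, a != 2 -> icell m a = fun _ => 0) ->
  (forall a, rcell m a = fun _ => 0%R) ->
  stored (@dev x) finset.set0 finset.set0 (fun => 0) m /\ consistent W M m.
Proof.
move=> Hi Hr; split.
  split; rewrite ?finset.sub0set ?Hi ?cards0 //.
  - by move=> i; rewrite inE.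
  - by move=> p; lia.
split=> b v; first by rewrite Hi //; case: b.
move=> _; rewrite /local_best /node /own !Hi ?Hr //; case: b => //=.
Qed.

(** The nominal load runs over the whole route [S], the trees only over the kept part [C]; with
    removals, [C] is all of [S]. *)
Definition kept x W M (S C T : {set 'I_(G_n x)}) sl m : Prop :=
  [/\ stored (@dev x) C T sl m, consistent W M m, tallied (@dev x) (rank x) T m
    & rcell m 1 0 = (\sum_(i in S) G_q0 x i ord0)%R].

(** Array [8] finds the slot of a customer to be removed; it is indexed by customers, hence storage
    linear in [G_n x]. *)
Definition cardinality_inv x W M (S : {set 'I_(G_n x)}) m : Prop :=
  exists T sl, [/\ kept W M S S T sl m, forall i, i \in S -> icell m 8 i = sl i,
    balanced (@dev x) (rank x) S T & reports (@dev x) (G_Gamma x) (rank x) S T m].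

Lemma tallied_frame x (T : {set 'I_(G_n x)}) m m' :
  icell m' 2 = icell m 2 -> icell m' 3 = icell m 3 -> rcell m' 2 = rcell m 2 ->
  tallied (@dev x) (rank x) T m -> tallied (@dev x) (rank x) T m'.
Proof. by rewrite /tallied => -> -> ->. Qed.

Lemma wp_kept_rebalance x table query W M (S C T : {set 'I_(G_n x)}) sl m :
  let inst := inst_memory (cardinality_problem x) in
  0 < M -> #|C| < M -> #|C| <= W -> 2 <= W -> rank x <= W ->
  kept W M S C T sl m -> nearly_balanced (@dev x) (rank x) C T ->
  wp inst table query W M rebalance_cmd m (40 * trunc_log 2 #|C| + 60) (fun m' =>
    exists T', [/\ kept W M S C T' sl m', icell m' 8 = icell m 8,
      balanced (@dev x) (rank x) C T' & reports (@dev x) (G_Gamma x) (rank x) C T' m']).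
Proof.
move=> inst M0 CM CW W2 KW [st cm tm bm] near.
have gE : rcell inst 2 0 = G_Gamma x by [].
apply: wp_weaken; first apply: wp_frame;
  first apply: (wp_rebalance table query gE M0 CM CW W2 KW st cm tm near) => //.
  by [].
move=> m' [[T' [k1 k2 k3 k4 k5]] [Hi Hr]]; exists T'; split=> //.
  by split=> //; rewrite Hr.
by rewrite Hi.
Qed.

Definition cardinality_update (b : bool) (e : iexp) : cmd :=
  if b then
    Seq (setr0 1 (RAdd (wr 1) (RGet Inst 0 e)))
   (Seq (SetI 8 e (IAdd (wi 1) (ILit 1))) (Seq (append_cmd e) rebalance_cmd))
  else
    Seq (setr0 1 (RSub (wr 1) (RGet Inst 0 e)))
   (Seq (seti0 13 (IGet Work 8 e))
   (Seq (If (BLeI (IGet Work 7 (wi 13)) (ILit 1))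
           (Seq (seti0 3 (ISub (wi 3) (ILit 1)))
                (setr0 2 (RSub (wr 2) (RGet Work 3 (wi 13))))) Skip)
   (Seq remove_cmd rebalance_cmd))).

Lemma nth_dev x (i : 'I_(G_n x)) : rcell (inst_memory (cardinality_problem x)) 1 i = dev i.
Proof. exact: nth_vec. Qed.

Lemma wp_cardinality_add x table query W M (S : {set 'I_(G_n x)}) i e m :
  let inst := inst_memory (cardinality_problem x) in
  G_n x < M -> G_n x < W -> 2 <= W -> cardinality_inv W M S m -> i \notin S ->
  evaluates inst table query m e i ->
  wp inst table query W M (cardinality_update true e) m
    (60 * trunc_log 2 #|S|.+1 + 90) (cardinality_inv W M (i |: S)%SET).
Proof.
move=> inst nM nW W2 [T [sl [[st cm tm bm] pos [cT oT] _]]] iS ei.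
have [TS kS _ _ _] := st.
have M0 : 0 < M by lia.
have cS : #|(i |: S)%SET| = #|S|.+1 by rewrite cardsU1 iS.
have Sn : #|S| < G_n x.
  by rewrite -cS -[leqRHS]card_ord max_card.
have SM : #|S|.+1 < M by apply: leq_ltn_trans nM.
have SW : #|S|.+1 <= W by apply: leq_trans (ltnW nW).
apply: (@wp_weaken _ _ _ _ _ _ _ _ (1 + (1 + ((20 * trunc_log 2 #|S|.+1 + 28) +
   (40 * trunc_log 2 #|S|.+1 + 60))))); [|by lia|by move=> m'; apply].
apply: wp_seq; apply: wp_lf => /=; rewrite ei // nth_vec bm; split=> //.
apply: wp_seq; apply: wp_lf => /=; rewrite kS ei // addn1; split=> //.
  by apply: ltn_trans nM; exact: ltn_ord.
set m1 := seti _ 8 _ _.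
have st1 : stored (@dev x) S T sl m1 by exact: stored_frame st.
have cm1 : consistent W M m1 by apply: consistent_frame cm => // -[].
apply: wp_seq; apply: wp_weaken; first apply: wp_frame;
  first apply: (wp_append (@nth_dev x) st1 cm1 iS SM SW (ltnW nW) W2 (e := e)).
- by move=> m' e0; apply: ei; rewrite e0.
- by [].
move=> m2 [[st2 cm2] [Hi Hr]].
have kp : kept W M (i |: S)%SET (i |: S)%SET T (fun j => if j == i then #|S|.+1 else sl j) m2.
  split=> //.
    by apply: tallied_frame tm; rewrite ?Hi ?Hr.
  by rewrite Hr //= /store /= big_setU1 // addrC.
rewrite -cS; apply: wp_weaken; first apply: (wp_kept_rebalance _ _ M0 _ _ W2 _ kp).
- by rewrite cS.
- by rewrite cS.
- by apply: leq_trans (rank_le x) (ltnW nW).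
(* If [T] is not full it equals [S], so only [i] lies outside; otherwise only [i] can be out of
   order. *)
- have [TK|TK] := ltnP #|T| (rank x).
    left; split=> //; left.
    have ST : S \subset T.
      have : #|T| = #|S| by move: TK cT; rewrite /minn; case: ifP => //; lia.
      by move=> e1; have := subset_leqif_cards TS => -[_]; rewrite e1 eqxx => /esym/eqP ->.
    apply: leq_trans (_ : #|[set i]%SET| <= 1); last by rewrite cards1.
    apply: subset_leq_card; apply/fintype.subsetP => j; rewrite !inE => /andP[jT].
    by case/predU1P => [->//|/(fintype.subsetP ST)]; rewrite (negbTE jT).
  right; split; first by apply/eqP; rewrite eqn_leq TK andbT cT geq_minl.
  exists [set i]%SET; first by rewrite cards1.
  move=> t u tT; rewrite !inE => /predU1P[->|uS] uT ui; first by rewrite eqxx in ui.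
  by apply: oT => //; rewrite inE.
- by [].
move=> m3 [T' [k1 k2 k3 k4]]; exists T', (fun j => if j == i then #|S|.+1 else sl j); split=> //.
move=> j; rewrite k2 Hi //= /store /= !inE val_eqE; case: eqP => [//|_] /= jS.
exact: pos.
Qed.

Lemma wp_cardinality_remove x table query W M (S : {set 'I_(G_n x)}) i e m :
  let inst := inst_memory (cardinality_problem x) in
  G_n x < M -> G_n x < W -> 2 <= W -> cardinality_inv W M S m -> i \in S ->
  evaluates inst table query m e i ->
  wp inst table query W M (cardinality_update false e) m
    (80 * trunc_log 2 #|S| + 120) (cardinality_inv W M (S :\ i)%SET).
Proof.
move=> inst nM nW W2 [T [sl [[st cm [t1 t2 t3] bm] pos [cT oT] _]]] iS ei.
have [TS kS Hs _ _] := st.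
have M0 : 0 < M by lia.
have cS : #|(S :\ i)%SET| = #|S|.-1 by rewrite (cardsD1 i S) iS.
have Sn : #|S| <= G_n x by rewrite -[leqRHS]card_ord max_card.
have SM : #|S| < M by apply: leq_ltn_trans nM.
have SW : #|S| <= W by apply: leq_trans (ltnW nW).
have [/andP[s0 sS] h2 h3 h4] := Hs i iS.
have TKr : #|T| <= rank x by rewrite cT geq_minl.
have KW : rank x <= W by apply: leq_trans (rank_le x) (ltnW nW).
apply: (@wp_weaken _ _ _ _ _ _ _ _ (1 + (1 + (3 + ((40 * trunc_log 2 #|S| + 54) +
   (40 * trunc_log 2 #|S| + 60)))))); [|by lia|by move=> m'; apply].
apply: wp_seq; apply: wp_lf => /=; rewrite ei // nth_vec bm; split=> //.
apply: wp_seq; apply: wp_lf => /=; rewrite ei // pos //; split=> //.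
  by apply: leq_trans SW.
set m1 := seti _ 13 _ _.
have st1 : stored (@dev x) S T sl m1 by exact: stored_frame st.
have cm1 : consistent W M m1 by apply: consistent_frame cm => // -[].
have sumT : (\sum_(j in T) dev j = (if i \in T then dev i else 0) + \sum_(j in (T :\ i)%SET) dev j)%R.
  case: ifP => iT; first exact: big_setD1.
  rewrite add0r; apply: eq_bigl => j; rewrite !inE.
  by case: eqP => // ->; rewrite iT.
have cardT : #|T| = (i \in T) + #|(T :\ i)%SET| by exact: cardsD1.
apply: wp_seq; apply: (wp_weaken (k := 3) (Q := fun m2 =>
  [/\ stored (@dev x) S T sl m2, consistent W M m2, tallied (@dev x) (rank x) (T :\ i)%SET m2,
      icell m2 8 = icell m 8 & icell m2 13 0 = sl i /\ rcell m2 1 = rcell m1 1])); [|by []|].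
  apply: wp_lf => /=; rewrite /store /= h4 h3 t2 t3.
  move: sumT cardT; case: ifP => iT sumT cardT /=.
    split=> //; first exact: leq_trans (leq_subr _ _) (leq_trans TKr KW).
    split=> //; split=> //.
    - by apply: consistent_frame cm => // -[].
    - split=> //; rewrite /= /store /=; first by rewrite cardT addnC addnK.
      by rewrite sumT addrC addKr.
  split=> //; split=> //; rewrite /= /store /=.
  - by rewrite t2 cardT.
  - by rewrite t3 sumT add0r.
move=> m2 [st2 cm2 tm2 e8 [e13 r1]].
have pos2 j : j \in S -> icell m2 8 j = sl j by rewrite e8; exact: pos.
apply: wp_seq; apply: wp_weaken; first apply: wp_frame;
  first apply: (wp_remove inst table query st2 cm2 iS pos2 e13 SM SW (ltnW nW) (ltnW nM) W2).
- by [].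
move=> m3 [[sl' [st3 cm3 pos3]] [Hi Hr]].
have kp : kept W M (S :\ i)%SET (S :\ i)%SET (T :\ i)%SET sl' m3.
  split=> //.
    by apply: tallied_frame tm2; rewrite ?Hi ?Hr.
  by rewrite Hr // r1 /= /store /= (big_setD1 i iS) /= addrAC subrr add0r.
apply: wp_weaken; first apply: (wp_kept_rebalance _ _ M0 _ _ W2 KW kp).
- by rewrite cS; apply: leq_ltn_trans SM; exact: leq_pred.
- by rewrite cS; apply: leq_trans SW; exact: leq_pred.
(* Removing a member of [T] leaves a vacancy but keeps the order; removing an outsider leaves [T]
   full and ordered. *)
- have cardS := cardsD1 i S; rewrite iS /= in cardS.
  case: (boolP (i \in T)) => iT; rewrite ?iT ?(negbTE iT) /= in cardT.
    left; split; first by move: TKr; rewrite cardT.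
    have [SK|KS] := leqP #|S| (rank x).
      left; have ST : S \subset T.
        have : #|T| = #|S| by rewrite cT; apply/minn_idPr.
        by move=> e1; have := subset_leqif_cards TS => -[_]; rewrite e1 eqxx => /esym/eqP ->.
      rewrite (_ : _ :\: _ = finset.set0) ?cards0 //.
      apply/setP => j; rewrite !inE; case: eqP => //= _.
      by apply/negP => /andP[/negP h /(fintype.subsetP ST)].
    right; split; first by rewrite -add1n -cardT cT; apply/minn_idPl; exact: ltnW.
    move=> t u; rewrite !inE => /andP[_ tT] /andP[ui uS]; rewrite ui /= => uT _.
    by apply: oT => //; rewrite inE.
  right; split.
    rewrite -[LHS]add0n -cardT cT; apply/minn_idPl; rewrite leqNgt; apply: contra iT => SK.
    have : #|T| = #|S| by rewrite cT; apply/minn_idPr; exact: ltnW.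
    by move=> e1; have := subset_leqif_cards TS => -[_]; rewrite e1 eqxx => /esym/eqP ->.
  exists finset.set0; first by rewrite cards0.
  move=> t u; rewrite !inE => /andP[_ tT] /andP[ui uS]; rewrite ui /= => uT _.
  by apply: oT => //; rewrite inE.
- by rewrite cS leq_add2r leq_mul2l leq_trunc_log ?leq_pred ?orbT.
by move=> m4 [T' [k1 k2 k3 k4]]; exists T', sl'; split=> // j jS; rewrite k2 pos3.
Qed.

(** The trees may have one slot more than the number inside the logarithm of the time bound, which
    is the size of the route before an insertion or the integral part of [Gamma]. *)
Lemma trunc_logS_le k : trunc_log 2 k.+1 <= (trunc_log 2 k).+1.
Proof.
case: k => // k; rewrite -trunc_log2_double //; apply: leq_trunc_log.
by rewrite -addnn; lia.
Qed.

Lemma cardinality_inst_size x :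
  inst_size (cardinality_problem x) = 1 + (G_n x + G_n x + 1).
Proof. by rewrite /inst_size /= !size_vec; lia. Qed.

Lemma cardinality_incremental :
  incremental (@cardinality_problem R) true (fun x k => log2 k) (fun x => G_n x).
Proof.
apply: (@incrementalI R _ (@cardinality_problem R) _ _ _ rank_cmd
  (fun b => cardinality_update b customer_arg) 200
  (fun x => cardinality_inv (bigO 200 (inst_size (cardinality_problem x))) (bigO 200 (G_n x))))
  => x ux inst W M E0.
have EW : W = 200 * (1 + (G_n x + G_n x + 1)).+1.
  by rewrite /W /bigO cardinality_inst_size.
have EM : M = 200 * (G_n x).+1 by [].
rewrite -/W -/M; clearbody W M; split.
- apply: (wp_weaken (wp_rank (W := W) (M := M) _ _ _ _)); try lia.
  move=> m [m2 mi mr]; have [st cm] := stored0 x W M mi mr.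
  exists finset.set0, (fun => 0); split.
  + split=> //; last by rewrite mr big_set0.
    by split=> //; rewrite ?mi ?mr ?cards0 ?big_set0.
  + by move=> i; rewrite inE.
  + by split=> [|t]; rewrite ?cards0 ?minn0 // inE.
  + by left; rewrite finset.sub0set /output !mr big_set0 addr0.
- move=> S m [T [sl [[[TS _ _ _ _] _ _ base] _ bal rep]]].
  exact: kept_worst_case TS (fintype.subxx _) _ _ _ rep.
- move=> [] S m i _ IS iS ei.
    apply: wp_weaken; first apply: (wp_cardinality_add _ _ _ IS _ ei); try lia.
    + by rewrite iS.
    + rewrite /bigO /log2; have := trunc_logS_le #|S|.
      by move: (trunc_log 2 #|S|.+1) (trunc_log 2 #|S|) => a b; clear; lia.
    + by [].
  apply: wp_weaken; first apply: (wp_cardinality_remove _ _ _ IS iS ei); try lia.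
  + by rewrite /bigO /log2; move: (trunc_log 2 #|S|) => a; clear; lia.
  + by [].
Qed.

(** * Additions only *)

Definition discarded x (S C : {set 'I_(G_n x)}) : Prop :=
  S <> C -> #|C| = (rank x).+1 /\
    forall j c, j \in S -> j \notin C -> c \in C -> (dev j <= dev c)%R.

(** Array [8] is absent, since no slot has to be found from a customer; all slots in use then lie in
    [1..rank x + 1]. *)
Definition addition_inv x W M (S : {set 'I_(G_n x)}) m : Prop :=
  exists C T sl, [/\ kept W M S C T sl m, C \subset S /\ #|C| <= (rank x).+1, discarded S C,
    balanced (@dev x) (rank x) C T & reports (@dev x) (G_Gamma x) (rank x) C T m].

(* When customers are never removed, only the [rank x + 1] greatest deviations
   of the route can matter, now or later. *)
Definition addition_cmd (e : iexp) : cmd :=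
  Seq (setr0 1 (RAdd (wr 1) (RGet Inst 0 e)))
 (Seq (If (BLeI (wi 1) (wi 2)) (append_cmd e)
         (Seq (seti0 11 (IGet Work (best_slot false) (ILit 1)))
              (If (BLeR (RGet Inst 1 e) (RGet Work (best_value false) (ILit 1))) Skip
                  (replace_cmd e))))
      rebalance_cmd).

(** Once [C] is full, a single customer [w] lies outside [T], and it is least in [C]. A newcomer no
    greater than [w] is discarded, any other takes the slot of [w]; in both cases all that is
    dropped is dominated by all that stays. *)
Lemma wp_addition x table query W M (S : {set 'I_(G_n x)}) i e m :
  let inst := inst_memory (cardinality_problem x) in
  (rank x).+1 < M -> G_n x < W -> 2 <= W -> addition_inv W M S m -> i \notin S ->
  evaluates inst table query m e i ->
  wp inst table query W M (addition_cmd e) m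
    (60 * trunc_log 2 (rank x).+1 + 100) (addition_inv W M (i |: S)%SET).
Proof.
move=> inst KM nW W2 [C [T [sl [[st cm tm bm] [CS CK] disc [cT oT] _]]]] iS ei.
have [TC kC Hs _ _] := st.
have M0 : 0 < M by lia.
have iC : i \notin C by apply: contra iS; exact: (fintype.subsetP CS).
have iT : i \notin T by apply: contra iC; exact: (fintype.subsetP TC).
have KW : (rank x).+1 <= W by apply: leq_trans nW; rewrite ltnS; exact: rank_le.
have CM : #|C| < M by apply: leq_ltn_trans KM.
have CW : #|C| <= W by apply: leq_trans KW.
set L := trunc_log 2 (rank x).+1.
have logL (C' : {set 'I_(G_n x)}) : #|C'| <= (rank x).+1 -> trunc_log 2 #|C'| <= L.
  exact: leq_trunc_log.
apply: (@wp_weaken _ _ _ _ _ _ _ _ (1 + ((20 * L + 29).+1 + (40 * L + 60))));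
  [|by lia|by move=> m'; apply].
apply: wp_seq; apply: wp_lf => /=; rewrite ei // nth_vec bm; split=> //.
set m1 := setr _ 1 0 _.
have st1 : stored (@dev x) C T sl m1 by exact: stored_frame st.
have cm1 : consistent W M m1 by apply: consistent_frame cm => // -[].
have ei1 : evaluates inst table query m1 e i by move=> m' e0; apply: ei; rewrite e0.
have tm1 : tallied (@dev x) (rank x) T m1 by exact: tallied_frame tm.
have base1 : rcell m1 1 0 = (\sum_(j in (i |: S)%SET) G_q0 x j ord0)%R.
  by rewrite /= /store /= big_setU1 // addrC.
have done_ (C' : {set 'I_(G_n x)}) sl' m' : C' \subset (i |: S)%SET -> #|C'| <= (rank x).+1 ->
    discarded (i |: S)%SET C' -> nearly_balanced (@dev x) (rank x) C' T ->
    kept W M (i |: S)%SET C' T sl' m' ->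
    wp inst table query W M rebalance_cmd m' (40 * L + 60) (addition_inv W M (i |: S)%SET).
  move=> C'S C'K disc' near' kp'.
  apply: wp_weaken; first apply: (wp_kept_rebalance _ _ M0 _ _ W2 _ kp' near').
  - exact: leq_ltn_trans KM.
  - exact: leq_trans KW.
  - exact: ltnW.
  - by rewrite leq_add2r leq_mul2l logL ?orbT.
  by move=> m2 [T' [k1 _ k3 k4]]; exists C', T', sl'.
pose Q (m2 : memory R) := exists (C' : {set 'I_(G_n x)}) (sl' : 'I_(G_n x) -> nat),
  [/\ C' \subset (i |: S)%SET /\ #|C'| <= (rank x).+1, discarded (i |: S)%SET C',
    nearly_balanced (@dev x) (rank x) C' T & kept W M (i |: S)%SET C' T sl' m2].
apply: wp_seq; apply: (wp_weaken (Q := Q) _ (leqnn _)); last first.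
  by move=> m2 [C' [sl' [[h1 h2] h3 h4 h5]]]; exact: done_ h5.
have [tK tc tsum] := tm1.
(* Below [rank x + 1] kept customers nothing has been discarded yet, so [S = C]. *)
apply: wp_if; rewrite /= kC [icell m 2 0]tK; case: leqP => CrK.
  have eS : S = C by apply: contrapT => /disc[e1 _]; rewrite e1 ltnn in CrK.
  have cC : #|(i |: C)%SET| = #|C|.+1 by rewrite cardsU1 iC.
  apply: wp_weaken; first apply: wp_frame;
    first apply: (wp_append (@nth_dev x) st1 cm1 iC _ _ (ltnW nW) W2 (e := e)) => //.
  - by apply: leq_ltn_trans KM.
  - by apply: leq_trans KW.
  - have : trunc_log 2 #|C|.+1 <= L by rewrite -cC logL // cC.
    by move: (trunc_log 2 #|C|.+1) => l; lia.
  move=> m2 [[st2 cm2] [Hi Hr]].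
  exists (i |: C)%SET, (fun j => if j == i then #|C|.+1 else sl j); split.
  - by rewrite eS cC; split.
  - by rewrite eS => /(_ erefl).
  - have [TK|TK] := ltnP #|T| (rank x).
      left; split=> //; left.
      have CT : C \subset T.
        have : #|T| = #|C| by rewrite cT; apply/minn_idPr.
        by move=> e1; have := subset_leqif_cards TC => -[_]; rewrite e1 eqxx => /esym/eqP ->.
      apply: leq_trans (_ : #|[set i]%SET| <= 1); last by rewrite cards1.
      apply: subset_leq_card; apply/fintype.subsetP => j; rewrite !inE => /andP[jT].
      by case/predU1P => [->//|/(fintype.subsetP CT)]; rewrite (negbTE jT).
    right; split; first by apply/eqP; rewrite eqn_leq TK andbT cT geq_minl.
    exists [set i]%SET; first by rewrite cards1.
    move=> t u tT; rewrite !inE => /predU1P[->|uS] uT ui; first by rewrite eqxx in ui.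
    by apply: oT => //; rewrite inE.
  - split=> //; last by rewrite Hr.
    by apply: tallied_frame tm1; rewrite ?Hi ?Hr.
have {CK CrK} CK : #|C| = (rank x).+1 by apply/eqP; rewrite eqn_leq CK.
have cTK : #|T| = rank x by rewrite cT CK; apply/minn_idPl.
apply: (@wp_weaken _ _ _ _ _ _ _ _ (1 + (20 * L + 26).+1)); [|by lia|by move=> m'; apply].
apply: wp_seq; apply: wp_lf => /=; split=> //.
  by have [bmm _] := cm; have [] := bmm false 1.
set m2 := seti m1 11 0 _.
have st2 : stored (@dev x) C T sl m2 by exact: stored_frame st.
have cm2 : consistent W M m2 by apply: consistent_frame cm => // -[].
have ei2 : evaluates inst table query m2 e i by move=> m' e0; apply: ei; rewrite e0.
have tm2 : tallied (@dev x) (rank x) T m2 by exact: tallied_frame tm.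
have [w [wC wT sw vw wonly]] : exists w, [/\ w \in C, w \notin T,
    icell m (best_slot false) 1 = sl w, rcell m (best_value false) 1 = dev w &
    forall j, j \in C -> j \notin T -> j = w].
  case: (stored_root false st cm) => [[_ allT]|[w [wC /negbT wT sw vw _]]].
    have : #|C| <= #|T|.
      by apply: subset_leq_card; apply/fintype.subsetP => j jC; rewrite allT.
    by rewrite CK cTK ltnn.
  exists w; split=> // j jC jT; have CT1 : #|C :\: T| <= 1.
    by rewrite cardsDS // CK cTK subSn // subnn.
  by apply: (card_le1_eqP CT1); rewrite inE ?jT ?wT.
have w_least c : c \in C -> (dev w <= dev c)%R.
  move=> cC; have [cT'|cT'] := boolP (c \in T); last by rewrite (wonly c).
  by apply: oT => //; rewrite inE.
apply: wp_if; rewrite [beval _ _](_ : _ = (dev i <= dev w)%R); last first.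
  by rewrite /= ei2 // nth_vec -vw.
case: leP => [iw|wi_].
  apply: wp_skip; first by lia.
  exists C, sl; split.
  - split; last by rewrite CK.
    by apply: fintype.subset_trans CS _; exact: finset.subsetUr.
  - move=> _; split=> // j c; rewrite !inE => /predU1P[->|jS] jC cC.
      exact: le_trans iw (w_least c cC).
    have [|_ d] := disc; first by move=> e1; rewrite -e1 jS in jC.
    exact: d.
  - right; split=> //; exists finset.set0; rewrite ?cards0 //.
  - by split.
apply: wp_weaken; first apply: wp_frame;
  first apply: (wp_replace (@nth_dev x) st2 cm2 iC wC wT _ CM CW (ltnW nW) ei2) => //.
- by have := logL C; rewrite CK leqnn => /(_ isT); move: (trunc_log 2 _) => l; lia.
have cC : #|(i |: C :\ w)%SET| = (rank x).+1.
  by rewrite cardsU1 !inE (negbTE iC) andbF /= -CK (cardsD1 w C) wC.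
move=> m3 [[st3 cm3] [Hi Hr]].
exists (i |: C :\ w)%SET, (fun j => if j == i then sl w else sl j); split.
- split; last by rewrite cC.
  apply/fintype.subsetP => j; rewrite !inE => /predU1P[->|/andP[_ /(fintype.subsetP CS)->]].
    by rewrite eqxx.
  by rewrite orbT.
- move=> _; split=> // j c; rewrite !inE => /predU1P[->|jS] jC cC'.
    by rewrite eqxx in jC.
  have jw : (dev j <= dev w)%R.
    have [jC'|jC'] := boolP (j \in C).
      by move: jC; rewrite jC' andbT negb_or negbK => /andP[_ /eqP ->].
    have [|_ d] := disc; first by move=> e1; rewrite -e1 jS in jC'.
    exact: d.
  apply: (le_trans jw); case/predU1P: cC' => [->|/andP[_ cC']]; first exact: ltW.
  exact: w_least.
- right; split=> //; exists [set i]%SET; first by rewrite cards1.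
  move=> t u tT; rewrite !inE => /predU1P[->|/andP[uw uC]] uT ui; first by rewrite eqxx in ui.
  by move: uw; rewrite (wonly u uC uT) eqxx.
- split=> //; last by rewrite Hr.
  by apply: tallied_frame tm2; rewrite ?Hi ?Hr.
Qed.

Lemma cardinality_additions :
  incremental (@cardinality_problem R) false
    (fun x k => log2 (Num.truncn (G_Gamma x))) (fun x => Num.truncn (G_Gamma x)).
Proof.
apply: (@incrementalI R _ (@cardinality_problem R) _ _ _ rank_cmd
  (fun=> addition_cmd customer_arg) 200
  (fun x => addition_inv (bigO 200 (inst_size (cardinality_problem x))) (bigO 200 (rank x))))
  => x ux inst W M E0.
have EW : W = 200 * (1 + (G_n x + G_n x + 1)).+1.
  by rewrite /W /bigO cardinality_inst_size.
have EM : M = 200 * (rank x).+1 by [].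
rewrite -/W -/(rank x) -/M; clearbody W M; split.
- apply: (wp_weaken (wp_rank (W := W) (M := M) _ _ _ _)); try lia.
  move=> m [m2 mi mr]; have [st cm] := stored0 x W M mi mr.
  exists finset.set0, finset.set0, (fun => 0); split.
  + split=> //; last by rewrite mr big_set0.
    by split=> //; rewrite ?mi ?mr ?cards0 ?big_set0.
  + by rewrite finset.sub0set cards0.
  + by [].
  + by split=> [|t]; rewrite ?cards0 ?minn0 // inE.
  + by left; rewrite finset.sub0set /output !mr big_set0 addr0.
- move=> S m [C [T [sl [[[TC _ _ _ _] _ _ base] [CS _] disc bal rep]]]].
  exact: kept_worst_case TC CS bal disc base rep.
- move=> [] // S m i _ IS iS ei.
  apply: wp_weaken; first apply: (wp_addition _ _ _ IS _ ei); try lia.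
  + by rewrite iS.
  + rewrite /bigO /log2 -/(rank x); have := trunc_logS_le (rank x).
    by move: (trunc_log 2 (rank x).+1) (trunc_log 2 (rank x)) => a b; clear; lia.
  + by [].
Qed.

End CardinalityIncremental.

Theorem proposition2 (R : realType) :
  (* budget sets *)
  ((exists pre : cmd,
      from_scratch (@budget_problem R) pre (fun x k => k)) /\
   incremental (@budget_problem R) true (fun x k => 1%N) (fun x => B_L x)) /\
  (* factor models *)
  (from_scratch (@factor_problem R) Skip
     (fun x k => (k * F_F x + F_F x * log2 (F_F x))%N) /\
   incremental (@factor_problem R) true
     (fun x k => (F_F x * log2 (F_F x))%N) (fun x => F_F x)) /\
  (* axis-parallel ellipsoids *)
  (from_scratch (@axis_ellipsoid_problem R) Skip (fun x k => k) /\
   incremental (@axis_ellipsoid_problem R) true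
     (fun x k => 1%N) (fun x => 1%N)) /\
  (* general ellipsoids *)
  (from_scratch (@ellipsoid_problem R) Skip (fun x k => (k * E_n x)%N) /\
   incremental (@ellipsoid_problem R) true
     (fun x k => E_n x) (fun x => E_n x)) /\
  (* cardinality-constrained sets *)
  (from_scratch (@cardinality_problem R) Skip (fun x k => k) /\
   incremental (@cardinality_problem R) true
     (fun x k => log2 k) (fun x => G_n x) /\
   incremental (@cardinality_problem R) false
     (fun x k => log2 (Num.truncn (G_Gamma x)))
     (fun x => Num.truncn (G_Gamma x))) /\
  (* discrete sets *)
  (from_scratch (@discrete_problem R) Skip (fun x k => (k * D_D x)%N) /\
   incremental (@discrete_problem R) true
     (fun x k => D_D x) (fun x => D_D x)).
Proof.
split; first by split; [exists budget_init; exact: budget_from_scratch|exact: budget_incremental].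
split; first by split; [exact: factor_from_scratch|exact: factor_incremental].
split; first by split; [exact: axis_from_scratch|exact: axis_incremental].
split; first by split; [exact: ellipsoid_from_scratch|exact: ellipsoid_incremental].
split; last by split; [exact: discrete_from_scratch|exact: discrete_incremental].
split; first exact: cardinality_from_scratch.
split; [exact: cardinality_incremental|exact: cardinality_additions].
Qed.
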